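(* Let $\mathcal F$ be a convex Zhegalkin zebra function and $\Lambda\subset\mathrm{Aut}(\mathcal F)$ a sublattice such that the superpotential $[\mathcal F]_\Lambda=(\mathcal E_\Lambda,\sigma_0,\sigma_1)$ is dimer complete and admits a weight realization. Let $\mathcal M_\Lambda$ be the set of perfect matchings, $\mathcal A_\Lambda=\mathcal M_\Lambda/{\sim}$, $\mathcal W_\Lambda$ the semi-group of integer weight functions and $\overline{\mathcal W}_\Lambda=\mathcal W_\Lambda/{\sim}$. Then: (i) The matching polytope $\mathrm{conv}(\mathcal M_\Lambda)\subset\mathbb R^{\mathcal E_\Lambda}$ equals $$\Big\{\theta:\mathcal E_\Lambda\to\mathbb R_{\ge 0}\ \Big|\ \sum_{e:\,w(e)=\mathbf w}\theta(e)=\sum_{e:\,b(e)=\mathbf b}\theta(e)=1\ \text{ for all }\mathbf w\in P_\Lambda^\circ,\ \mathbf b\in P_\Lambda^\bullet\Big\},$$ and the set of its vertices is precisely $\mathcal M_\Lambda$. (ii) The semi-group $\mathcal W_\Lambda$ is generated by the perfect matchings and the semi-group $\overline{\mathcal W}_\Lambda$ is generated by $\mathcal A_\Lambda$: $$\mathcal W_\Lambda=\mathbb Z_{\ge0}\mathcal M_\Lambda,\qquad \overline{\mathcal W}_\Lambda=\mathbb Z_{\ge 0}\mathcal A_\Lambda .$$ (iii) The matching polytope $\mathrm{conv}(\mathcal M_\Lambda)$ has dimension $|P_\Lambda^\star|+1$ and the Newton polygon $\mathrm{conv}(\mathcal A_\Lambda)$ has dimension $2$.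
   Context: **Zhegalkin zebra functions.** For $\mathfrak v\in\mathbb R^2\setminus\{0\}$ put $Z^{\mathfrak v}:\mathbb R^2\to\mathbb F_2$, $Z^{\mathfrak v}(x)=\lfloor 2\,x\cdot\mathfrak v\rfloor \bmod 2$. Identify $\mathbb R^2=\mathbb C$, let $\varepsilon=e^{\pi i/6}$ and $\mathfrak v_1=\sqrt3\varepsilon^5,\ \mathfrak v_2=\varepsilon^4,\ \mathfrak v_3=\sqrt3 i,\ \mathfrak v_4=\varepsilon^2,\ \mathfrak v_5=\sqrt3\varepsilon,\ \mathfrak v_6=1$. A Zhegalkin zebra function is an element $\mathcal F$ of the ring of $\mathbb F_2$-valued functions on $\mathbb R^2$ generated by the $Z^{k\mathfrak v_j}$ ($k\in\mathbb Z_{>0}$, $1\le j\le 6$). It gives a tiling of the plane by white ($\mathcal F=0$) and black ($\mathcal F=1$) polygons; $\mathcal F$ is convex if all these polygons are bounded and convex. $\mathrm{Aut}(\mathcal F)=\{\tau\in\mathbb R^2: \mathcal F(x+\tau)=\mathcal F(x)\ \forall x\}$ is then a lattice in $\mathbb R^2$; ''sublattice'' means of rank 2. **Superpotential.** Let $\mathcal E$ be the set of edges of the tiling (vertices are the points where at least four edges meet), each oriented so that boundaries of black polygons run clockwise and of white polygons counter-clockwise. For $e\in\mathcal E$ let $\sigma_0(e)$ (resp. $\sigma_1(e)$) be the edge following $e$ on the boundary of the white (resp. black) polygon adjacent to $e$. Let $\mathcal E_\Lambda=\mathcal E/\Lambda$ (finite), with induced permutations $\sigma_0,\sigma_1$;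 $[\mathcal F]_\Lambda=(\mathcal E_\Lambda,\sigma_0,\sigma_1)$ is the superpotential. $P^\circ_\Lambda,P^\bullet_\Lambda,P^\star_\Lambda$ denote the sets of white polygons, black polygons, vertices of the induced tiling of $\mathbb R^2/\Lambda$ (equivalently the cycles of $\sigma_0$, $\sigma_1$, $\sigma_1^{-1}\sigma_0$). For $e\in\mathcal E_\Lambda$: $w(e)\in P^\circ_\Lambda$, $b(e)\in P^\bullet_\Lambda$ are its adjacent white and black polygon, $s(e),t(e)\in P^\star_\Lambda$ its source and target. **Weights.** An integer weight function is a map $\nu:\mathcal E_\Lambda\to\mathbb Z_{\ge0}$ whose sum over each cycle of $\sigma_0$ and each cycle of $\sigma_1$ equals one and the same integer $\deg\nu$; it is positive if all $\nu(e)>0$. They form a graded semi-group $\mathcal W_\Lambda$ under addition. Perfect matchings are those of degree $1$; $\mathcal M_\Lambda$ is their set. $[\mathcal F]_\Lambda$ is dimer complete if $\sum_{\mathsf m\in\mathcal M_\Lambda}\mathsf m$ is positive. **Weight realizations.** A realization of $[\mathcal F]_\Lambda$ is a map $\omega:\mathcal E_\Lambda\to\mathbb R^2\setminus\{0\}$ such that drawing each edge as the vector $\omega(e)$ (lifted to $\mathcal E$) gives a tiling of $\mathbb R^2$ by polygons with the same combinatorics (white/black polygons being the cycles of $\sigma_0$/$\sigma_1$, traversed counter-clockwise/clockwise), $\Lambda$ acting by a lattice $\Lambda_\omega$ of translations. Given $\theta:\mathcal E_\Lambda\to\mathbb R_{>0}$ with sum $1$ over every cycle of $\sigma_0$ and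 of $\sigma_1$, mark in each polygon the convex combination, with coefficients $\theta(e)$, of the midpoints of its edges $e$; the quadrangle of an edge has as vertices the two endpoints of the edge and the marked points of its two adjacent polygons. A weight realization is a triple of positive weight functions $(\nu_1,\nu_2,\nu_3)$ such that $\omega=(\nu_1-\nu_3,\nu_2-\nu_3)$ is a realization for which all polygons and all quadrangles (with $\theta=\frac1{\deg\nu_3}\nu_3$) are strictly convex. **Equivalence.** For $\mathbf v\in P^\star_\Lambda$ let $\alpha_{\mathbf v}:\mathcal E_\Lambda\to\mathbb Z$, $\alpha_{\mathbf v}(e)=[t(e)=\mathbf v]-[s(e)=\mathbf v]$. For $\nu,\nu'\in\mathcal W_\Lambda$: $\nu\sim\nu'$ iff $\nu-\nu'$ is a $\mathbb Z$-linear combination of the $\alpha_{\mathbf v}$. The matching polytope is the convex hull $\mathrm{conv}(\mathcal M_\Lambda)$ in $\mathbb R^{\mathcal E_\Lambda}$; the Newton polygon $\mathrm{conv}(\mathcal A_\Lambda)$ is the convex hull of (the image of) $\mathcal A_\Lambda$ in $\mathbb R^{\mathcal E_\Lambda}/\mathrm{span}_{\mathbb R}\{\alpha_{\mathbf v}\}$. *)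

(* Defs.v *)
From HB Require Import structures.
From mathcomp Require Import all_boot all_order all_fingroup all_algebra.
From mathcomp Require Import complex.
From mathcomp Require Import all_classical all_reals all_analysis.

Set Implicit Arguments.
Unset Strict Implicit.
Unset Printing Implicit Defensive.

Import Order.TTheory GRing.Theory Num.Theory.
Import numFieldNormedType.Exports.

Local Open Scope classical_set_scope.
Local Open Scope ring_scope.

Section Convexity.
Variables (R : realType) (V : lmodType R).

Definition conv (S : set V) : set V :=
  smallest [set A | convex_set (M := V) A] S.

Definition segment (a b : V) : set V :=
  [set (1 - t) *: a + t *: b | t in [set t : R | 0 <= t <= 1]].

Definition open_segment (a b : V) : set V :=
  [set (1 - t) *: a + t *: b | t in [set t : R | 0 < t < 1]].

(* The extreme points; for a polytope these are its vertices. *)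
Definition extreme_points (P : set V) : set V :=
  [set x | P x /\
     forall a b, P a -> P b -> open_segment a b x -> a = x /\ b = x].

End Convexity.

(* [d] is the dimension of the affine hull of the nonempty set [S]: [U] is the
   least linear subspace containing all differences of points of [S]. *)
Definition has_dim (R : realType) (V : vectType R) (S : set V) (d : nat) :=
  S !=set0 /\
  exists U : {vspace V},
    [/\ \dim U = d,
        forall x y, S x -> S y -> x - y \in U
      & forall U' : {vspace V},
          (forall x y, S x -> S y -> x - y \in U') -> (U <= U')%VS].

(* Z_{>=0} S: all finite sums, the empty one included. *)
Definition Nspan (V : nmodType) (S : set V) : set V :=
  [set \sum_(x <- l) x | l in [set l : seq V | forall x, x \in l -> S x]].

Notation plane R := 'rV[R]_2.

Section Plane.
Variable R : realType.
Local Notation plane := (plane R).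

Definition mkpt (a b : R) : plane := \row_(i < 2) (if i == 0 then a else b).
Definition dot (x y : plane) : R := x 0 0 * y 0 0 + x 0 1 * y 0 1.
Definition det2 (x y : plane) : R := x 0 0 * y 0 1 - x 0 1 * y 0 0.
(* Counter-clockwise rotation by a right angle. *)
Definition rot90 (x : plane) : plane := mkpt (- x 0 1) (x 0 0).

Definition lattice (L : set plane) : Prop :=
  exists a b : plane, det2 a b != 0 /\
    L = [set x | exists m n : int, x = a *~ m + b *~ n].

(* The points of [s], in this cyclic order, are the corners of a strictly
   convex polygon traversed counter-clockwise: every corner not on a given
   side lies strictly to the left of that side. *)
Definition ccw_convex (s : seq plane) : Prop :=
  (3 <= size s)%N /\
  forall i j : nat, (i < size s)%N -> (j < size s)%N ->
    j != i -> j != (i.+1 %% size s)%N ->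
    0 < det2 (nth 0 s (i.+1 %% size s) - nth 0 s i) (nth 0 s j - nth 0 s i).

End Plane.

Section Zebra.
Variable R : realType.
Local Notation plane := (plane R).
Local Notation C := (complex R).

Definition complex_pt (z : C) : plane := mkpt (complex.Re z) (complex.Im z).

Definition eps : C := Complex (cos (pi / 6)) (sin (pi / 6)).
Definition sqrt3 : C := Complex (Num.sqrt 3) 0.

Definition zebra_dirs : seq C :=
  [:: sqrt3 * eps ^+ 5; eps ^+ 4; sqrt3 * Complex 0 1;
      eps ^+ 2; sqrt3 * eps; 1].

(* The cast from int to 'F_2 is reduction modulo 2. *)
Definition zebra_gen (v x : plane) : 'F_2 := (Num.floor (2 * dot x v))%:~R.

(* The (unital) subring of 'F_2-valued functions generated by the Z^{k v_j};
   opposites are not needed in characteristic 2. *)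
Inductive zebra : (plane -> 'F_2) -> Prop :=
| zebra_base (k : nat) (v : C) : (0 < k)%N -> v \in zebra_dirs ->
    zebra (zebra_gen (k%:R *: complex_pt v))
| zebra_one : zebra (fun=> 1)
| zebra_add F G : zebra F -> zebra G -> zebra (fun x => F x + G x)
| zebra_mul F G : zebra F -> zebra G -> zebra (fun x => F x * G x).

Variable F : plane -> 'F_2.

Definition zAut : set plane := [set tau | forall x, F (x + tau) = F x].

(* Values of [F] on the boundary lines are an artefact of the floor function,
   so regions are taken in the interior of a level set. *)
Definition region (c : 'F_2) : set plane := [set x | F x = c]°.

(* The polygons of colour [c] (white is 0, black is 1): closures of the
   connected components of the region.  Two polygons of the same colour that
   touch in a corner are thus different. *)
Definition tile (c : 'F_2) : set (set plane) :=
  [set closure (connected_component (region c) x) | x in region c].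

Definition tiles : set (set plane) := tile 0 `|` tile 1.

Definition zebra_convex : Prop :=
  forall T, tiles T -> bounded_set T /\ convex_set T.

Definition skeleton : set plane := ~` (region 0 `|` region 1).

(* Unit directions in which an edge leaves [x]. *)
Definition edge_direction (x u : plane) : Prop :=
  dot u u = 1 /\ \forall r \near (0 : R)^'+, skeleton (x + r *: u).

Definition vertex : set plane :=
  [set x | exists2 u : 'I_4 -> plane,
     injective u & forall i, edge_direction x (u i)].

(* An edge is the pair (source, target); its orientation has white on the left
   and black on the right, i.e. white polygons run counter-clockwise and black
   ones clockwise. *)
Definition edge : set (plane * plane) :=
  [set e | [/\ vertex e.1, vertex e.2, e.1 <> e.2
     & forall x, open_segment e.1 e.2 x ->
        [/\ ~ vertex x,
            \forall r \near (0 : R)^'+, region 0 (x + r *: rot90 (e.2 - e.1))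
          & \forall r \near (0 : R)^'+,
              region 1 (x - r *: rot90 (e.2 - e.1))]]].

(* [e'] follows [e] on the boundary of the polygon of colour [c] at [e]. *)
Definition follows (c : 'F_2) (e e' : plane * plane) : Prop :=
  [/\ edge e, edge e', e'.1 = e.2
    & exists T, [/\ tile c T, segment e.1 e.2 `<=` T
                  & segment e'.1 e'.2 `<=` T]].

(* The finite quotient of the edges by the translations in [L]: the fibres of
   [eproj] over [eclass] are the L-orbits of edges (values of [eproj] on other
   pairs of points are irrelevant).  This determines
   (eclass, sigma0, sigma1) up to isomorphism. *)
Record superpotential (L : set plane) := Superpotential {
  eclass : finType;
  eproj : plane * plane -> eclass;
  sigma0 : {perm eclass};
  sigma1 : {perm eclass};
  eproj_surj : forall x, exists2 e, edge e & eproj e = x;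
  eproj_eq : forall e e', edge e -> edge e' ->
    (eproj e = eproj e' <->
     exists2 l, L l & e' = (e.1 + l, e.2 + l));
  sigma0P : forall e e', follows 0 e e' -> sigma0 (eproj e) = eproj e';
  sigma1P : forall e e', follows 1 e e' -> sigma1 (eproj e) = eproj e' }.

End Zebra.

Section Weights.
Variables (E : finType) (s0 s1 : {perm E}).

Definition Pwhite : {set {set E}} := porbits s0.
Definition Pblack : {set {set E}} := porbits s1.
(* Products in {perm E} apply the left factor first, so this is
   s1^{-1} o s0 in functional notation. *)
Definition vperm : {perm E} := (s0 * s1^-1)%g.
Definition Pstar : {set {set E}} := porbits vperm.

Definition wpoly (e : E) : {set E} := porbit s0 e.
Definition bpoly (e : E) : {set E} := porbit s1 e.
(* A vertex is identified with the set of edges having it as target: [vperm]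
   sends [e] to the edge before [s0 e] on its black polygon, which has the
   target of [e].  The source of [e] is the target of the edge before [e]. *)
Definition target (e : E) : {set E} := porbit vperm e.
Definition source (e : E) : {set E} := porbit vperm (s0^-1%g e).

Definition is_weight (d : nat) (nu : {ffun E -> nat}) : Prop :=
  (forall w, w \in Pwhite -> (\sum_(e in w) nu e)%N = d) /\
  (forall b, b \in Pblack -> (\sum_(e in b) nu e)%N = d).

Definition weights : set {ffun E -> nat} := [set nu | exists d, is_weight d nu].
Definition matchings : set {ffun E -> nat} := [set nu | is_weight 1 nu].

Definition positive (nu : {ffun E -> nat}) : Prop := forall e, (0 < nu e)%N.

Definition dimer_complete : Prop := positive (\sum_(m \in matchings) m).

Definition alpha (v : {set E}) : {ffun E -> int} :=
  [ffun e => (target e == v)%:Z - (source e == v)%:Z].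

Definition to_int (nu : {ffun E -> nat}) : {ffun E -> int} :=
  [ffun e => (nu e)%:Z].

Definition alpha_lattice : {pred {ffun E -> int}} :=
  fun x => `[< exists c : {set E} -> int,
                 x = \sum_(v in Pstar) alpha v *~ c v >].

Definition weight_sim (nu nu' : {ffun E -> nat}) : Prop :=
  to_int nu - to_int nu' \in alpha_lattice.

Fact alpha_lattice_zmod : zmod_closed alpha_lattice.
Proof.
split=> [|x y].
  rewrite unfold_in; apply/asboolP; exists (fun=> 0).
  by rewrite big1 // => v _; rewrite mulr0z.
rewrite !unfold_in => /asboolP [c ->] /asboolP [d ->].
apply/asboolP; exists (fun v => c v - d v).
by rewrite -sumrB; apply: eq_bigr => v _; rewrite mulrzBr.
Qed.
HB.instance Definition _ :=
  GRing.isZmodClosed.Build {ffun E -> int} alpha_lattice alpha_lattice_zmod.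

(* Quotients by ~ are formed inside the group Z^E / sum_v Z alpha_v. *)
Definition weight_group : zmodType := Quotient.quot alpha_lattice.

Definition wclass (nu : {ffun E -> nat}) : weight_group :=
  (\pi_(Quotient.quot alpha_lattice) (to_int nu))%qT.

Lemma wclassP nu nu' : wclass nu = wclass nu' <-> weight_sim nu nu'.
Proof.
by rewrite /weight_sim Quotient.idealrBE; split=> [|/eqP] // H; apply/eqP.
Qed.

Definition weight_classes : set weight_group := wclass @` weights.
Definition matching_classes : set weight_group := wclass @` matchings.

Section Real.
Variable R : realType.

Definition to_real (nu : {ffun E -> nat}) : {ffun E -> R^o} :=
  [ffun e => (nu e)%:R].

Definition matching_polytope : set {ffun E -> R^o} :=
  conv (to_real @` matchings).

Definition alpha_real (v : {set E}) : {ffun E -> R^o} :=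
  [ffun e => (alpha v e)%:~R].

Definition alpha_space : {vspace {ffun E -> R^o}} :=
  <<[seq alpha_real v | v <- enum Pstar]>>%VS.

(* The Newton polygon in a model [q : R^E -> Q] of the quotient of R^E by
   [alpha_space] (that is, q onto with kernel [alpha_space]); the image of a
   class in matching_classes is the image under [q] of any matching in it. *)
Definition newton_polygon (Q : vectType R) (q : 'Hom({ffun E -> R^o}, Q)) :
    set Q :=
  conv [set q (to_real m) | m in matchings].

End Real.
End Weights.

Arguments wclass {E} s0 s1 nu.
Arguments weight_classes {E} s0 s1.
Arguments matching_classes {E} s0 s1.
Arguments matching_polytope {E} s0 s1 R.
Arguments alpha_space {E} s0 s1 R.
Arguments newton_polygon {E} s0 s1 {R Q} q.

Section Realization.
Variables (R : realType) (F : plane R -> 'F_2) (L : set (plane R)).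
Variable S : superpotential F L.
Local Notation E := (eclass S).
Local Notation s0 := (sigma0 S).
Local Notation s1 := (sigma1 S).

Section Drawing.
Variable omega : E -> plane R.

(* Source of the k-th edge after [e] on its polygon, relative to the source of
   [e]; [s] is sigma0 or sigma1. *)
Definition corner (s : {perm E}) (e : E) (k : nat) : plane R :=
  \sum_(j < k) omega ((s ^+ j)%g e).

Definition corners (s : {perm E}) (e : E) : seq (plane R) :=
  [seq corner s e k | k <- iota 0 #|porbit s e|].

(* Drawing of the polygon [T] of the original tiling when the vertices [v] are
   moved to [p v]; the convex hull is the polygon itself for the strictly
   convex polygons considered below. *)
Definition drawn (p : plane R -> plane R) (T : set (plane R)) : set (plane R) :=
  conv (p @` (vertex F `&` T)).

(* A realization all of whose polygons are strictly convex.  [p] gives the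
   positions of the vertices of the drawing and L acts on it through the
   lattice {l *m A | l in L}. *)
Definition convex_realization : Prop :=
  [/\ forall e, omega e != 0,
      exists (p : plane R -> plane R) (A : 'M[R]_2),
        [/\ A \in unitmx,
            forall e, edge F e -> p e.2 - p e.1 = omega (eproj S e),
            forall v l, vertex F v -> L l -> p (v + l) = p v + l *m A,
            forall v v', vertex F v -> vertex F v' -> p v = p v' -> v = v'
          & \bigcup_(T in tiles F) drawn p T = [set: plane R] /\
            trivIset (tiles F) (fun T => (drawn p T)°)],
      forall e, ccw_convex (corners s0 e)
    & forall e, ccw_convex (rev (corners s1 e))].

(* Marked point of the polygon of [e], relative to the source of [e]. *)
Definition mark (theta : E -> R) (s : {perm E}) (e : E) : plane R :=
  \sum_(k < #|porbit s e|) theta ((s ^+ k)%g e) *: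
     (corner s e k + 2^-1 *: omega ((s ^+ k)%g e)).

(* White is on the left of [e], so this is the counter-clockwise order. *)
Definition quadrangle (theta : E -> R) (e : E) : seq (plane R) :=
  [:: 0; mark theta s1 e; omega e; mark theta s0 e].

End Drawing.

Definition weight_realization (nu1 nu2 nu3 : {ffun E -> nat}) : Prop :=
  [/\ weights s0 s1 nu1 /\ positive nu1,
      weights s0 s1 nu2 /\ positive nu2
    & exists d3 : nat,
      let omega e := mkpt ((nu1 e)%:R - (nu3 e)%:R) ((nu2 e)%:R - (nu3 e)%:R) in
      let theta e := (nu3 e)%:R / d3%:R in
      [/\ is_weight s0 s1 d3 nu3, positive nu3, convex_realization omega
        & forall e, ccw_convex (quadrangle omega theta e)]].

End Realization.

(* Main.v *)
(* At every point the zebra function is constant on the 12 sectors cut out by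
   the directions k pi/6, so the tiling is described locally by a 12-periodic
   two-colouring.  Convexity of the tiles bounds the angles by pi, whence every
   edge has a successor on each of its two tiles.

   Fix a height function for which no edge is horizontal.  A convex tile has
   exactly one highest corner and a turn around a vertex passes from the lower
   to the upper half-plane exactly once on a given side.  Counting the
   consecutive pairs of edges of these kinds gives Euler's formula
   |E| = |white| + |black| + |vertices| for the torus.  As the tiles sharing an
   edge with a given class of tiles fill an open and closed part of the plane,
   the two permutations generate a transitive group.

   The rest is linear algebra on the incidence matrix of edges and tiles: a
   feasible point with a fractional coordinate can be moved along a vector of
   the kernel supported on the fractional edges, so extreme points are integral,
   a matching exists in every support, and the theorems of Birkhoff and Koenig
   follow by subtracting matchings.  By connectedness the kernel has dimension
   |E| - |white| - |black| + 1 = |vertices| + 1, and the coboundaries form a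
   subspace of dimension |vertices| - 1, with quotient of dimension 2. *)
From HB Require Import structures.
Require Import Defs.
From mathcomp Require Import all_boot all_order all_fingroup all_algebra.
From mathcomp Require Import complex ring lra zify.
From mathcomp Require Import all_classical all_reals all_analysis.

Set Implicit Arguments.
Unset Strict Implicit.
Unset Printing Implicit Defensive.

Import Order.TTheory GRing.Theory Num.Theory.
Import numFieldNormedType.Exports.

Local Open Scope classical_set_scope.
Local Open Scope ring_scope.

(** * Directions and sectors *)

(** The permutations of a [superpotential] are known only through [follows], so every combinatorial
    fact has to be read off tiles that are given as closures of connected components. No Jordan
    curve argument is made: the tile seen from a point in one of its twelve sectors is recorded as a
    [germ], which can be carried along a ray and round a vertex. Sector indices are natural numbers
    read modulo 12, so [i + 6] is the opposite direction, and [i + 11] and [i + 9] stand for [i - 1]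
    and [i - 3]. The delicate point is that all edges of one tile lie in one orbit. Walking round
    the boundary is avoided: an orbit lifts to edges of a single tile, boundedness forces the lift
    to turn from upwards to downwards somewhere, and the place where it does so is the strictly
    highest corner of that tile. Two edges of the same tile therefore have orbits through the same
    edge. *)

Section Directions.
Variable R : realType.
Local Notation plane := (plane R).
Implicit Types (x y z h : plane) (i j k n : nat).

Lemma det2Dl x y z : det2 (x + y) z = det2 x z + det2 y z.
Proof. by rewrite /det2 !mxE; ring. Qed.
Lemma det2Dr x y z : det2 x (y + z) = det2 x y + det2 x z.
Proof. by rewrite /det2 !mxE; ring. Qed.
Lemma det2Zl (a : R) x y : det2 (a *: x) y = a * det2 x y.
Proof. by rewrite /det2 !mxE; ring. Qed.
Lemma det2Zr (a : R) x y : det2 x (a *: y) = a * det2 x y.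
Proof. by rewrite /det2 !mxE; ring. Qed.
Lemma det2Nl x y : det2 (- x) y = - det2 x y.
Proof. by rewrite /det2 !mxE; ring. Qed.
Lemma det2Nr x y : det2 x (- y) = - det2 x y.
Proof. by rewrite /det2 !mxE; ring. Qed.
Lemma det2xx x : det2 x x = 0.
Proof. by rewrite /det2; ring. Qed.
Lemma det2C x y : det2 x y = - det2 y x.
Proof. by rewrite /det2; ring. Qed.
Lemma det2r0 x : det2 x 0 = 0.
Proof. by rewrite /det2 !mxE; ring. Qed.

Lemma plane_eqP x y : x 0 0 = y 0 0 -> x 0 1 = y 0 1 -> x = y.
Proof.
move=> h0 h1; apply/matrixP => a b; rewrite ord1.
have /orP[/eqP->|/eqP->] // : (b == 0) || (b == 1).
by case: b => [[|[|]]].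
Qed.

(** Cramer's rule. *)
Lemma det2_decomp x y h : det2 x y != 0 ->
  h = (det2 h y / det2 x y) *: x + (det2 x h / det2 x y) *: y.
Proof.
rewrite /det2 => xy.
by apply: plane_eqP; rewrite !mxE; field.
Qed.

Lemma mkptE (a b : R) : ((mkpt a b) 0 0 = a) * ((mkpt a b) 0 1 = b).
Proof. by rewrite /mkpt !mxE. Qed.

Definition ang k : R := k%:R * (pi / 6).

(* Locked, so that unification does not unfold trigonometric functions. *)
Definition dir k : plane := locked (mkpt (cos (ang k)) (sin (ang k))).

Lemma dirE k : dir k = mkpt (cos (ang k)) (sin (ang k)).
Proof. by rewrite /dir -lock. Qed.

Definition sn k : R := sin (ang k).

Lemma angD i j : ang (i + j) = ang i + ang j.
Proof. by rewrite /ang natrD mulrDl. Qed.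

Lemma ang6 : ang 6 = pi.
Proof. by rewrite /ang; field. Qed.

Lemma det_dir i k : det2 (dir i) (dir (i + k)) = sn k.
Proof.
rewrite /det2 !dirE !mkptE angD sinD cosD /sn.
have := cos2Dsin2 (ang i); rewrite !expr2 => E.
transitivity ((cos (ang i) * cos (ang i) + sin (ang i) * sin (ang i)) * sin (ang k)).
  ring.
by rewrite E mul1r.
Qed.

Lemma dirD6 i : dir (i + 6) = - dir i.
Proof.
rewrite !dirE angD ang6; apply: plane_eqP; rewrite !mkptE.
  by rewrite [RHS]mxE mkptE cosDpi.
by rewrite [RHS]mxE mkptE sinDpi.
Qed.

Lemma dirD12 i : dir (i + 12) = dir i.
Proof. by rewrite (_ : 12 = 6 + 6)%N // addnA !dirD6 opprK. Qed.

Lemma dir_mod i : dir (i %% 12) = dir i.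
Proof.
rewrite [in RHS](divn_eq i 12); elim: (i %/ 12)%N => [//|q IH].
by rewrite mulSnr addnAC dirD12.
Qed.

Lemma snD6 k : sn (k + 6) = - sn k.
Proof. by rewrite /sn angD ang6 sinDpi. Qed.

Lemma sn_gt0 k : (0 < k < 6)%N -> 0 < sn k.
Proof.
move=> /andP[k0 k6]; apply: sin_gt0_pi; rewrite -ang6 /ang.
have p0 : 0 < pi / 6 :> R by rewrite divr_gt0 // pi_gt0.
by rewrite mulr_gt0 ?ltr0n//= ltr_pM2r // ltr_nat.
Qed.

Lemma sn0 : sn 0 = 0.
Proof. by rewrite /sn /ang mul0r sin0. Qed.

Lemma sn6 : sn 6 = 0.
Proof. by rewrite (snD6 0) sn0 oppr0. Qed.

Lemma sn_ge0 k : (k <= 6)%N -> 0 <= sn k.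
Proof.
case: (posnP k) => [->|k0]; first by rewrite sn0.
rewrite leq_eqVlt => /orP[/eqP ->|k6]; first by rewrite sn6.
by apply/ltW/sn_gt0/andP.
Qed.

Lemma dir_norm i : dot (dir i) (dir i) = 1.
Proof. by rewrite /dot !dirE !mkptE -!expr2 cos2Dsin2. Qed.

Lemma rot90_dir i : rot90 (dir i) = dir (i + 3).
Proof.
rewrite /rot90 !dirE !mkptE.
have -> : ang (i + 3) = ang i + pi / 2 by rewrite angD /ang; field.
by rewrite cosDpihalf sinDpihalf.
Qed.

Lemma rot90Z (a : R) x : rot90 (a *: x) = a *: rot90 x.
Proof. by apply: plane_eqP; rewrite !mxE /= ?mulrN. Qed.

Lemma dotZr (a : R) x y : dot x (a *: y) = a * dot x y.
Proof. by rewrite /dot !mxE; ring. Qed.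
Lemma dotZl (a : R) x y : dot (a *: x) y = a * dot x y.
Proof. by rewrite /dot !mxE; ring. Qed.
Lemma dotDl x y z : dot (x + y) z = dot x z + dot y z.
Proof. by rewrite /dot !mxE; ring. Qed.

(** Turning [dir i] clockwise by a right angle turns the scalar product into a determinant, so that
    only determinants need sign tables. *)
Lemma dot_dir x i : dot x (dir i) = det2 (dir (i + 9)) x.
Proof.
rewrite (_ : 9 = 3 + 6)%N // addnA dirD6 det2Nl !dirE /det2 /dot !mkptE.
have -> : ang (i + 3) = ang i + pi / 2 by rewrite angD /ang; field.
by rewrite cosDpihalf sinDpihalf; ring.
Qed.

Definition sector j h := (0 < det2 (dir j) h) /\ (0 < det2 h (dir j.+1)).

Lemma sectorD12 j h : sector (j + 12) h = sector j h.
Proof. by rewrite /sector -addSn !dirD12. Qed.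


Lemma det_dirS i : det2 (dir i) (dir i.+1) = sn 1.
Proof. by rewrite -addn1 det_dir. Qed.

Lemma sn1_gt0 : 0 < sn 1. Proof. exact: sn_gt0. Qed.

Lemma sector_decomp j h : sector j h -> exists a b : R,
  [/\ 0 < a, 0 < b & h = a *: dir j + b *: dir j.+1].
Proof.
move=> [h1 h2].
have n0 : 0 < det2 (dir j) (dir j.+1) by rewrite det_dirS sn1_gt0.
exists (det2 h (dir j.+1) / det2 (dir j) (dir j.+1)),
  (det2 (dir j) h / det2 (dir j) (dir j.+1)).
by split; [exact: divr_gt0|exact: divr_gt0|apply: det2_decomp; rewrite gt_eqF].
Qed.

Lemma sector_comb j (a b : R) : 0 < a -> 0 < b ->
  sector j (a *: dir j + b *: dir j.+1).
Proof.
move=> a0 b0; rewrite /sector det2Dl det2Dr !det2Zr !det2Zl !det2xx.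
rewrite !det_dirS !mulr0 addr0 add0r.
by split; rewrite mulr_gt0 // sn1_gt0.
Qed.

(** The six sectors that follow direction [n] fill the half-plane on its left. *)
Lemma sector_pos n k h : (k < 6)%N -> sector (n + k) h -> 0 < det2 (dir n) h.
Proof.
move=> k6 /sector_decomp[a [b [a0 b0 ->]]].
rewrite det2Dr !det2Zr -addnS !det_dir.
case: (posnP k) => [->|k0].
  by rewrite sn0 mulr0 add0r mulr_gt0 // sn1_gt0.
apply: ltr_wpDr; first by rewrite mulr_ge0 ?sn_ge0 // ltW.
by rewrite mulr_gt0 // sn_gt0 // k0.
Qed.

Lemma sector_neg n k h : (6 <= k < 12)%N -> sector (n + k) h ->
  det2 (dir n) h < 0.
Proof.
move=> /andP[k6 k12] s.
have -> : dir n = - dir (n + 6) by rewrite dirD6 opprK.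
rewrite det2Nl oppr_lt0; apply: (@sector_pos _ (k - 6)); first lia.
by have -> : (n + 6 + (k - 6) = n + k)%N by lia.
Qed.

Lemma sector_modE j h : sector j h <-> sector (j %% 12) h.
Proof.
rewrite [in sector j h](divn_eq j 12); elim: (j %/ 12)%N => [//|q IH].
by rewrite mulSnr addnAC sectorD12.
Qed.

Lemma sectorZ j h (t : R) : 0 < t -> sector j h -> sector j (t *: h).
Proof.
by move=> t0 [h1 h2]; split; rewrite ?det2Zl ?det2Zr mulr_gt0.
Qed.

Lemma sectorD j x y : sector j x -> sector j y -> sector j (x + y).
Proof.
by move=> [h1 h2] [h3 h4]; split; rewrite ?det2Dl ?det2Dr addr_gt0.
Qed.

(* Some sign change of [k |-> det2 (dir k) h] occurs, by antiperiodicity. *)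
Lemma sector_cases h : h != 0 -> exists2 j, (j < 12)%N &
  sector j h \/ exists2 t : R, 0 < t & h = t *: dir j.
Proof.
move=> h0.
pose f k := det2 (dir k) h.
have f6 k : f (k + 6)%N = - f k by rewrite /f dirD6 det2Nl.
have [k [fk fk1]] : exists k, 0 <= f k /\ f k.+1 < 0.
  apply: contrapT => H.
  have up k : 0 <= f k -> forall n, 0 <= f (k + n)%N.
    move=> fk; elim=> [|n IH]; first by rewrite addn0.
    by rewrite leNgt; apply/negP => fn; apply: H; exists (k + n)%N; rewrite -addnS.
  have zero k : 0 <= f k -> f k = 0.
    by move=> fk; apply/eqP; rewrite eq_le fk andbT -oppr_ge0 -f6; exact: up.
  have all0 k : f k = 0.
    case: (lerP 0 (f k)) => [/zero //|/ltW fk].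
    have : f (k + 6)%N = 0 by apply: zero; rewrite f6 oppr_ge0.
    by rewrite f6 => /eqP; rewrite oppr_eq0 => /eqP.
  move/eqP: h0; apply.
  have n0 : det2 (dir 0) (dir 1) != 0 by rewrite det_dirS gt_eqF // sn1_gt0.
  rewrite (det2_decomp h n0) (det2C h) -/(f 1%N) -/(f 0%N) !all0.
  by rewrite oppr0 !mul0r !scale0r addr0.
exists (k %% 12)%N; first by rewrite ltn_mod.
have n0 : 0 < det2 (dir k) (dir k.+1) by rewrite det_dirS sn1_gt0.
have hk : 0 < det2 h (dir k.+1) by rewrite det2C oppr_gt0.
move: fk; rewrite le_eqVlt => /orP[/eqP fk|fk]; last first.
  by left; apply: (sector_modE k h).1; split.
right; rewrite dir_mod; exists (det2 h (dir k.+1) / det2 (dir k) (dir k.+1)).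
  exact: divr_gt0.
by rewrite {1}(det2_decomp h (lt0r_neq0 n0)) -/(f k) -fk mul0r scale0r addr0.
Qed.

End Directions.

(** * Zebra functions near a point *)

Section Germs.
Variable R : realType.
Local Notation plane := (plane R).
Implicit Types (x y z h : plane) (i j k n : nat).

Lemma coord_le h (i : 'I_2) : `|h 0 i| <= `|h|.
Proof.
have -> : `|h| = mx_norm h by [].
rewrite mx_normrE.
exact: (@le_bigmax _ _ _ 0 (fun ij : 'I_1 * 'I_2 => `|h ij.1 ij.2|) (0, i)).
Qed.

(** If [a] is an integer, the sign of [b] decides between two values; otherwise a small [b] does not
    change the floor. Zero goes with the positive numbers because [floor] is right continuous. *)
Lemma floor_germ (a : R) : exists2 d : R, 0 < d &
  forall b b' : R, `|b| < d -> `|b'| < d -> (b < 0) = (b' < 0) ->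
    Num.floor (a + b) = Num.floor (a + b').
Proof.
set n := Num.floor a.
have an : n%:~R <= a by exact: floor_le.
have an1 : a < n%:~R + 1 by rewrite -intrD1; exact: floorD1_gt.
have [na|na] := eqVneq (n%:~R) a.
  exists 1 => // b b'; rewrite !ltr_norml => /andP[b1 b2] /andP[b3 b4].
  case: (ltrP b 0) => b0 /esym b0'.
    have E c : -1 < c -> c < 0 -> Num.floor (a + c) = n - 1.
      move=> c1 c2; apply: floor_def; rewrite intrB subrK; apply/andP; split; lra.
    by rewrite !E // b0'.
  have E c : 0 <= c -> c < 1 -> Num.floor (a + c) = n.
    move=> c1 c2; apply: floor_def; rewrite intrD1; apply/andP; split; lra.
  rewrite !E // leNgt b0' //.
have an' : n%:~R < a by rewrite lt_neqAle na.
exists (Num.min (a - n%:~R) (n%:~R + 1 - a)).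
  by rewrite lt_min; apply/andP; split; lra.
have E c : `|c| < Num.min (a - n%:~R) (n%:~R + 1 - a) -> Num.floor (a + c) = n.
  rewrite lt_min !ltr_norml => /andP[/andP[? ?] /andP[? ?]].
  by apply: floor_def; rewrite intrD1; apply/andP; split; lra.
by move=> b b' /E -> /E ->.
Qed.

Lemma complex_pt_eps k : complex_pt (eps R ^+ k) = dir R k.
Proof.
elim: k => [|k IH].
  apply: plane_eqP; rewrite dirE /complex_pt !mkptE /ang mul0r ?cos0 ?sin0 //.
rewrite exprSr; move: IH; rewrite /complex_pt !dirE.
case: (eps R ^+ k) => a b /= E.
have Ea : a = cos (ang R k) by move/matrixP/(_ 0 0): E; rewrite !mkptE.
have Eb : b = sin (ang R k) by move/matrixP/(_ 0 1): E; rewrite !mkptE.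
have a1 : ang R 1 = pi / 6 by rewrite /ang mul1r.
apply: plane_eqP; rewrite !mkptE -(addn1 k) angD a1 ?cosD ?sinD Ea Eb /=; ring.
Qed.

Lemma complex_ptM (c : R) (z : complex R) :
  complex_pt (Complex c 0 * z) = c *: complex_pt z.
Proof. by case: z => a b; apply: plane_eqP; rewrite !mxE /=; ring. Qed.

Lemma zebra_dirsP v : v \in zebra_dirs R ->
  exists (c : R) (m : nat), [/\ 0 < c, (m < 6)%N & complex_pt v = c *: dir R m].
Proof.
have s3 : 0 < Num.sqrt 3 :> R by rewrite sqrtr_gt0.
have i3 : complex_pt (Complex 0 1) = dir R 3.
  rewrite -complex_pt_eps; apply: plane_eqP; rewrite complex_pt_eps dirE !mkptE /=;
  have -> : ang R 3 = pi / 2 by rewrite /ang; field.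
    by rewrite cos_pihalf.
  by rewrite sin_pihalf.
rewrite !inE => /or4P[/eqP->|/eqP->|/eqP->|/or3P[/eqP->|/eqP->|/eqP->]].
- by exists (Num.sqrt 3), 5; rewrite /sqrt3 complex_ptM complex_pt_eps.
- by exists 1, 4; rewrite scale1r complex_pt_eps.
- by exists (Num.sqrt 3), 3; rewrite /sqrt3 complex_ptM i3.
- by exists 1, 2; rewrite scale1r complex_pt_eps.
- exists (Num.sqrt 3), 1; rewrite /sqrt3 complex_ptM; split => //.
  by rewrite -complex_pt_eps expr1.
- by exists 1, 0; rewrite scale1r -complex_pt_eps expr0.
Qed.

Lemma dot_dir_le h k : `|dot h (dir R k)| <= 2 * `|h|.
Proof.
rewrite /dot dirE !mkptE.
have c : `|cos (ang R k)| <= 1 by rewrite ler_norml cos_geN1 cos_le1.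
have s : `|sin (ang R k)| <= 1 by rewrite ler_norml sin_geN1 sin_le1.
rewrite (le_trans (ler_normD _ _)) // mulr2n mulrDl mul1r lerD // normrM.
  by rewrite -[leRHS]mulr1 ler_pM // coord_le.
by rewrite -[leRHS]mulr1 ler_pM // coord_le.
Qed.

(** By [dot_dir] these are the signs of the scalar products with the six zebra directions, on which
    alone the generators depend near a point. *)
Definition same_signs h h' := forall m, (m < 6)%N ->
  (det2 (dir R (m + 9)) h < 0) = (det2 (dir R (m + 9)) h' < 0).

Lemma zebra_germ (F : plane -> 'F_2) : zebra F -> forall x,
  exists2 r : R, 0 < r & forall h h', `|h| < r -> `|h'| < r ->
    same_signs h h' -> F (x + h) = F (x + h').
Proof.
elim => [k v k0 /zebra_dirsP[c [m [c0 m6 vE]]] x||G1 G2 _ IH1 _ IH2 x|G1 G2 _ IH1 _ IH2 x].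
- pose w := k%:R * c.
  have w0 : 0 < w by rewrite mulr_gt0 // ltr0n.
  rewrite /zebra_gen vE scalerA -/w; move: w w0 => w w0.
  have [d d0 dP] := floor_germ (2 * (w * dot x (dir R m))).
  exists (d / (4 * w)); first by rewrite divr_gt0 // mulr_gt0.
  move=> h h' hr hr' s; rewrite !dotZr !dotDl.
  have E l : 2 * (w * (dot x (dir R m) + dot l (dir R m))) =
      2 * (w * dot x (dir R m)) + 2 * (w * dot l (dir R m)) by ring.
  rewrite !E (dP _ (2 * (w * dot h' (dir R m)))) //.
  + rewrite !normrM (gtr0_norm w0) gtr0_norm // mulrA.
    rewrite (@le_lt_trans _ _ (2 * w * (2 * `|h|))) //.
      by rewrite ler_pM2l ?dot_dir_le // mulr_gt0.
    by move: hr; rewrite ltr_pdivlMr ?mulr_gt0 //; lra.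
  + rewrite !normrM (gtr0_norm w0) gtr0_norm // mulrA.
    rewrite (@le_lt_trans _ _ (2 * w * (2 * `|h'|))) //.
      by rewrite ler_pM2l ?dot_dir_le // mulr_gt0.
    by move: hr'; rewrite ltr_pdivlMr ?mulr_gt0 //; lra.
  + by rewrite !pmulr_rlt0 // !dot_dir s.
- by move=> x; exists 1.
- have [r1 r10 H1] := IH1 x; have [r2 r20 H2] := IH2 x.
  exists (Num.min r1 r2) => [|h h']; first by rewrite lt_min r10.
  rewrite !lt_min => /andP[a b] /andP[c d] s.
  by rewrite (H1 h h') // (H2 h h').
- have [r1 r10 H1] := IH1 x; have [r2 r20 H2] := IH2 x.
  exists (Num.min r1 r2) => [|h h']; first by rewrite lt_min r10.
  rewrite !lt_min => /andP[a b] /andP[c d] s.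
  by rewrite (H1 h h') // (H2 h h').
Qed.

Lemma sector_same_signs j h h' : sector j h -> sector j h' -> same_signs h h'.
Proof.
move=> s s' m m6; set n := (m + 9)%N.
(* This is [j - n] modulo 12; the summand [12 * n] prevents truncation. *)
pose k := ((j + 12 * n - n) %% 12)%N.
have S (l : plane) : sector j l -> sector (n + k) l.
  move=> /sector_modE sl; apply/sector_modE.
  by rewrite /k modnDmr (_ : n + _ = n * 12 + j)%N ?modnMDl //; lia.
have k12 : (k < 12)%N by rewrite ltn_mod.
case: (ltnP k 6) => k6.
  have p := sector_pos k6 (S _ s); have p' := sector_pos k6 (S _ s').
  by rewrite !ltNge !ltW.
have kk : (6 <= k < 12)%N by rewrite k6.
by rewrite (sector_neg kk (S _ s)) (sector_neg kk (S _ s')).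
Qed.

(* [floor] is right continuous, and every [dir m] with [m < 6] has a positive
   scalar product with [updir]. *)
Definition updir : plane := dir R 2 + dir R 3.

Lemma det_updir m : (m < 6)%N -> 0 < det2 (dir R (m + 9)) updir.
Proof.
move=> m6; rewrite /updir det2Dr -(dirD12 _ 2) -(dirD12 _ 3).
have -> : (2 + 12 = m + 9 + (5 - m))%N by lia.
have -> : (3 + 12 = m + 9 + (6 - m))%N by lia.
rewrite !det_dir; case: (posnP m) => [->|m0].
  by rewrite sn6 addr0 sn_gt0.
by apply: ltr_wpDl; [rewrite sn_ge0|rewrite sn_gt0]; lia.
Qed.

End Germs.

(** * Perturbations, segments and real induction *)

Section PlaneTopology.
Variable R : realType.
Local Notation plane := (plane R).
Implicit Types (x y z h : plane) (i j k n : nat).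

Lemma det_dir_le j h : `|det2 (dir R j) h| <= 2 * `|h|.
Proof.
by have := dot_dir_le h (j + 3); rewrite dot_dir -addnA dirD12.
Qed.

Lemma sector_open j h : sector j h ->
  exists2 e : R, 0 < e & forall k : plane, `|k| < e -> sector j (h + k).
Proof.
move=> [h1 h2]; exists (Num.min (det2 (dir R j) h) (det2 h (dir R j.+1)) / 2).
  by rewrite divr_gt0 // lt_min h1.
move=> k; rewrite ltr_pdivlMr // lt_min => /andP[k1 k2].
have := det_dir_le j k; have := det_dir_le j.+1 k.
rewrite !ler_norml => /andP[? ?] /andP[? ?].
split; rewrite ?det2Dl ?det2Dr; first by lra.
by rewrite (det2C k); lra.
Qed.

Lemma near0_small (h : plane) (r : R) : 0 < r ->
  exists2 e : R, 0 < e & forall t, 0 < t -> t < e -> `|t *: h| < r.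
Proof.
move=> r0; have h0 : 0 < 1 + `|h| by rewrite ltr_pwDl.
exists (r / (1 + `|h|)) => [|t t0]; first exact: divr_gt0.
rewrite ltr_pdivlMr // normrZ gtr0_norm // mulrDr mulr1 => H.
by apply: le_lt_trans H; rewrite lerDr ltW.
Qed.

Lemma seg_component (A : set plane) x y :
  (forall t : R, 0 <= t <= 1 -> A (x + t *: (y - x))) ->
  connected_component A x = connected_component A y.
Proof.
move=> H; apply: same_connected_component.
pose f (t : R) : plane := x + t *: (y - x).
exists (f @` `[0, 1]); last first.
  by exists 1; rewrite /= ?in_itv /= ?lexx ?ler01 // /f scale1r addrC subrK.
split.
- by exists 0; rewrite /= ?in_itv /= ?lexx ?ler01 // /f scale0r addr0.
- by move=> _ [t /= + <-]; rewrite in_itv /= => /H.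
- apply: connected_continuous_connected; first exact: segment_connected.
  apply: continuous_subspaceT => t; apply: cvgD; first exact: cvg_cst.
  by apply: cvgZr_tmp; exact: cvg_id.
Qed.

(** Real induction: [t] is the infimum of the points where [G] fails. If [G] held there, the second
    hypothesis would push the infimum further. *)
Lemma first_exit (G : R -> Prop) :
  (exists2 e, 0 < e & forall s, 0 < s -> s < e -> G s) ->
  (forall t, 0 < t -> G t ->
     exists2 e, 0 < e & forall s, t < s -> s < t + e -> G s) ->
  (forall t, 0 < t -> G t) \/
  exists t, [/\ 0 < t, ~ G t & forall s, 0 < s -> s < t -> G s].
Proof.
move=> [e e0 He] Hstep.
have [H|/existsNP[b /not_implyP[b0 nb]]] := pselect (forall t, 0 < t -> G t).
  by left.
right; pose B := [set t : R | 0 < t /\ ~ G t].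
have hB : has_inf B.
  by split; [exists b|exists 0 => t [/ltW]].
have lb : lbound B e.
  by move=> t [t0 nt]; rewrite leNgt; apply/negP => te; apply: nt; exact: He.
have below s : 0 < s -> s < inf B -> G s.
  move=> s0 si; apply: contrapT => ns.
  by move: si; rewrite ltNge ge_inf //; exact: hB.2.
have i0 : 0 < inf B by apply: lt_le_trans e0 _; apply: lb_le_inf => //; exists b.
exists (inf B); split => // Gi.
have [d d0 Hd] := Hstep _ i0 Gi.
have : lbound B (inf B + d).
  move=> t [t0 nt]; rewrite leNgt; apply/negP => td; apply: nt.
  case: (ltgtP t (inf B)) => [ti|ti|->//]; first exact: below.
  exact: Hd.
move=> /(lb_le_inf hB.1); rewrite leNgt; apply/negP; rewrite negbK.
by rewrite ltrDl.
Qed.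

End PlaneTopology.

(** * Local structure of the tiling *)

Section LocalStructure.
Variables (R : realType) (F : plane R -> 'F_2) (zF : zebra F).
Local Notation plane := (plane R).
Local Notation dir := (dir R).
Implicit Types (x y z h : plane) (i j k n : nat) (b : bool).

Definition clr b : 'F_2 := if b then 1 else 0.

Lemma clrK (c : 'F_2) : clr (c != 0) = c.
Proof.
by apply/val_inj; case: c => [[|[|n]]].
Qed.

Lemma clr_inj : injective clr.
Proof. by case=> -[]. Qed.

Lemma regionP (c : 'F_2) x : region F c x <->
  exists2 e : R, 0 < e & forall k : plane, `|k| < e -> F (x + k) = c.
Proof.
rewrite /region /interior /=; split => [/nbhs_ballP[e /= e0 H]|[e e0 H]].
  exists e => // k ke; apply: H; rewrite -ball_normE /= opprD addrA subrr sub0r.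
  by rewrite normrN.
apply/nbhs_ballP; exists e => //= y; rewrite -ball_normE /= => xy.
by rewrite -(H (y - x)) ?[x + _]addrC ?subrK // distrC.
Qed.

Lemma region_F (c : 'F_2) x : region F c x -> F x = c.
Proof. by move=> /regionP[e e0 /(_ 0)]; rewrite normr0 addr0; exact. Qed.

(** A chosen radius within which the description by sectors is valid. *)
Definition rad x : R := s2val (cid2 (zebra_germ zF x)).

Lemma rad_gt0 x : 0 < rad x.
Proof. by rewrite /rad; case: cid2. Qed.

Lemma radP x h h' : `|h| < rad x -> `|h'| < rad x -> same_signs h h' ->
  F (x + h) = F (x + h').
Proof. by rewrite /rad; case: cid2 => /= r r0; apply. Qed.

Definition mid j : plane := dir j + dir j.+1.

Lemma midD12 j : mid (j + 12) = mid j.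
Proof. by rewrite /mid -addSn !dirD12. Qed.

Lemma sector_mid j : sector j (mid j).
Proof. by have := @sector_comb R j 1 1 ltr01 ltr01; rewrite !scale1r. Qed.

Definition germ_pt x j : plane := (rad x / (1 + `|mid j|)) *: mid j.

Lemma germ_pt_sector x j : sector j (germ_pt x j).
Proof.
apply: sectorZ (sector_mid j); rewrite divr_gt0 ?rad_gt0 //.
Qed.

Lemma germ_pt_norm x j : `|germ_pt x j| < rad x.
Proof.
have h0 : 0 < 1 + `|mid j| by rewrite ltr_pwDl.
rewrite /germ_pt normrZ gtr0_norm ?divr_gt0 ?rad_gt0 //.
rewrite -mulrA -[ltRHS]mulr1 ltr_pM2l ?rad_gt0 // mulrC ltr_pdivrMr //.
by rewrite mul1r ltrDr.
Qed.

(* Locked, as unfolding it makes [done] compute with real numbers. *)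
Definition colour x j : bool := locked (F (x + germ_pt x j) != 0).

Definition component x j : set plane :=
  locked (connected_component (region F (clr (colour x j))) (x + germ_pt x j)).

(** This pair names the tile seen from [x] in sector [j]; one equation of germs identifies both the
    tile and its colour. *)
Definition germ x j : bool * set plane := (colour x j, component x j).

Lemma germD12 x j : germ x (j + 12) = germ x j.
Proof. by rewrite /germ /component /colour /germ_pt !midD12. Qed.

Lemma colD12 x j : colour x (j + 12) = colour x j.
Proof. by rewrite /colour /germ_pt !midD12. Qed.

Lemma germ_modE x j : germ x (j %% 12)%N = germ x j.
Proof.
rewrite [in RHS](divn_eq j 12); elim: (j %/ 12)%N => [//|q IH].
by rewrite mulSnr addnAC germD12.
Qed.

Lemma germ_eq_mod x j k : j = k %[mod 12] -> germ x j = germ x k.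
Proof. by move=> jk; rewrite -germ_modE jk germ_modE. Qed.

Lemma col_eq_mod x j k : j = k %[mod 12] -> colour x j = colour x k.
Proof. by move=> /(germ_eq_mod x)[]. Qed.

Lemma F_sector x j h : sector j h -> `|h| < rad x -> F (x + h) = clr (colour x j).
Proof.
move=> s hr; rewrite /colour -lock clrK; apply: radP => //; first exact: germ_pt_norm.
exact: sector_same_signs s (germ_pt_sector x j).
Qed.

Lemma region_sector x j h : sector j h -> `|h| < rad x ->
  region F (clr (colour x j)) (x + h).
Proof.
move=> s hr; apply/regionP; have [e e0 He] := sector_open s.
exists (Num.min e (rad x - `|h|)); first by rewrite lt_min e0 subr_gt0.
move=> k; rewrite lt_min => /andP[ke kr]; rewrite -addrA; apply: F_sector.
  exact: He.
by rewrite (le_lt_trans (ler_normD _ _)) // -ltrBrDl.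
Qed.

Lemma sector_convex j h h' (t : R) : sector j h -> sector j h' ->
  0 <= t <= 1 -> sector j (h + t *: (h' - h)).
Proof.
move=> s s' /andP[t0 t1].
have -> : h + t *: (h' - h) = (1 - t) *: h + t *: h'.
  by rewrite scalerBr scalerBl scale1r addrA addrAC.
move: t0; rewrite le_eqVlt => /orP[/eqP <-|t0].
  by rewrite subr0 scale1r scale0r addr0.
move: t1; rewrite le_eqVlt => /orP[/eqP ->|t1].
  by rewrite subrr scale1r scale0r add0r.
by apply: sectorD; apply: sectorZ; rewrite ?subr_gt0.
Qed.

Lemma norm_segment h h' (r t : R) : `|h| < r -> `|h'| < r ->
  0 <= t <= 1 -> `|h + t *: (h' - h)| < r.
Proof.
move=> hr hr' /andP[t0 t1].
have -> : h + t *: (h' - h) = (1 - t) *: h + t *: h'.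
  by rewrite scalerBr scalerBl scale1r addrA addrAC.
rewrite (le_lt_trans (ler_normD _ _)) // !normrZ !ger0_norm ?subr_ge0 //.
move: t0; rewrite le_eqVlt => /orP[/eqP <-|t0].
  by rewrite subr0 mul1r mul0r addr0.
have -> : r = (1 - t) * r + t * r by ring.
by apply: ler_ltD; [rewrite ler_wpM2l ?subr_ge0 // ltW|rewrite ltr_pM2l].
Qed.

Lemma comp_sector x j h : sector j h -> `|h| < rad x ->
  component x j = connected_component (region F (clr (colour x j))) (x + h).
Proof.
move=> s hr; rewrite /component -lock; apply: seg_component => t t01.
rewrite opprD addrACA subrr add0r -addrA; apply: region_sector.
  by apply: sector_convex => //; exact: germ_pt_sector.
by apply: norm_segment => //; exact: germ_pt_norm.
Qed.

(** Both germs are read off at one point that is close to [y] in its sector [k] and also lies in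
    sector [j] of [x]. *)
Lemma germ_near x j y k :
  (exists2 e0 : R, 0 < e0 & forall e, 0 < e -> e < e0 ->
     sector j (y + e *: mid k - x) /\ `|y + e *: mid k - x| < rad x) ->
  germ y k = germ x j.
Proof.
move=> [e0 e00 H]; have [e1 e10 H1] := near0_small (mid k) (rad_gt0 y).
pose e := Num.min e0 e1 / 2.
have m0 : 0 < Num.min e0 e1 by rewrite lt_min e00.
have ep : 0 < e by rewrite divr_gt0.
have em : e < Num.min e0 e1 by rewrite /e; lra.
move: em; rewrite lt_min => /andP[/(H _ ep)[s r] /(H1 _ ep) n].
have sk := sectorZ ep (sector_mid k).
have E : x + (y + e *: mid k - x) = y + e *: mid k by rewrite addrC subrK.
have cE : colour y k = colour x j.
  by apply: clr_inj; rewrite -(F_sector sk n) -(F_sector s r) E.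
by rewrite /germ cE (comp_sector s r) (comp_sector sk n) cE E.
Qed.

Let addrBase x h h' : x + h + h' - x = h + h'.
Proof. by rewrite -(addrA x) [x + _]addrC addrK. Qed.

Lemma germ_in_sector x j h k : sector j h -> `|h| < rad x ->
  germ (x + h) k = germ x j.
Proof.
move=> s hr; apply: germ_near; have [e0 e00 H] := sector_open s.
have d0 : 0 < Num.min e0 (rad x - `|h|) by rewrite lt_min e00 subr_gt0.
have [e1 e10 H1] := near0_small (mid k) d0.
exists e1 => // e ep /(H1 _ ep); rewrite lt_min => /andP[a b].
rewrite addrBase; split; first exact: H.
by rewrite (le_lt_trans (ler_normD _ _)) // -ltrBrDl.
Qed.

Lemma germ_ray_aux x i (t : R) k j : 0 < t -> `|t *: dir i| < rad x ->
  (exists2 e0 : R, 0 < e0 & forall e, 0 < e -> e < e0 ->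
     sector j (t *: dir i + e *: mid k)) ->
  germ (x + t *: dir i) k = germ x j.
Proof.
move=> t0 tr [e0 e00 H]; apply: germ_near.
have d0 : 0 < rad x - `|t *: dir i| by rewrite subr_gt0.
have [e1 e10 H1] := near0_small (mid k) d0.
exists (Num.min e0 e1) => [|e ep]; first by rewrite lt_min e00.
rewrite lt_min => /andP[a /(H1 _ ep) b].
rewrite addrBase; split; first exact: H.
by rewrite (le_lt_trans (ler_normD _ _)) // -ltrBrDl.
Qed.

Lemma small_perturb (a c : R) : 0 < a ->
  exists2 e0 : R, 0 < e0 & forall e, 0 < e -> e < e0 -> 0 < a + e * c.
Proof.
move=> a0; have n0 : 0 < 1 + `|c| by rewrite ltr_pwDl.
exists (a / (1 + `|c|)) => [|e ep]; first exact: divr_gt0.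
rewrite ltr_pdivlMr // => H.
have : - `|c| <= c by rewrite lerNl ler_normr lexx orbT.
nra.
Qed.

(** A point on the ray in direction [i] has six sectors on the left of the ray, and all of them
    begin inside sector [i] of [x]. *)
Lemma germ_left x i (t : R) k : 0 < t -> `|t *: dir i| < rad x -> (k < 6)%N ->
  germ (x + t *: dir i) (i + k) = germ x i.
Proof.
move=> t0 tr k6; apply: germ_ray_aux => //.
have a0 : 0 < t * sn R 1 by rewrite mulr_gt0 // sn1_gt0.
have [e0 e00 H] := small_perturb (det2 (mid (i + k)) (dir i.+1)) a0.
exists e0 => // e ep ee; split.
  rewrite det2Dr !det2Zr det2xx mulr0 add0r mulr_gt0 //.
  exact: sector_pos k6 (sector_mid _).
by rewrite det2Dl !det2Zl det_dirS; exact: H.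
Qed.

(** The six sectors on the right of the ray begin inside sector [i - 1] of [x]. *)
Lemma germ_right x i (t : R) k : 0 < t -> `|t *: dir i| < rad x -> (k < 6)%N ->
  germ (x + t *: dir i) (i + 6 + k) = germ x (i + 11).
Proof.
move=> t0 tr k6; apply: germ_ray_aux => //.
have dE : dir (i + 11).+1 = dir i by rewrite -addnS dirD12.
have a0 : 0 < t * sn R 1 by rewrite mulr_gt0 // sn1_gt0.
have [e0 e00 H] := small_perturb (det2 (dir (i + 11)) (mid (i + 6 + k))) a0.
exists e0 => // e ep ee; split.
  by rewrite det2Dr !det2Zr -{1}dE det_dirS; exact: H.
rewrite dE det2Dl !det2Zl det2xx mulr0 add0r mulr_gt0 //.
rewrite det2C oppr_gt0; apply: (@sector_neg _ _ (6 + k)); first lia.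
by rewrite addnA; exact: sector_mid.
Qed.

Lemma F_updir y : exists2 e0 : R, 0 < e0 & forall e, 0 < e -> e < e0 ->
  F (y + e *: updir R) = F y.
Proof.
have [e0 e00 H] := near0_small (updir R) (rad_gt0 y).
exists e0 => // e ep /(H _ ep) n; rewrite -[in RHS](addr0 y).
apply: radP => //; first by rewrite normr0 rad_gt0.
move=> m m6; rewrite det2r0 ltxx det2Zr.
by apply/negbTE; rewrite -leNgt; apply/ltW; rewrite mulr_gt0 // det_updir.
Qed.

Lemma updir_sector : sector 2 (updir R).
Proof. exact: sector_mid. Qed.

(** By right continuity the value at a point persists along [updir], which points into sector 2. *)
Lemma F_center x : F x = clr (colour x 2).
Proof.
have [e0 e00 H] := F_updir x.
have [e1 e10 H1] := near0_small (updir R) (rad_gt0 x).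
pose e := Num.min e0 e1 / 2.
have m0 : 0 < Num.min e0 e1 by rewrite lt_min e00.
have ep : 0 < e by rewrite divr_gt0.
have em : e < Num.min e0 e1 by rewrite /e; lra.
move: em; rewrite lt_min => /andP[/(H _ ep) <- /(H1 _ ep) r].
by apply: F_sector => //; apply: sectorZ updir_sector.
Qed.

Lemma region_const x b : (forall j, colour x j = b) -> region F (clr b) x.
Proof.
move=> H; apply/regionP; exists (rad x); first exact: rad_gt0.
move=> k kr; have [->|k0] := eqVneq k 0; first by rewrite addr0 F_center H.
have [j _ [s|[t t0 kE]]] := sector_cases k0; first by rewrite (F_sector s kr) H.
rewrite F_center kE; rewrite kE in kr.
(* Position of sector 2 counted from the ray [j]: it decides on which side of the ray this sector
   lies. *)
pose m := ((2 + 12 * j - j) %% 12)%N.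
have m12 : (m < 12)%N by rewrite ltn_mod.
have mE : ((j + m) %% 12 = 2 %% 12)%N.
  by rewrite /m modnDmr (_ : _ + _ = j * 12 + 2)%N ?modnMDl //; lia.
rewrite -(col_eq_mod _ mE); congr clr.
case: (ltnP m 6) => m6; first by have [-> _] := germ_left t0 kr m6.
have -> : (j + m = j + 6 + (m - 6))%N by lia.
have m6' : (m - 6 < 6)%N by lia.
by have [-> _] := germ_right t0 kr m6'.
Qed.

Lemma region_col x b j : region F (clr b) x -> colour x j = b.
Proof.
move=> /regionP[e0 e00 H].
have m0 : 0 < Num.min e0 (rad x) by rewrite lt_min e00 rad_gt0.
have [e1 e10 H1] := near0_small (mid j) m0.
have e2 : 0 < e1 / 2 by rewrite divr_gt0.
have : e1 / 2 < e1 by lra.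
move=> /(H1 _ e2); rewrite lt_min => /andP[/H h /(F_sector (sectorZ e2 (sector_mid j))) h'].
by apply: clr_inj; rewrite -h -h'.
Qed.

Lemma germ_const x b : (forall j, colour x j = b) -> forall j,
  germ x j = (b, connected_component (region F (clr b)) x).
Proof.
move=> H j; rewrite /germ /component -lock H; congr pair; apply/esym/seg_component => t.
move=> /andP[t0 t1].
have -> : x + germ_pt x j - x = germ_pt x j by rewrite addrC addKr.
move: t0; rewrite le_eqVlt => /orP[/eqP <-|t0].
  by rewrite scale0r addr0; exact: region_const.
rewrite -(H j); apply: region_sector; first exact: sectorZ (germ_pt_sector x j).
rewrite normrZ gtr0_norm //; apply: le_lt_trans (germ_pt_norm x j).
by rewrite ler_piMl.
Qed.

Lemma region_ray x i (t : R) b : 0 < t -> `|t *: dir i| < rad x ->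
  colour x i = b -> colour x (i + 11) = b -> region F (clr b) (x + t *: dir i).
Proof.
move=> t0 tr c1 c2; apply: region_const => j.
pose m := ((12 * i + j - i) %% 12)%N.
have m12 : (m < 12)%N by rewrite ltn_mod.
have mE : ((i + m) %% 12 = j %% 12)%N.
  by rewrite /m modnDmr (_ : _ + _ = i * 12 + j)%N ?modnMDl //; lia.
rewrite -(col_eq_mod _ mE).
case: (ltnP m 6) => m6; first by have [-> _] := germ_left t0 tr m6.
have -> : (i + m = i + 6 + (m - 6))%N by lia.
have m6' : (m - 6 < 6)%N by lia.
by have [-> _] := germ_right t0 tr m6'.
Qed.

(** The ray between the two sectors belongs to the region near [x], so a point on it joins the two
    components. *)
Lemma germ_adj x i : colour x i = colour x i.+1 -> germ x i = germ x i.+1.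
Proof.
move=> cE; have [e e0 H] := near0_small (dir i.+1) (rad_gt0 x).
have t0 : 0 < e / 2 by rewrite divr_gt0.
have : e / 2 < e by lra.
move=> /(H _ t0) tr.
have E : germ x (i.+1 + 11) = germ x i by rewrite addSnnS germD12.
have cE' : colour x (i.+1 + 11) = colour x i by case: E.
have c := region_ray t0 tr (erefl (colour x i.+1)) (etrans cE' cE).
have cc j : colour (x + e / 2 *: dir i.+1) j = colour x i.+1 by exact: region_col.
rewrite -E -(germ_right t0 tr (isT : (0 < 6)%N)).
rewrite -(germ_left t0 tr (isT : (0 < 6)%N)).
by rewrite !(germ_const cc).
Qed.

Lemma germ_run x i n b : (forall k, (k <= n)%N -> colour x (i + k) = b) ->
  forall k, (k <= n)%N -> germ x (i + k) = germ x i.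
Proof.
move=> H; elim=> [|k IH] kn; first by rewrite addn0.
rewrite -IH ?(ltnW kn) // addnS; apply/esym/germ_adj.
by rewrite -addnS !H // ltnW.
Qed.

Definition tile_at x j : set plane := closure (component x j).

Lemma comp_nonempty x j : region F (clr (colour x j)) (x + germ_pt x j).
Proof. exact: region_sector (germ_pt_sector x j) (germ_pt_norm x j). Qed.

Lemma tile_at_tile x j : tile F (clr (colour x j)) (tile_at x j).
Proof. by exists (x + germ_pt x j); rewrite ?/tile_at ?/component -?lock //; exact: comp_nonempty. Qed.

Lemma sector_tile x j h : sector j h -> `|h| < rad x -> component x j (x + h).
Proof.
move=> s hr; rewrite (comp_sector s hr); apply: connected_component_refl.
exact: region_sector.
Qed.

Lemma center_tile x j : tile_at x j x.
Proof.
move=> B /nbhs_ballP[e /= e0 H].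
have m0 : 0 < Num.min e (rad x) by rewrite lt_min e0 rad_gt0.
have [e1 e10 H1] := near0_small (mid j) m0.
have e2 : 0 < e1 / 2 by rewrite divr_gt0.
have : e1 / 2 < e1 by lra.
move=> /(H1 _ e2); rewrite lt_min => /andP[a b].
exists (x + e1 / 2 *: mid j); split.
  by apply: sector_tile => //; exact: sectorZ (sector_mid j).
by apply: H; rewrite -ball_normE /= opprD addrA subrr sub0r normrN.
Qed.

(** Regions are open, so the region around [z] meets the component whose closure contains [z]. *)
Lemma tile_col x j z b : tile_at x j z -> region F (clr b) z -> b = colour x j.
Proof.
move=> Tz rz; have := rz => /regionP[e e0 H].
have : nbhs z (region F (clr b)).
  by apply: open_nbhs_nbhs; split => //; exact: open_interior.
rewrite /tile_at /component -lock in Tz.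
move=> /Tz[w [/connected_component_sub w1 w2]].
by apply: clr_inj; rewrite -(region_F w1) -(region_F w2).
Qed.

End LocalStructure.

(** * Elementary forms of convexity and of one-sided limits *)

Section ConvexSets.
Variables (R : realType) (V : lmodType R).

Lemma convex_setP (A : set V) : convex_set (M := V) A <->
  forall x y (t : R), A x -> A y -> 0 <= t <= 1 -> A (t *: x + (1 - t) *: y).
Proof.
split=> [cA x y t Ax Ay /andP[t0 t1]|cA x y l].
  have := cA x y (Itv01 t0 t1).
  by rewrite !inE => /(_ Ax Ay).
rewrite !inE => Ax Ay; apply: (cA x y l%:inum) => //.
by apply/andP; split; [exact: ge0|exact: le1].
Qed.

End ConvexSets.

Lemma nbhs_right0E (R : realType) (P : R -> Prop) :
  (\forall r \near (0 : R)^'+, P r) <->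
  exists2 e : R, 0 < e & forall r, 0 < r -> r < e -> P r.
Proof.
split.
  move=> /(@nbhs_right0P _ 0 P) /nbhs_ballP[e /= e0 H].
  exists e => // r r0 re; have := H r; rewrite add0r; apply => //.
  by rewrite /= -ball_normE /= sub0r normrN gtr0_norm.
move=> [e e0 H]; apply/(@nbhs_right0P _ 0 P)/nbhs_ballP; exists e => //= r.
rewrite -ball_normE /= sub0r normrN add0r => re r0.
by apply: H => //; rewrite gtr0_norm in re.
Qed.

(** * Two-colourings of the twelve sectors *)

Section CyclicWords.
Implicit Types (s : bitseq) (c : nat -> bool) (i : nat).

Definition cyc s i := nth false s (i %% 12)%N.

(** The ray in direction [i] separates the sectors [i - 1] and [i]. *)
Definition change c i := c i != c (i + 11)%N.

Definition changes c := count (change c) (iota 0 12).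

(** Seven sectors of one colour would form an angle greater than pi. *)
Definition no_long_run c :=
  all (fun i => ~~ all (fun k => c (i + k)%N == c i) (iota 0 7)) (iota 0 12).

(** The picture at an inner point of an edge parallel to direction [i]: a half-plane of each
    colour. *)
Definition straight c i :=
  all (fun k => (c (i + k)%N == c i) && (c (i + 6 + k)%N == ~~ c i)) (iota 0 6).

Fixpoint words n : seq bitseq :=
  if n is n'.+1 then [seq b :: s | b <- [:: true; false], s <- words n']
  else [:: [::]].

Lemma words_mem s : s \in words (size s).
Proof.
by elim: s => // b s IH; apply: allpairs_f => //; case: b.
Qed.

(* A property of 12-periodic two-colourings depending only on finitely many
   values is checked on the 4096 words of length 12. *)
Lemma check_words (P : (nat -> bool) -> bool) c :
  (forall i, c (i + 12)%N = c i) ->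
  (forall c c', c =1 c' -> P c = P c') ->
  all (fun s => P (cyc s)) (words 12) -> P c.
Proof.
move=> c12 Pext H.
have cm i : c (i %% 12)%N = c i.
  rewrite [in RHS](divn_eq i 12); elim: (i %/ 12)%N => [//|q IH].
  by rewrite mulSnr addnAC c12.
rewrite (Pext c (cyc (map c (iota 0 12)))).
  apply: (allP H).
  by have := words_mem (map c (iota 0 12)); rewrite size_map size_iota.
move=> i; rewrite /cyc (nth_map 0%N) ?size_iota ?ltn_mod //.
by rewrite nth_iota ?ltn_mod // add0n cm.
Qed.

Lemma eq_changes c c' : c =1 c' -> changes c = changes c'.
Proof. by move=> E; apply: eq_count => i; rewrite /change !E. Qed.

Lemma eq_no_long_run c c' : c =1 c' -> no_long_run c = no_long_run c'.
Proof.
by move=> E; apply: eq_all => i; congr (~~ _); apply: eq_all => k; rewrite !E.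
Qed.

Lemma eq_straight c c' i : c =1 c' -> straight c i = straight c' i.
Proof. by move=> E; apply: eq_all => k; rewrite !E. Qed.

(** The number of changes round a point is even, so here it is two; two runs of at most six sectors
    have six each. *)
Lemma straight_of_few_changes c i : (forall i, c (i + 12)%N = c i) ->
  no_long_run c -> (i < 12)%N -> change c i -> (changes c < 4)%N -> straight c i.
Proof.
move=> c12 nl i12 ch few.
have /implyP/(_ nl)/allP/(_ i) : no_long_run c ==>
    all (fun i => change c i ==> (changes c < 4)%N ==> straight c i) (iota 0 12).
  apply: (check_words c12
    (P := fun c => no_long_run c ==> all _ (iota 0 12))).
    move=> c1 c2 E; rewrite (eq_no_long_run E); congr (_ ==> _).
    by apply: eq_all => j; rewrite (eq_changes E) (eq_straight _ E) /change !E.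
  by vm_compute.
by rewrite mem_iota => /(_ i12)/implyP/(_ ch)/implyP/(_ few).
Qed.

Lemma straight_changes c i : (forall i, c (i + 12)%N = c i) ->
  (i < 12)%N -> straight c i -> (changes c < 4)%N.
Proof.
move=> c12 i12.
have /allP/(_ i) :
    all (fun i => straight c i ==> (changes c < 4)%N) (iota 0 12).
  apply: (check_words c12 (P := fun c => all _ (iota 0 12))).
    by move=> c1 c2 E; apply: eq_all => j; rewrite (eq_changes E) (eq_straight _ E).
  by vm_compute.
by rewrite mem_iota => /(_ i12)/implyP.
Qed.

(** An edge of direction [i] reaches its target between the sectors [i + 5] and [i + 6]. Here [b] is
    the first sector of the run that ends on its left. *)
Lemma run_cw c i : (forall i, c (i + 12)%N = c i) -> no_long_run c ->
  (i < 12)%N -> c (i + 5)%N != c (i + 6)%N ->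
  exists b, [/\ (i <= b <= i + 5)%N, c (b + 11)%N = ~~ c (i + 5)%N &
    forall k, (b <= k <= i + 5)%N -> c k = c (i + 5)%N].
Proof.
move=> c12 nl i12 ch.
have /implyP/(_ nl)/allP/(_ i) : no_long_run c ==>
    all (fun i => (c (i + 5)%N != c (i + 6)%N) ==>
      has (fun b => (c (b + 11)%N == ~~ c (i + 5)%N) &&
        all (fun k => c k == c (i + 5)%N) (iota b (i + 6 - b))) (iota i 6))
     (iota 0 12).
  apply: (check_words c12
    (P := fun c => no_long_run c ==> all _ (iota 0 12))).
    move=> c1 c2 E; rewrite (eq_no_long_run E); congr (_ ==> _).
    apply: eq_all => j; rewrite !E; congr (_ ==> _); apply: eq_has => b.
    by rewrite !E; congr (_ && _); apply: eq_all => k; rewrite !E.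
  by vm_compute.
rewrite mem_iota => /(_ i12)/implyP/(_ ch)/hasP[b].
rewrite mem_iota => bi /andP[/eqP cb /allP H]; exists b; split => //; first lia.
by move=> k kb; apply/eqP/H; rewrite mem_iota; lia.
Qed.

(** The same for the run that begins on the right of the arriving edge; [b] is the first sector
    after it. *)
Lemma run_ccw c i : (forall i, c (i + 12)%N = c i) -> no_long_run c ->
  (i < 12)%N -> c (i + 5)%N != c (i + 6)%N ->
  exists b, [/\ (i + 7 <= b <= i + 12)%N, c b = ~~ c (i + 6)%N &
    forall k, (i + 6 <= k < b)%N -> c k = c (i + 6)%N].
Proof.
move=> c12 nl i12 ch.
have /implyP/(_ nl)/allP/(_ i) : no_long_run c ==>
    all (fun i => (c (i + 5)%N != c (i + 6)%N) ==>
      has (fun b => (c b == ~~ c (i + 6)%N) &&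
        all (fun k => c k == c (i + 6)%N) (iota (i + 6) (b - (i + 6))))
        (iota (i + 7) 6))
     (iota 0 12).
  apply: (check_words c12
    (P := fun c => no_long_run c ==> all _ (iota 0 12))).
    move=> c1 c2 E; rewrite (eq_no_long_run E); congr (_ ==> _).
    apply: eq_all => j; rewrite !E; congr (_ ==> _); apply: eq_has => b.
    by rewrite !E; congr (_ && _); apply: eq_all => k; rewrite !E.
  by vm_compute.
rewrite mem_iota => /(_ i12)/implyP/(_ ch)/hasP[b].
rewrite mem_iota => bi /andP[/eqP cb /allP H]; exists b; split => //; first lia.
by move=> k kb; apply/eqP/H; rewrite mem_iota; lia.
Qed.

End CyclicWords.

(** * Convexity of the tiles *)

Section ConvexTiles.
Variables (R : realType) (F : plane R -> 'F_2) (zF : zebra F).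
Hypothesis cF : zebra_convex F.
Local Notation plane := (plane R).
Local Notation dir := (dir R).
Local Notation sn := (sn R).
Local Notation colour := (colour zF).
Local Notation component := (component zF).
Local Notation germ := (germ zF).
Local Notation rad := (rad zF).
Local Notation tile_at := (tile_at zF).
Implicit Types (x y z h : plane) (i j k n : nat) (b : bool).

Lemma tile_at_tiles x j : tiles F (tile_at x j).
Proof.
by have := tile_at_tile zF x j; rewrite /clr; case: (colour x j); [right|left].
Qed.

Lemma tile_segment x j z z' (t : R) : tile_at x j z -> tile_at x j z' ->
  0 <= t <= 1 -> tile_at x j (t *: z + (1 - t) *: z').
Proof. by have [_ /convex_setP] := cF (tile_at_tiles x j); apply. Qed.

Lemma tile_bounded x j : exists M : R, forall z, tile_at x j z -> `|z| < M.
Proof.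
have [[M0 [_ H]] _] := cF (tile_at_tiles x j).
have M1 : M0 < `|M0| + 1 by rewrite (le_lt_trans (ler_norm _)) // ltrDl.
exists (`|M0| + 2) => z Tz; apply: le_lt_trans (H _ M1 _ Tz) _.
by lra.
Qed.

Lemma germ_tile x j y k : germ x j = germ y k -> tile_at x j = tile_at y k.
Proof. by rewrite /tile_at => -[_ ->]. Qed.

(** For a sector with boundary rays [m0] and [m1], a point [w] beyond the line of [m0] pulls a small
    vector close to [m0] across that line; positivity of [det2 q] keeps the result from leaving the
    neighbouring sector on its far side. *)
Lemma perturb_direction (p q m0 m1 w : plane) (r : R) :
  det2 p m0 = 0 -> 0 < det2 q m0 -> 0 <= det2 q m1 -> 0 < det2 p w -> 0 < r ->
  exists a b t : R, [/\ 0 < a, 0 < b, 0 <= t <= 1,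
    `|a *: m0 + b *: m1| < r /\
    `|(1 - t) *: (a *: m0 + b *: m1) + t *: w| < r &
    0 < det2 p ((1 - t) *: (a *: m0 + b *: m1) + t *: w) /\
    0 < det2 q ((1 - t) *: (a *: m0 + b *: m1) + t *: w)].
Proof.
move=> pm0 qm0 qm1 pw r0.
move DE : (det2 p w) pw => D pw.
move QE : (det2 q m0) qm0 => Q qm0.
have [S S0 s] : exists2 S : R, 0 <= S & - S <= det2 p m1.
  by exists `|det2 p m1|; rewrite ?normr_ge0 // lerNl -normrN ler_norm.
have [C C0 c] : exists2 C : R, 0 <= C & - C <= det2 q w.
  by exists `|det2 q w|; rewrite ?normr_ge0 // lerNl -normrN ler_norm.
(* The weights are chosen in the order [tau], [eta], [eps]: the share of [w] costs [q] at most
   [Q / 4], the share of [m1] costs [p] less than the gain [tau * D], and [eps] makes the vectors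
   short. *)
have [tau tau0 tauE] : exists2 tau, 0 < tau & tau * (4 * (1 + C + Q)) = Q.
  have n0 : 0 < 4 * (1 + C + Q) by rewrite mulr_gt0 //; lra.
  by exists (Q / (4 * (1 + C + Q))); rewrite ?divr_gt0 // divfK // gt_eqF.
have [eta eta0 etaE] : exists2 eta, 0 < eta & eta * (1 + S) = tau * D.
  have n0 : 0 < 1 + S by lra.
  exists (tau * D / (1 + S)); last by rewrite divfK // gt_eqF.
  by apply: divr_gt0 => //; exact: mulr_gt0.
pose B := `|m0| + eta * `|m1| + tau * `|w|.
have B0 : 0 <= B by rewrite !addr_ge0 // mulr_ge0 // ltW.
have [eps eps0 [eps1 epsB]] : exists2 eps : R, 0 < eps & eps <= 1 /\ eps * B < r.
  have n0 : 0 < 1 + B by lra.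
  exists (Num.min 1 (r / (1 + B))).
    by rewrite lt_min ltr01 divr_gt0.
  split; first by rewrite ge_min lexx.
  have : Num.min 1 (r / (1 + B)) <= r / (1 + B) by rewrite ge_min lexx orbT.
  have : 0 < Num.min 1 (r / (1 + B)) by rewrite lt_min ltr01 divr_gt0.
  by rewrite ler_pdivlMr //; move: (Num.min _ _) => e; nra.
have tau1 : tau <= 4^-1 by nra.
exists eps, (eps * eta), (eps * tau); split => //; first exact: mulr_gt0.
- by apply/andP; split; [apply: mulr_ge0; apply: ltW|nra].
- split; apply: le_lt_trans epsB; rewrite (le_trans (ler_normD _ _)) // !normrZ.
    rewrite !gtr0_norm ?mulr_gt0 // /B -mulrA -mulrDr ler_pM2l // lerDl.
    by rewrite mulr_ge0 // ltW.
  have u0 : 0 <= 1 - eps * tau by nra.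
  rewrite (ger0_norm u0) (gtr0_norm eps0) (gtr0_norm tau0).
  have N : `|eps *: m0 + (eps * eta) *: m1| <= eps * (`|m0| + eta * `|m1|).
    rewrite (le_trans (ler_normD _ _)) // !normrZ.
    by rewrite !gtr0_norm ?mulr_gt0 // -mulrA -mulrDr.
  have N' : (1 - eps * tau) * `|eps *: m0 + (eps * eta) *: m1| <=
     `|eps *: m0 + (eps * eta) *: m1|.
    by rewrite ler_piMl // gerBl mulr_ge0 // ltW.
  by rewrite /B; lra.
- rewrite !det2Dr !det2Zr !det2Dr !det2Zr pm0 DE QE mulr0 add0r.
  have et : 0 <= eps * tau <= 4^-1.
    by apply/andP; split; [apply: mulr_ge0; apply: ltW|nra].
  split.
    have -> : (1 - eps * tau) * (eps * eta * det2 p m1) + eps * tau * D =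
       eps * ((1 - eps * tau) * (eta * det2 p m1) + tau * D) by ring.
    apply: mulr_gt0 => //; rewrite -etaE.
    have h1 : - (eta * S) <= eta * det2 p m1 by nra.
    have h2 : - (eta * S) <= (1 - eps * tau) * (eta * det2 p m1).
      have h3 : 0 <= eta * S by apply: mulr_ge0 => //; exact: ltW.
      by move: et h1 h3; move: (eta * S) (eta * det2 p m1) (eps * tau) => u v w' *; nra.
    by lra.
  have -> : (1 - eps * tau) * (eps * Q + eps * eta * det2 q m1) +
      eps * tau * det2 q w =
    eps * ((1 - eps * tau) * (Q + eta * det2 q m1) + tau * det2 q w) by ring.
  apply: mulr_gt0 => //.
  have h1 : 0 <= eta * det2 q m1 by rewrite mulr_ge0 // ltW.
  have h2 : - (tau * C) <= tau * det2 q w by nra.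
  have h3 : tau * C <= Q / 4 by nra.
  by move: et h1; move: (eta * det2 q m1) (eps * tau) => u v *; nra.
Qed.

(* Otherwise the segments from this point to the sector [k] would enter the
   next sector, of the other colour. *)
Lemma tile_left_of_ray y k z : tile_at y k z ->
  0 < det2 (dir k.+1) (z - y) -> colour y k.+1 = colour y k.
Proof.
move=> Tz D.
have q0 : det2 (- dir k.+2) (dir k.+1) = sn 1.
  by rewrite det2Nl det2C opprK det_dirS.
have q1 : det2 (- dir k.+2) (dir k) = sn 2.
  by rewrite det2Nl det2C opprK -addn2 det_dir.
have [||a [b [t [a0 b0 t01 [n1 n2] [p1 p2]]]]] := perturb_direction
  (q := - dir k.+2) (m1 := dir k) (det2xx _) _ _ D (rad_gt0 zF y).
- by rewrite q0 sn1_gt0.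
- by rewrite q1 sn_ge0.
set m := a *: dir k.+1 + b *: dir k in n1 n2 p1 p2.
have s : sector k m by rewrite /m addrC; exact: sector_comb.
have Tm : tile_at y k (y + m) by apply: subset_closure; exact: sector_tile.
have E : t *: z + (1 - t) *: (y + m) = y + ((1 - t) *: m + t *: (z - y)).
  rewrite scalerDr scalerBr scalerBl scale1r.
  by apply/matrixP => u v; rewrite !mxE; ring.
have := tile_segment Tz Tm t01; rewrite E => Tw.
apply: tile_col Tw _; apply: region_sector => //; split => //.
by move: p2; rewrite det2Nl det2C opprK.
Qed.

(** Mirror image of [tile_left_of_ray], for the ray that bounds sector [k] on the right. *)
Lemma tile_right_of_ray y k z : tile_at y k z ->
  det2 (dir k) (z - y) < 0 -> colour y (k + 11) = colour y k.
Proof.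
move=> Tz D.
have dE : dir (k + 11).+1 = dir k by rewrite -addnS dirD12.
have D' : 0 < det2 (- dir k) (z - y) by rewrite det2Nl oppr_gt0.
have q0 : det2 (dir (k + 11)) (dir k) = sn 1 by rewrite -dE det_dirS.
have q1 : det2 (dir (k + 11)) (dir k.+1) = sn 2.
  by rewrite -(dirD12 _ k.+1) (_ : k.+1 + 12 = k + 11 + 2)%N ?det_dir //; lia.
have pm : det2 (- dir k) (dir k) = 0 by rewrite det2Nl det2xx oppr0.
have [||a [b [t [a0 b0 t01 [n1 n2] [p1 p2]]]]] := perturb_direction
  (q := dir (k + 11)) (m1 := dir k.+1) pm _ _ D' (rad_gt0 zF y).
- by rewrite q0 sn1_gt0.
- by rewrite q1 sn_ge0.
set m := a *: dir k + b *: dir k.+1 in n1 n2 p1 p2.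
have s : sector k m by exact: sector_comb.
have Tm : tile_at y k (y + m) by apply: subset_closure; exact: sector_tile.
have E : t *: z + (1 - t) *: (y + m) = y + ((1 - t) *: m + t *: (z - y)).
  by apply/matrixP => u v; rewrite !mxE; ring.
have := tile_segment Tz Tm t01; rewrite E => Tw.
apply: tile_col Tw _; apply: region_sector => //; split => //.
by move: p1; rewrite det2Nl -det2C dE.
Qed.

(** The first of seven sectors lies to the left of the ray that ends the last one, so
    [tile_left_of_ray] passes the colour on to the next sector, and so on round the point. *)
Lemma long_run_const x i b : (forall k, (k <= 6)%N -> colour x (i + k) = b) ->
  forall j, colour x j = b.
Proof.
move=> H.
have step n : forall k, (k <= 6)%N -> colour x (i + n + k) = b.
  elim: n => [|n IH] k; first by rewrite addn0; exact: H.
  rewrite leq_eqVlt => /orP[/eqP ->|k6]; last by rewrite addnS addSnnS IH.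
  have -> : (i + n.+1 + 6 = (i + n + 6).+1)%N by lia.
  rewrite (@tile_left_of_ray _ _ (x + germ_pt zF x (i + n))) ?IH //.
    rewrite (germ_tile (germ_run IH (leqnn 6))); apply: subset_closure.
    apply: sector_tile; [exact: germ_pt_sector|exact: germ_pt_norm].
  rewrite addrC addKr; apply: (@sector_pos _ _ 5) => //.
  by rewrite (_ : _ + _ = i + n + 12)%N ?sectorD12; [exact: germ_pt_sector|lia].
move=> j; rewrite -(step (j + 12 * i - i)%N 0%N isT) addn0.
by apply: col_eq_mod; rewrite (_ : _ + _ = i * 12 + j)%N ?modnMDl //; lia.
Qed.

Lemma col_no_long_run x : ~ (exists b, forall j, colour x j = b) ->
  no_long_run (colour x).
Proof.
move=> nc; apply/allP => i _; apply/negP => /allP H; apply: nc.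
exists (colour x i); apply: (@long_run_const _ i) => k k6.
by have := H k; rewrite mem_iota add0n ltnS k6 => /(_ isT)/eqP.
Qed.

Lemma change_not_const x i : change (colour x) i ->
  ~ (exists b, forall j, colour x j = b).
Proof. by move=> ch [b H]; move: ch; rewrite /change !H eqxx. Qed.

Lemma change_skeleton x i : change (colour x) i -> skeleton F x.
Proof.
move=> ch rx; apply: (change_not_const ch).
case: rx => rx; [exists false|exists true] => j.
  exact: (@region_col _ _ zF x false j rx).
exact: (@region_col _ _ zF x true j rx).
Qed.

(** A direction inside a sector, or between two sectors of one colour, enters a region; only rays
    with a colour change stay in the skeleton. *)
Lemma edge_directionP x u : edge_direction F x u <->
  exists i, [/\ (i < 12)%N, u = dir i & change (colour x) i].
Proof.
split=> [[u1 /nbhs_right0E[e e0 H]]|[i [i12 -> ch]]].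
  have u0 : u != 0.
    apply/eqP => uE; move: u1; rewrite uE /dot !mxE !mul0r addr0 => /eqP.
    by rewrite eq_sym oner_eq0.
  have sk b r : 0 < r -> r < e -> ~ region F (clr b) (x + r *: u).
    by move=> r0 re rg; apply: (H _ r0 re); case: b rg; [right|left].
  have [e1 e10 H1] := near0_small u (rad_gt0 zF x).
  pose r := Num.min e e1 / 2.
  have m0 : 0 < Num.min e e1 by rewrite lt_min e0.
  have r0 : 0 < r by rewrite divr_gt0.
  have : r < Num.min e e1 by rewrite /r; lra.
  rewrite lt_min => /andP[re /(H1 _ r0) rn].
  have [i i12 [s|[t t0 uE]]] := sector_cases u0.
    by case: (sk _ _ r0 re (region_sector (sectorZ r0 s) rn)).
  have t1 : t = 1.
    apply/eqP; have := u1; rewrite uE dotZl dotZr dir_norm mulr1 -expr2 => /eqP.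
    by rewrite sqrf_eq1 => /orP[//|/eqP tN]; move: t0; rewrite tN ltr0N1.
  rewrite t1 scale1r in uE; exists i; split => //.
  apply/negP => /eqP cE; rewrite uE in rn re sk.
  by case: (sk (colour x i) _ r0 re); exact: region_ray.
split; first exact: dir_norm.
apply/nbhs_right0E; have [e1 e10 H1] := near0_small (dir i) (rad_gt0 zF x).
exists e1 => // r r0 /(H1 _ r0) rn; apply: (@change_skeleton _ i).
rewrite /change.
have [c1 _] := germ_left r0 rn (isT : (0 < 6)%N).
have [c2 _] := germ_right r0 rn (isT : (5 < 6)%N).
move: c1 c2; rewrite addn0 -addnA (_ : 6 + 5 = 11)%N // => -> ->.
exact: ch.
Qed.

Lemma dir_inj i j : (i < 12)%N -> (j < 12)%N -> dir i = dir j -> i = j.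
Proof.
wlog ij : i j / (i <= j)%N => [H i12 j12 E|].
  by case: (leqP i j) => ij; [exact: H|apply/esym/H => //; exact: ltnW].
move=> i12 j12 E; apply/eqP/negPn/negP => nij.
have := det2xx (dir i); rewrite {2}E -(subnKC ij) det_dir => s0.
have k0 : (0 < j - i)%N by lia.
case: (ltngtP (j - i) 6) => k6.
- by have := @sn_gt0 R (j - i); rewrite k0 k6 s0 ltxx => /(_ isT).
- have k6' : (0 < j - i - 6 < 6)%N by lia.
  have := sn_gt0 R k6'; move: s0; have -> : (j - i = j - i - 6 + 6)%N by lia.
  by rewrite snD6 addnK => /eqP; rewrite oppr_eq0 => /eqP ->; rewrite ltxx.
- have d0 : dir i = 0.
    move: E; rewrite -(subnKC ij) k6 dirD6 => /eqP.
    by rewrite -addr_eq0 -mulr2n -scaler_nat scaler_eq0 pnatr_eq0 => /eqP.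
  have := dir_norm R i; rewrite d0 /dot !mxE !mul0r addr0 => /eqP.
  by rewrite eq_sym oner_eq0.
Qed.

Lemma vertexP x : vertex F x <-> (4 <= changes (colour x))%N.
Proof.
rewrite /changes -size_filter.
pose s := [seq i <- iota 0 12 | change (colour x) i]; rewrite -/s.
have us : uniq s by rewrite filter_uniq // iota_uniq.
have sP i : (i \in s) = ((i < 12)%N && change (colour x) i).
  by rewrite mem_filter mem_iota andbC.
split=> [[u u_inj /(_ _)/edge_directionP H]|s4].
  pose f (a : 'I_4) : nat := projT1 (cid (H a)).
  have fP a : [/\ (f a < 12)%N, u a = dir (f a) & change (colour x) (f a)].
    by rewrite /f; case: (cid (H a)).
  have f_inj : injective f.
    by move=> a b E; apply: u_inj; have [_ -> _] := fP a; have [_ -> _] := fP b; rewrite E.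
  have := @uniq_leq_size _ [seq f a | a <- enum 'I_4] s.
  rewrite map_inj_uniq // enum_uniq size_map size_enum_ord; apply => //.
  by move=> _ /mapP[a _ ->]; rewrite sP; have [-> _ ->] := fP a.
have ns (a : 'I_4) : nth 0%N s a \in s.
  by apply: mem_nth; apply: leq_trans (ltn_ord a) s4.
exists (fun a : 'I_4 => dir (nth 0%N s a)).
  move=> a b; have := ns a; have := ns b; rewrite !sP => /andP[b12 _] /andP[a12 _].
  move=> /(dir_inj a12 b12)/eqP; rewrite nth_uniq //.
  - by move=> /eqP/val_inj.
  - by apply: leq_trans (ltn_ord a) s4.
  - by apply: leq_trans (ltn_ord b) s4.
move=> a; apply/edge_directionP; exists (nth 0%N s a).
by have := ns a; rewrite sP => /andP[-> ->].
Qed.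

Lemma nonvertex_straight x i : (i < 12)%N -> change (colour x) i -> ~ vertex F x ->
  straight (colour x) i.
Proof.
move=> i12 ch nv; have : (changes (colour x) < 4)%N.
  by rewrite ltnNge; apply/negP => /vertexP.
apply: straight_of_few_changes => //; first exact: colD12.
by apply: col_no_long_run; exact: change_not_const ch.
Qed.

Lemma straight_nonvertex x i : (i < 12)%N -> straight (colour x) i -> ~ vertex F x.
Proof.
move=> i12 st /vertexP; apply/negP; rewrite -ltnNge.
by apply: straight_changes st => //; exact: colD12.
Qed.

End ConvexTiles.


(** * Edges and their successors *)

Section Edges.
Variables (R : realType) (F : plane R -> 'F_2) (zF : zebra F).
Hypothesis cF : zebra_convex F.
Local Notation plane := (plane R).
Local Notation dir := (dir R).
Local Notation colour := (colour zF).
Local Notation germ := (germ zF).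
Local Notation rad := (rad zF).
Local Notation tile_at := (tile_at zF).
Implicit Types (x y z h : plane) (i j k n b : nat) (e : plane * plane).

(* [f] and [g] describe a point as seen when leaving it in the direction [d]
   and when arriving at it. *)
Lemma ray_const (X : Type) (f g : plane -> X) (d x : plane) (t : R) :
  (forall z, exists2 r : R, 0 < r &
     forall s, 0 < s -> s < r -> f (z + s *: d) = f z) ->
  (forall z, exists2 r : R, 0 < r &
     forall s, 0 < s -> s < r -> f (z - s *: d) = g z) ->
  0 < t -> (forall s, 0 < s -> s < t -> g (x + s *: d) = f (x + s *: d)) ->
  g (x + t *: d) = f x.
Proof.
move=> fwd bwd t0 H.
(* The guard makes [G] trivial beyond [t], where [H] gives no information. *)
pose G s := s < t -> f (x + s *: d) = f x.
have back s : 0 < s -> (forall u, 0 < u -> u < s -> f (x + u *: d) = f x) ->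
    g (x + s *: d) = f x.
  move=> s0 below; have [r r0 Hr] := bwd (x + s *: d).
  pose u := Num.min s r / 2.
  have m0 : 0 < Num.min s r by rewrite lt_min s0.
  have u0 : 0 < u by rewrite divr_gt0.
  have : u < Num.min s r by rewrite /u; lra.
  rewrite lt_min => /andP[us /(Hr _ u0) <-].
  by rewrite -addrA -scalerBl below ?subr_gt0 // gtrBl.
have [r r0 Hr] := fwd x.
have [||Gall|[s [s0 nG below]]] := first_exit (G := G).
- by exists r; [exact: r0|move=> s s0 sr _; exact: Hr].
- move=> s s0 Gs; have [r' r'0 Hr'] := fwd (x + s *: d).
  exists r'; [exact: r'0|move=> u su ur ut]; have -> : u = s + (u - s) by ring.
  rewrite scalerDl addrA Hr' ?subr_gt0 //; first by apply: Gs; exact: lt_trans ut.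
  by rewrite ltrBlDl.
- apply: back => // u u0 ut; exact: Gall.
- apply: (back t) => // u u0 ut; case: (ltP u s) => us; first exact: below.
  case: nG => st; rewrite -H // back // => v v0 vs.
  by apply: below => //; exact: lt_trans st.
Qed.

Let mod12 j : (j %% 12 < 12)%N.
Proof. exact: ltn_pmod. Qed.

Lemma near_ray x i : exists2 r : R, 0 < r &
  forall s, 0 < s -> s < r -> `|s *: dir i| < rad x.
Proof. exact/near0_small/rad_gt0. Qed.

(** In direction [i] the sector on the left is [i] on departure and [i + 5] on arrival; on the right
    these are [i + 11] and [i + 6]. *)
Lemma germ_ray_left x i (t : R) : 0 < t ->
  (forall s, 0 < s -> s < t ->
     germ (x + s *: dir i) (i + 5) = germ (x + s *: dir i) i) ->
  germ (x + t *: dir i) (i + 5) = germ x i.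
Proof.
apply: (ray_const (f := germ^~ i) (g := germ^~ (i + 5)%N)) => z.
  have [r r0 H] := near_ray z i; exists r; [exact: r0|move=> s s0 /(H _ s0) n].
  by have := germ_left s0 n (isT : (0 < 6)%N); rewrite addn0.
have [r r0 H] := near_ray z (i + 6); exists r; [exact: r0|move=> s s0 /(H _ s0) n].
have := germ_right s0 n (isT : (0 < 6)%N); rewrite dirD6 scalerN addn0.
have E1 : (i + 6 + 6 = i + 12)%N by lia.
have E2 : (i + 6 + 11 = i + 5 + 12)%N by lia.
by rewrite E1 E2 !germD12.
Qed.

Lemma germ_ray_right x i (t : R) : 0 < t ->
  (forall s, 0 < s -> s < t ->
     germ (x + s *: dir i) (i + 6) = germ (x + s *: dir i) (i + 11)) ->
  germ (x + t *: dir i) (i + 6) = germ x (i + 11).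
Proof.
apply: (ray_const (f := germ^~ (i + 11)%N) (g := germ^~ (i + 6)%N)) => z.
  have [r r0 H] := near_ray z i; exists r; [exact: r0|move=> s s0 /(H _ s0) n].
  by have := germ_right s0 n (isT : (5 < 6)%N); rewrite -addnA.
have [r r0 H] := near_ray z (i + 6); exists r; [exact: r0|move=> s s0 /(H _ s0) n].
by have := germ_left s0 n (isT : (5 < 6)%N); rewrite dirD6 scalerN -addnA.
Qed.

Lemma ray_leaves_tile x i j :
  ~ (forall t : R, 0 < t -> tile_at x j (x + t *: dir i)).
Proof.
move=> H; have [M HM] := tile_bounded zF cF x j.
have d0 : 0 < `|dir i|.
  rewrite normr_gt0; apply/eqP => d0.
  have := dir_norm R i; rewrite d0 /dot !mxE !mul0r addr0 => /eqP.
  by rewrite eq_sym oner_eq0.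
have M0 : 0 < M.
  by apply: le_lt_trans (HM _ (H 1 ltr01)).
pose t := (M + `|x|) / `|dir i|.
have Mx : 0 < M + `|x| by rewrite ltr_pwDl.
have t0 : 0 < t by rewrite divr_gt0.
have := HM _ (H _ t0).
have : `|t *: dir i| <= `|x + t *: dir i| + `|x|.
  rewrite -[in leRHS](normrN x); apply: le_trans (ler_normD _ _).
  by rewrite addrAC subrr add0r.
by rewrite normrZ gtr0_norm // /t divfK ?gt_eqF //; lra.
Qed.

Lemma straightP c i : straight c i <->
  forall k, (k < 6)%N -> c (i + k)%N = c i /\ c (i + 6 + k)%N = ~~ c i.
Proof.
split=> [/allP H k k6|H].
  by have := H k; rewrite mem_iota => /(_ k6)/andP[/eqP -> /eqP ->].
by apply/allP => k; rewrite mem_iota => /H[-> ->]; rewrite !eqxx.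
Qed.

Lemma straightD6 c i : (forall i, c (i + 12)%N = c i) -> straight c (i + 6) ->
  straight c i /\ c i = ~~ c (i + 6)%N.
Proof.
move=> c12 /straightP H.
have ci : c i = ~~ c (i + 6)%N.
  by have [_] := H 0%N isT; rewrite addn0 -addnA c12.
split => //; apply/straightP => k /H[h1]; rewrite h1 ci negbK => h2; split => //.
have E : (i + 6 + 6 + k = i + k + 12)%N by lia.
by rewrite -h2 E c12.
Qed.

Lemma change_straight x i : change (colour x) i -> ~ vertex F x ->
  straight (colour x) i.
Proof.
move=> ch nv.
have cm j : colour x (i %% 12 + j) = colour x (i + j).
  by apply: col_eq_mod; rewrite modnDml.
have : straight (colour x) (i %% 12).
  apply: nonvertex_straight => //.
  by rewrite /change cm -(addn0 (i %% 12)%N) cm addn0.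
have c0 : colour x (i %% 12) = colour x i by have := cm 0%N; rewrite !addn0.
move=> /straightP H; apply/straightP => k /H.
by rewrite cm -!addnA cm c0.
Qed.

Lemma near_straight x i : change (colour x) i -> exists2 r : R, 0 < r &
  forall s, 0 < s -> s < r -> straight (colour (x + s *: dir i)) i /\
    colour (x + s *: dir i) i = colour x i.
Proof.
move=> ch; have [r r0 H] := near_ray x i; exists r; [exact: r0|move=> s s0 /(H _ s0) n].
have c0 : colour (x + s *: dir i) i = colour x i.
  by have [] := germ_left s0 n (isT : (0 < 6)%N); rewrite addn0.
split => //; apply/straightP => k k6; rewrite c0.
have [-> _] := germ_left s0 n k6; have [-> _] := germ_right s0 n k6.
by split => //; move: ch; rewrite /change; case: (colour x i); case: (colour _ _).
Qed.

Lemma straight_germs x i : straight (colour x) i ->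
  germ x (i + 5) = germ x i /\ germ x (i + 6) = germ x (i + 11).
Proof.
move=> /straightP H; split.
  apply: (@germ_run _ _ _ _ _ 5 (colour x i)) => [k k5|]; last exact: leqnn.
  by have [] := H k k5.
have -> : (i + 11 = i + 6 + 5)%N by lia.
apply/esym; apply: (@germ_run _ _ _ _ _ 5 (~~ colour x i)) => [k k5|]; last exact: leqnn.
by have [] := H k k5.
Qed.

Lemma straight_change x i : straight (colour x) i -> change (colour x) i.
Proof.
move=> /straightP/(_ 5%N isT)[_]; rewrite -addnA /change => ->.
by case: (colour x i).
Qed.

(** Follow the ray while the picture stays straight. If this never ended, the tile on its left would
    contain an unbounded ray. At the first other point the ray still arrives between two colours,
    and a colour change at a point that is no vertex is straight. *)
Lemma ray_to_vertex x i : change (colour x) i -> exists t : R,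
  [/\ 0 < t, vertex F (x + t *: dir i),
      germ (x + t *: dir i) (i + 5) = germ x i,
      germ (x + t *: dir i) (i + 6) = germ x (i + 11) &
      forall s, 0 < s -> s < t -> straight (colour (x + s *: dir i)) i /\
        colour (x + s *: dir i) i = colour x i].
Proof.
move=> ch.
pose G s := straight (colour (x + s *: dir i)) i /\
  colour (x + s *: dir i) i = colour x i.
have left t : 0 < t -> (forall s, 0 < s -> s < t -> G s) ->
    germ (x + t *: dir i) (i + 5) = germ x i.
  move=> t0 below; apply: (germ_ray_left t0) => s s0 st.
  by have [/straight_germs[]] := below s s0 st.
have right t : 0 < t -> (forall s, 0 < s -> s < t -> G s) ->
    germ (x + t *: dir i) (i + 6) = germ x (i + 11).
  move=> t0 below; apply: (germ_ray_right t0) => s s0 st.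
  by have [/straight_germs[]] := below s s0 st.
have [||Gall|[t [t0 nG below]]] := first_exit (G := G).
- exact: near_straight.
- move=> t t0 [st c0]; have [r r0 H] := near_straight (straight_change st).
  exists r; [exact: r0|move=> s ts sr]; have -> : s = t + (s - t) by ring.
  rewrite /G scalerDl addrA -c0; apply: H; first by rewrite subr_gt0.
  by rewrite ltrBlDl.
- case: (@ray_leaves_tile x i i) => t t0.
  rewrite -(germ_tile (left t t0 _)); last by move=> s s0 _; exact: Gall.
  exact: center_tile.
have L := left t t0 below; have Rt := right t t0 below.
exists t; split; [exact: t0| |exact: L|exact: Rt|exact: below].
apply: contrapT => nv; apply: nG.
have [L1 _] := L; have [R1 _] := Rt.
have ch6 : change (colour (x + t *: dir i)) (i + 6).
  rewrite /change -addnA (_ : 6 + 11 = 5 + 12)%N // addnA colD12 L1 R1.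
  by rewrite eq_sym.
have [st c0] := straightD6 (colD12 zF _) (change_straight ch6 nv).
split; [exact: st|rewrite c0 R1]; move: ch; rewrite /change.
by case: (colour x i); case: (colour _ _).
Qed.

(** Without any colour change a single tile would contain a whole ray. *)
Lemma exists_change : exists x i, (i < 12)%N /\ change (colour x) i.
Proof.
apply: contrapT => H.
have nc x i : colour x i.+1 = colour x i.
  apply: contrapT => /eqP ch; apply: H; exists x, (i.+1 %% 12)%N.
  split; first by rewrite ltn_mod.
  rewrite /change (col_eq_mod zF x (modn_mod i.+1 12)).
  rewrite (@col_eq_mod _ _ zF x (i.+1 %% 12 + 11) i) // modnDml.
  by rewrite addSnnS modnDr.
have all_eq x j : colour x j = colour x 0 by elim: j => // j <-; exact: nc.
apply: (@ray_leaves_tile 0 0 0) => t t0.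
rewrite -(@germ_tile _ _ zF (0 + t *: dir 0) 5 0 0); first exact: center_tile.
apply: (germ_ray_left t0) => s s0 st.
by rewrite !(germ_const (all_eq _)).
Qed.

Definition edge_dir e i := [/\ edge F e, (i < 12)%N &
  exists2 t : R, 0 < t & e.2 = e.1 + t *: dir i].

Lemma edge_intro x i (t : R) : (i < 12)%N -> 0 < t ->
  vertex F x -> vertex F (x + t *: dir i) ->
  (forall s, 0 < s -> s < t -> straight (colour (x + s *: dir i)) i /\
     colour (x + s *: dir i) i = false) ->
  edge_dir (x, x + t *: dir i) i.
Proof.
move=> i12 t0 vx vy H; split; [split; [exact: vx|exact: vy| |]|exact: i12|by exists t] => /=.
  move=> /eqP; rewrite -subr_eq0 opprD addrA subrr sub0r oppr_eq0 scaler_eq0.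
  rewrite gt_eqF //= => /eqP d0.
  have := dir_norm R i; rewrite d0 /dot !mxE !mul0r addr0 => /eqP.
  by rewrite eq_sym oner_eq0.
move=> _ [tau /= /andP[tau0 tau1] <-].
have -> : (1 - tau) *: x + tau *: (x + t *: dir i) = x + (tau * t) *: dir i.
  by apply/matrixP => u v; rewrite !mxE; ring.
have s0 : 0 < tau * t by rewrite mulr_gt0.
have st : tau * t < t by rewrite gtr_pMl.
have [sz c0] := H _ s0 st.
have E : x + t *: dir i - x = t *: dir i by rewrite addrC addKr.
rewrite E rot90Z rot90_dir; move: (x + (tau * t) *: dir i) sz c0 => z sz c0.
have /straightP P := sz.
have {}P k : (k < 6)%N -> colour z (i + k) = false /\ colour z (i + 6 + k) = true.
  by move=> /P; rewrite c0.
split.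
- exact: straight_nonvertex sz.
(* The rotated edge points in direction [i + 3], between the white sectors [i + 2] and [i + 3]. *)
- have [r r0 Hr] := near_ray z (i + 3).
  apply/nbhs_right0E; exists (r / t); first exact: divr_gt0.
  move=> u u0; rewrite ltr_pdivlMr // => ur; rewrite scalerA.
  apply: (@region_ray _ _ zF _ _ _ false); [exact: mulr_gt0| | |].
  + by apply: Hr => //; exact: mulr_gt0.
  + by have [] := P 3%N isT.
  + rewrite -addnA (_ : 3 + 11 = 2 + 12)%N // addnA colD12.
    by have [] := P 2%N isT.
- have [r r0 Hr] := near_ray z (i + 9).
  apply/nbhs_right0E; exists (r / t); first exact: divr_gt0.
  move=> u u0; rewrite ltr_pdivlMr // => ur.
  have -> : z - u *: (t *: dir (i + 3)) = z + (u * t) *: dir (i + 9).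
    have -> : (i + 9 = i + 3 + 6)%N by rewrite -addnA.
    by rewrite scalerA dirD6 scalerN.
  apply: (@region_ray _ _ zF _ _ _ true); [exact: mulr_gt0| | |].
  + by apply: Hr => //; exact: mulr_gt0.
  + by have [] := P 3%N isT; rewrite -addnA.
  + rewrite -addnA (_ : 9 + 11 = 6 + 2 + 12)%N // !addnA colD12.
    by have [] := P 2%N isT.
Qed.

Lemma edge_segment_ray x i (s t : R) : 0 < s -> s < t ->
  open_segment x (x + t *: dir i) (x + s *: dir i).
Proof.
move=> s0 st; have t0 : 0 < t by exact: lt_trans st.
exists (s / t); first by rewrite /= divr_gt0 //= ltr_pdivrMr // mul1r.
apply/matrixP => u v; rewrite !mxE; field.
by rewrite gt_eqF.
Qed.

(** [edge] only gives the colours perpendicular to the edge. A slightly later point of the edge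
    sees, in its sectors [i + 3] and [i + 9], the sectors [i] and [i - 1] of the given point; so
    these differ in colour, and a colour change at a point that is no vertex is straight. *)
Lemma edge_interior e i (s t : R) : edge F e -> e.2 = e.1 + t *: dir i ->
  0 < s -> s < t -> straight (colour (e.1 + s *: dir i)) i /\
     colour (e.1 + s *: dir i) i = false.
Proof.
case: e => x y /= [_ _ _ /= H] yE; rewrite {}yE in H.
have sides s' : 0 < s' -> s' < t -> [/\ ~ vertex F (x + s' *: dir i),
    colour (x + s' *: dir i) (i + 3) = false &
    colour (x + s' *: dir i) (i + 9) = true].
  move=> s0 st; have t0 : 0 < t by exact: lt_trans st.
  have [nv] := H _ (edge_segment_ray x i s0 st).
  have -> : x + t *: dir i - x = t *: dir i by rewrite addrC addKr.
  move: (x + s' *: dir i) nv => z nv.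
  rewrite rot90Z rot90_dir => /nbhs_right0E[r r0 H0] /nbhs_right0E[r' r'0 H1].
  have aux j (c : bool) : (exists2 u : R, 0 < u & forall v, 0 < v -> v < u ->
      region F (clr c) (z + v *: dir j)) -> colour z j = c.
    move=> [u u0 Hu]; have [w w0 Hw] := near_ray z j.
    pose v := Num.min u w / 2.
    have m0 : 0 < Num.min u w by rewrite lt_min u0.
    have v0 : 0 < v by rewrite divr_gt0.
    have : v < Num.min u w by rewrite /v; lra.
    rewrite lt_min => /andP[/(Hu _ v0) rg /(Hw _ v0) n].
    have [E _] := germ_left v0 n (isT : (0 < 6)%N).
    by rewrite -E; exact: region_col rg.
  split => //; apply: aux.
    exists (r * t); first exact: mulr_gt0.
    move=> v v0 vr; have := H0 (v / t); rewrite divr_gt0 // ltr_pdivrMr //.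
    by rewrite scalerA divfK ?gt_eqF //; exact.
  exists (r' * t); first exact: mulr_gt0.
  move=> v v0 vr; have := H1 (v / t); rewrite divr_gt0 // ltr_pdivrMr //.
  rewrite scalerA divfK ?gt_eqF // => /(_ isT vr).
  have -> : (i + 9 = i + 3 + 6)%N by rewrite -addnA.
  by rewrite dirD6 scalerN.
move=> s0 st; have [nv _ _] := sides _ s0 st.
have [r r0 Hr] := near_ray (x + s *: dir i) i.
pose u := Num.min r (t - s) / 2.
have m0 : 0 < Num.min r (t - s) by rewrite lt_min r0 subr_gt0.
have u0 : 0 < u by rewrite divr_gt0.
have : u < Num.min r (t - s) by rewrite /u; lra.
rewrite lt_min => /andP[/(Hr _ u0) n ut].
have [l1 _] := germ_left u0 n (isT : (3 < 6)%N).
have [l2 _] := germ_right u0 n (isT : (3 < 6)%N).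
have [||_] := sides (s + u); [by rewrite addr_gt0|by rewrite -ltrBrDl|].
rewrite scalerDl addrA l1 => c1.
have E9 : (i + 9 = i + 6 + 3)%N by rewrite -addnA.
move=> c2; rewrite E9 l2 in c2; split => //; apply: change_straight => //.
by rewrite /change c1 c2.
Qed.

(** If the edge left its source inside a sector, an early point of it would be interior to a region,
    although both colours occur next to it. *)
Lemma edge_dirP e : edge F e -> exists i, edge_dir e i.
Proof.
move=> ee; have [vx vy ne H] := ee.
have w0 : e.2 - e.1 != 0 by rewrite subr_eq0 eq_sym; apply/eqP.
have [i i12 [s|[t t0 wE]]] := sector_cases w0; last first.
  by exists i; split => //; exists t => //; rewrite -wE addrC subrK.
have [r r0 Hr] := near0_small (e.2 - e.1) (rad_gt0 zF e.1).
pose u := Num.min r 1 / 2.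
have m0 : 0 < Num.min r 1 by rewrite lt_min r0 ltr01.
have u0 : 0 < u by rewrite divr_gt0.
have : u < Num.min r 1 by rewrite /u; lra.
rewrite lt_min => /andP[/(Hr _ u0) n u1].
have /regionP[d d0 Hd] := region_sector (sectorZ u0 s) n.
have os : open_segment e.1 e.2 (e.1 + u *: (e.2 - e.1)).
  exists u; first by rewrite /= u0.
  by apply/matrixP => a b; rewrite !mxE; ring.
have [_ /nbhs_right0E[r1 r10 H1] /nbhs_right0E[r2 r20 H2]] := H _ os.
have [r3 r30 H3] := near0_small (rot90 (e.2 - e.1)) d0.
pose v := Num.min (Num.min r1 r2) r3 / 2.
have mv : 0 < Num.min (Num.min r1 r2) r3 by rewrite !lt_min r10 r20.
have v0 : 0 < v by rewrite divr_gt0.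
have : v < Num.min (Num.min r1 r2) r3 by rewrite /v; lra.
rewrite !lt_min => /andP[/andP[/(H1 _ v0)/region_F F0 /(H2 _ v0)/region_F F1]].
move=> /(H3 _ v0) nv.
have := Hd (- (v *: rot90 (e.2 - e.1))); rewrite normrN F1 => /(_ nv).
by rewrite -(Hd _ nv) F0.
Qed.

Lemma edge_dir_ends e i : edge_dir e i ->
  [/\ colour e.1 i = false, colour e.1 (i + 11) = true,
      germ e.2 (i + 5) = germ e.1 i & germ e.2 (i + 6) = germ e.1 (i + 11)].
Proof.
move=> [ee i12 [t t0 eE]].
have st s : 0 < s -> s < t -> _ := edge_interior ee eE.
have L : germ e.2 (i + 5) = germ e.1 i.
  by rewrite eE; apply: (germ_ray_left t0) => s s0 /(st _ s0)[/straight_germs[]].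
have Rt : germ e.2 (i + 6) = germ e.1 (i + 11).
  by rewrite eE; apply: (germ_ray_right t0) => s s0 /(st _ s0)[/straight_germs[]].
have [r r0 H] := near_ray e.1 i.
pose v := Num.min r t / 2.
have mv : 0 < Num.min r t by rewrite !lt_min r0.
have v0 : 0 < v by rewrite divr_gt0.
have : v < Num.min r t by rewrite /v; lra.
rewrite lt_min => /andP[/(H _ v0) n /(st _ v0)[/straightP s1 c0]].
have [l1 _] := germ_left v0 n (isT : (0 < 6)%N).
have [l2 _] := germ_right v0 n (isT : (0 < 6)%N).
rewrite addn0 in l1.
have [_] := s1 0%N isT; rewrite l2 c0 => l3.
by split => //; rewrite -l1.
Qed.

(** Otherwise the source of the shorter edge would be an inner point of the longer one, where the
    picture is straight. *)
Lemma edge_dir_tgt_inj e e' i : edge_dir e i -> edge_dir e' i ->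
  e.2 = e'.2 -> e = e'.
Proof.
wlog le : e e' / (exists t t' : R, [/\ 0 < t, t <= t',
    e.2 = e.1 + t *: dir i & e'.2 = e'.1 + t' *: dir i]) => [H|].
  move=> ed ed' E; have [_ _ [t t0 tE]] := ed; have [_ _ [t' t'0 tE']] := ed'.
  by case: (leP t t') => tt; [apply: H|apply/esym/H] => //;
    [exists t, t'|exists t', t; split => //; exact: ltW].
move=> [ee i12 _] [ee' _ _] E; have [t [t' [t0 tt tE tE']]] := le.
have E1 : e.1 = e'.1 + (t' - t) *: dir i.
  by apply: (addIr (t *: dir i)); rewrite -tE -addrA -scalerDl subrK -tE'.
move: tt; rewrite le_eqVlt => /orP[/eqP tt|tt].
  move: E1; rewrite tt subrr scale0r addr0.
  by case: e e' E {le ee ee' tE tE'} => ? ? [? ?] /= -> ->.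
have [||st _] := edge_interior ee' tE' (s := t' - t); first by rewrite subr_gt0.
  by rewrite gtrBl.
by case: (straight_nonvertex i12 st); rewrite -E1; case: ee => vx _ _ _; exact: vx.
Qed.

Lemma out_edge x i : vertex F x -> (i < 12)%N ->
  colour x i = false -> colour x (i + 11) = true ->
  exists2 e, edge_dir e i & e.1 = x.
Proof.
move=> vx i12 c0 c1.
have [|t [t0 vy _ _ H]] := @ray_to_vertex x i; first by rewrite /change c0 c1.
exists (x, x + t *: dir i); last by [].
by apply: (edge_intro i12 t0 vx vy) => s s0 st; rewrite -c0; exact: H.
Qed.

(** The edge is found by running backwards, in direction [i + 6]. *)
Lemma in_edge y i : vertex F y -> (i < 12)%N ->
  colour y (i + 5) = false -> colour y (i + 6) = true ->
  exists2 e, edge_dir e i & e.2 = y.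
Proof.
move=> vy i12 c0 c1.
have [|t [t0 vx _ _ H]] := @ray_to_vertex y (i + 6).
  by rewrite /change c1 -addnA (_ : 6 + 11 = 5 + 12)%N // addnA colD12 c0.
have yE : y = y + t *: dir (i + 6) + t *: dir i.
  by rewrite dirD6 scalerN subrK.
exists (y + t *: dir (i + 6), y); last by [].
rewrite [in X in (_, X)]yE; apply: (edge_intro i12 t0 vx).
  by rewrite -yE.
move=> s s0 st; have -> : y + t *: dir (i + 6) + s *: dir i = y + (t - s) *: dir (i + 6).
  by rewrite scalerBl dirD6 scalerN -addrA scalerN opprK.
have [||s6 c6] := H (t - s); [by rewrite subr_gt0|by rewrite gtrBl|].
have [-> ->] := straightD6 (colD12 zF _) s6.
by rewrite c6 c1.
Qed.

(* The ray may be run through in the direction opposite to the edge. *)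
Lemma edge_of_change x i : (i < 12)%N -> change (colour x) i ->
  exists e j, edge_dir e j /\
    ((germ x i = germ e.1 j /\ germ x (i + 11) = germ e.1 (j + 11)) \/
     (germ x i = germ e.1 (j + 11) /\ germ x (i + 11) = germ e.1 j)).
Proof.
move=> i12 ch; have [t [t0 vy L Rt _]] := ray_to_vertex ch.
move: (x + t *: dir i) vy L Rt => y vy L Rt.
have [L1 _] := L; have [R1 _] := Rt; move: ch; rewrite /change.
case c0 : (colour x i); case c1 : (colour x (i + 11)) => // _.
  have [||e ed eE] := @out_edge y ((i + 6) %% 12) vy (mod12 _).
  - by rewrite (col_eq_mod zF y (modn_mod _ _)) R1 c1.
  - rewrite (@col_eq_mod _ _ zF y _ (i + 5)) ?L1 ?c0 // modnDml -addnA.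
    by rewrite (_ : 6 + 11 = 5 + 12)%N // addnA modnDr.
  exists e, ((i + 6) %% 12)%N; split; [exact: ed|right; rewrite eE; split].
    rewrite -L; apply: germ_eq_mod; rewrite modnDml -addnA.
    by rewrite (_ : 6 + 11 = 5 + 12)%N // addnA modnDr.
  by rewrite -Rt; apply: germ_eq_mod; rewrite modn_mod.
have [||e ed eE] := @in_edge y i vy i12; [by rewrite L1|by rewrite R1|].
exists e, i; split; [exact: ed|left]; have [_ _ <- <-] := edge_dir_ends ed.
by rewrite eE L Rt.
Qed.

Lemma edge_tiles e i : edge_dir e i ->
  segment e.1 e.2 `<=` tile_at e.1 i /\
  segment e.1 e.2 `<=` tile_at e.1 (i + 11).
Proof.
move=> ed; have [_ _ L Rt] := edge_dir_ends ed.
have aux j : tile_at e.1 j e.2 -> segment e.1 e.2 `<=` tile_at e.1 j.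
  move=> T2 _ [t /= t01 <-]; rewrite addrC.
  by apply: (tile_segment cF T2 _ t01); exact: center_tile.
split; apply: aux.
  by rewrite -(germ_tile L); exact: center_tile.
by rewrite -(germ_tile Rt); exact: center_tile.
Qed.

(** The sectors [b] to [i + 5] at the common vertex form one corner, through which the germ passes
    from [e] to [e']. *)
Lemma follows_white e e' i j b : edge_dir e i -> edge_dir e' j -> e'.1 = e.2 ->
  (i <= b <= i + 5)%N -> j = b %[mod 12] ->
  (forall k, (b <= k <= i + 5)%N -> colour e.2 k = false) ->
  follows F 0 e e' /\ germ e'.1 j = germ e.1 i.
Proof.
move=> ed ed' eE bi jb run.
have gE : germ e'.1 j = germ e.1 i.
  have [_ _ <- _] := edge_dir_ends ed; rewrite eE (germ_eq_mod zF _ jb).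
  have -> : (i + 5 = b + (i + 5 - b))%N by lia.
  apply/esym; apply: (@germ_run _ _ _ _ _ (i + 5 - b) false) => [k kb|]; last exact: leqnn.
  by apply: run; lia.
have [ee _ _] := ed; have [ee' _ _] := ed'.
split; last exact: gE.
split; [exact: ee|exact: ee'|exact: eE|exists (tile_at e.1 i); split].
- have [c0 _ _ _] := edge_dir_ends ed.
  by have := tile_at_tile zF e.1 i; rewrite c0.
- by have [] := edge_tiles ed.
- by rewrite -(germ_tile gE); have [] := edge_tiles ed'.
Qed.

(** The black corner lies on the other side of [e] and consists of the sectors [i + 6] to
    [b - 1]. *)
Lemma follows_black e e' i j b : edge_dir e i -> edge_dir e' j -> e'.1 = e.2 ->
  (i + 7 <= b <= i + 12)%N -> j = b %[mod 12] ->
  (forall k, (i + 6 <= k < b)%N -> colour e.2 k = true) ->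
  follows F 1 e e' /\ germ e'.1 (j + 11) = germ e.1 (i + 11).
Proof.
move=> ed ed' eE bi jb run.
have gE : germ e'.1 (j + 11) = germ e.1 (i + 11).
  have [_ _ _ <-] := edge_dir_ends ed; rewrite eE.
  rewrite (@germ_eq_mod _ _ zF _ _ (i + 6 + (b - (i + 7)))); last first.
    rewrite -modnDml jb modnDml (_ : b + 11 = i + 6 + (b - (i + 7)) + 12)%N.
      by rewrite modnDr.
    by lia.
  apply: (@germ_run _ _ _ _ _ (b - (i + 7)) true) => [k kb|]; last exact: leqnn.
  by apply: run; lia.
have [ee _ _] := ed; have [ee' _ _] := ed'.
split; last exact: gE.
split; [exact: ee|exact: ee'|exact: eE|exists (tile_at e.1 (i + 11)); split].
- have [_ c1 _ _] := edge_dir_ends ed.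
  by have := tile_at_tile zF e.1 (i + 11); rewrite c1.
- by have [] := edge_tiles ed.
- by rewrite -(germ_tile gE); have [] := edge_tiles ed'.
Qed.

Lemma edge_dir_vertices e i : edge_dir e i -> vertex F e.1 /\ vertex F e.2.
Proof. by move=> [[]]. Qed.

Lemma vertex_no_long_run x i : change (colour x) i -> no_long_run (colour x).
Proof. by move=> ch; apply: col_no_long_run => //; exact: change_not_const ch. Qed.

Lemma edge_end_colours e i : edge_dir e i ->
  colour e.2 (i + 5) = false /\ colour e.2 (i + 6) = true.
Proof.
by move=> ed; have [c0 c1 [-> _] [-> _]] := edge_dir_ends ed; rewrite c0 c1.
Qed.

Lemma edge_end_no_long_run e i : edge_dir e i -> no_long_run (colour e.2).
Proof.
move=> /edge_end_colours[c0 c1]; apply: (@vertex_no_long_run _ (i + 6)).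
by rewrite /change c1 -addnA (_ : 6 + 11 = 5 + 12)%N // addnA colD12 c0.
Qed.

Lemma white_next e i : edge_dir e i -> exists e' b,
  [/\ edge_dir e' (b %% 12), e'.1 = e.2, (i <= b <= i + 5)%N,
      forall k, (b <= k <= i + 5)%N -> colour e.2 k = false &
      colour e.2 (b + 11) = true].
Proof.
move=> ed; have [c0 c1] := edge_end_colours ed; have [_ i12 _] := ed.
have [|b [bi cb run]] := run_cw (colD12 zF _) (edge_end_no_long_run ed) i12.
  by rewrite c0 c1.
rewrite c0 in cb run; have [_ vy] := edge_dir_vertices ed.
have [||e' ed' e'E] := @out_edge e.2 (b %% 12) vy (mod12 _).
- by rewrite (col_eq_mod zF e.2 (modn_mod _ _)); apply: run; move: bi; clear; lia.
- by rewrite (@col_eq_mod _ _ zF _ _ (b + 11)) // modnDml.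
by exists e', b; split.
Qed.

Lemma black_next e i : edge_dir e i -> exists e' b,
  [/\ edge_dir e' (b %% 12), e'.1 = e.2, (i + 7 <= b <= i + 12)%N &
      forall k, (i + 6 <= k < b)%N -> colour e.2 k = true].
Proof.
move=> ed; have [c0 c1] := edge_end_colours ed; have [_ i12 _] := ed.
have [|b [bi cb run]] := run_ccw (colD12 zF _) (edge_end_no_long_run ed) i12.
  by rewrite c0 c1.
rewrite c1 in cb run; have [_ vy] := edge_dir_vertices ed.
have [||e' ed' e'E] := @out_edge e.2 (b %% 12) vy (mod12 _).
- by rewrite (col_eq_mod zF e.2 (modn_mod _ _)) cb.
- have bE : (b + 11 = b.-1 + 12)%N by move: bi; clear; lia.
  rewrite (@col_eq_mod _ _ zF _ _ b.-1); last by rewrite modnDml bE modnDr.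
  by apply: run; move: bi; clear; lia.
by exists e', b; split.
Qed.

(** Preceded by a step of [white_next], this realizes one step of [vperm] by edges of the plane. *)
Lemma black_prev e' j : edge_dir e' j -> exists e i b,
  [/\ edge_dir e i, e'.1 = e.2, (i + 7 <= b <= i + 12)%N, j = b %[mod 12] &
      forall k, (i + 6 <= k < b)%N -> colour e.2 k = true].
Proof.
move=> ed; have [c0 c1 _ _] := edge_dir_ends ed; have [_ j12 _] := ed.
have [vy _] := edge_dir_vertices ed.
have nl : no_long_run (colour e'.1).
  by apply: (@vertex_no_long_run _ j); rewrite /change c0 c1.
(* With this shift [run_cw] yields the first sector [b0] of the black run that ends at sector
   [j - 1]. The edge sought arrives along the ray [b0], so its direction is [b0 + 6]. *)
pose i0 := ((j + 6) %% 12)%N.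
have i012 : (i0 < 12)%N by rewrite ltn_mod.
have h5 : colour e'.1 (i0 + 5) = true.
  by rewrite (@col_eq_mod _ _ zF _ _ (j + 11)) // modnDml -addnA.
have h6 : colour e'.1 (i0 + 6) = false.
  rewrite (@col_eq_mod _ _ zF _ _ j) // modnDml -addnA.
  by rewrite (_ : 6 + 6 = 12)%N // modnDr.
have [|b0 [bi cb run]] := run_cw (colD12 zF e'.1) nl i012; first by rewrite h5 h6.
rewrite h5 in cb run.
have i12 : ((b0 + 6) %% 12 < 12)%N by rewrite ltn_mod.
have [||e ed' eE] := @in_edge e'.1 ((b0 + 6) %% 12) vy i12.
- by rewrite (@col_eq_mod _ _ zF _ _ (b0 + 11)) // modnDml -addnA.
- rewrite (@col_eq_mod _ _ zF _ _ b0); last first.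
    by rewrite modnDml -addnA (_ : 6 + 6 = 12)%N // modnDr.
  by apply: run; move: bi; clear; lia.
have m1 : (((b0 + 6) %% 12 + 6) %% 12 = b0 %% 12)%N.
  by rewrite modnDml -addnA (_ : 6 + 6 = 12)%N // modnDr.
(* The last witness is the start of the run plus its length, a representative of [j] modulo 12 in
   the required window. *)
exists e, ((b0 + 6) %% 12)%N, ((b0 + 6) %% 12 + 6 + (i0 + 6 - b0))%N.
split; [exact: ed'|by rewrite eE|by move: bi {run m1}; clear; lia| |].
  rewrite -modnDml m1 modnDml subnKC; last by move: bi; clear; lia.
  by rewrite /i0 modnDml -addnA (_ : 6 + 6 = 12)%N // modnDr.
move=> k kb; rewrite eE.
rewrite (@col_eq_mod _ _ zF _ _ (b0 + (k - ((b0 + 6) %% 12 + 6)))).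
  by apply: run; move: bi kb {m1}; clear; lia.
rewrite -[in RHS]modnDml -m1 modnDml subnKC //.
by move: kb {m1}; clear; lia.
Qed.

End Edges.

(** * Counting tiles and vertices by height *)

Lemma card_porbits (T : finType) (s : {perm T}) (P : pred T) :
  (forall x, exists2 y, y \in porbit s x & P y) ->
  (forall x y, y \in porbit s x -> P x -> P y -> x = y) ->
  #|porbits s| = #|P|.
Proof.
move=> Pex Puniq.
have -> : porbits s = imset (porbit s) (mem P).
  apply/setP => B; apply/imsetP/imsetP => [[x _ ->]|[x _ ->]]; last by exists x.
  have [y yx Py] := Pex x; exists y => //.
  by apply/eqP; rewrite eq_porbit_mem porbit_sym.
rewrite card_in_imset // => x y Px Py E; apply: Puniq => //.
by rewrite E porbit_id.
Qed.

Section Heights.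
Variable R : realType.
Local Notation plane := (plane R).
Local Notation dir := (dir R).

(* The scalar product with [dir 2 + dir 3]. *)
Definition height (z : plane) : R := det2 (dir 11) z + det2 (dir 0) z.

Lemma heightD x y : height (x + y) = height x + height y.
Proof. by rewrite /height !det2Dr addrACA. Qed.

Lemma heightN x : height (- x) = - height x.
Proof. by rewrite /height !det2Nr [RHS]opprD. Qed.

Lemma heightZ (a : R) x : height (a *: x) = a * height x.
Proof. by rewrite /height !det2Zr [RHS]mulrDr. Qed.

Lemma height_dir_up k : (k < 6)%N -> 0 < height (dir k).
Proof.
move=> k6; rewrite /height.
have -> : det2 (dir 11) (dir k) = sn R k.+1.
  by rewrite -(dirD12 R k) -(det_dir R 11) addSnnS addnC.
have -> : det2 (dir 0) (dir k) = sn R k by have := det_dir R 0 k; rewrite add0n.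
case: (posnP k) => [->|k0]; first by rewrite sn0 addr0 sn1_gt0.
by apply: ltr_wpDl; [apply: sn_ge0|apply: sn_gt0; rewrite k0].
Qed.

Lemma height_dir_down k : (6 <= k < 12)%N -> height (dir k) < 0.
Proof.
move=> /andP[k6 k12]; rewrite -(subnK k6) dirD6 heightN oppr_lt0.
by apply: height_dir_up; lia.
Qed.

Lemma height_le z : `|height z| <= 4 * `|z|.
Proof.
rewrite (le_trans (ler_normD _ _)) // (_ : 4 * `|z| = 2 * `|z| + 2 * `|z|).
  by apply: lerD; exact: det_dir_le.
by ring.
Qed.

Lemma scaled_dir_inj (t u : R) i j : 0 < t -> 0 < u -> (i < 12)%N -> (j < 12)%N ->
  t *: dir i = u *: dir j -> i = j.
Proof.
move=> t0 u0 i12 j12 E.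
have : dot (t *: dir i) (t *: dir i) = dot (u *: dir j) (u *: dir j) by rewrite E.
rewrite !dotZl !dotZr !dir_norm !mulr1 -!expr2 => /eqP.
rewrite eqrXn2 ?ltW // => /eqP tu; apply: (@dir_inj R) => //.
by apply: (scalerI (lt0r_neq0 t0)); rewrite E tu.
Qed.

End Heights.

(** * The highest corner of a tile *)

Section DownBlocks.
Variables (R : realType) (F : plane R -> 'F_2) (zF : zebra F).
Hypothesis cF : zebra_convex F.
Local Notation plane := (plane R).
Local Notation dir := (dir R).
Local Notation colour := (colour zF).
Local Notation germ := (germ zF).
Local Notation tile_at := (tile_at zF).
Implicit Types (y z : plane) (p q : nat).

(* The sectors [p], ..., [q - 1] at [y] form a corner of a tile, and point
   downwards. *)
Definition down_block y p q := [/\ (6 <= p)%N, (p < q)%N, (q <= 11)%N,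
  forall k, (p <= k < q)%N -> colour y k = colour y p &
  colour y (p + 11) = ~~ colour y p /\ colour y q = ~~ colour y p].

(** A point of the tile beyond a side of the corner would force the colour of the tile on the sector
    across that side. *)
Lemma down_block_cone y p q z : down_block y p q -> tile_at y p z ->
  0 <= det2 (dir p) (z - y) /\ 0 <= det2 (z - y) (dir q).
Proof.
move=> [p6 pq q11 run [cp cq]] Tz; split; rewrite leNgt; apply/negP => neg.
  have := tile_right_of_ray cF Tz neg; rewrite cp.
  by case: (colour y p).
have q1 : (q.-1.+1 = q)%N by move: pq; clear; lia.
have cq1 : colour y q.-1 = colour y p.
  by apply: run; move: pq; clear; lia.
have gE : germ y q.-1 = germ y p.
  have -> : (q.-1 = p + (q.-1 - p))%N by move: pq; clear; lia.
  apply: (@germ_run _ _ _ _ _ (q.-1 - p) (colour y p)); last exact: leqnn.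
  by move=> k kq; apply: run; move: pq kq; clear; lia.
rewrite -(germ_tile gE) in Tz.
have := tile_left_of_ray cF Tz; rewrite q1 det2C oppr_gt0 => /(_ neg).
by rewrite cq cq1; case: (colour y p).
Qed.

(** The tile lies in the cone spanned by [dir p] and [dir q], and both of these go down. *)
Lemma down_block_top y p q z : down_block y p q -> tile_at y p z -> z != y ->
  height z < height y.
Proof.
move=> db Tz zy; have [h1 h2] := down_block_cone db Tz.
have [p6 pq q11 _ _] := db.
have D0 : 0 < det2 (dir p) (dir q).
  rewrite -(subnKC (ltnW pq)) det_dir; apply: sn_gt0; move: p6 pq q11; clear; lia.
have w0 : z - y != 0 by rewrite subr_eq0.
rewrite -subr_gt0 -opprB oppr_gt0 -heightN -heightD.
move: (z - y) w0 h1 h2 => w w0 h1 h2.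
rewrite (det2_decomp w (lt0r_neq0 D0)) heightD !heightZ.
have hp : height (dir p) < 0.
  by apply: height_dir_down; move: p6 pq q11; clear; lia.
have hq : height (dir q) < 0.
  by apply: height_dir_down; move: p6 pq q11; clear; lia.
have a0 : 0 <= det2 w (dir q) / det2 (dir p) (dir q) by rewrite divr_ge0 // ltW.
have b0 : 0 <= det2 (dir p) w / det2 (dir p) (dir q) by rewrite divr_ge0 // ltW.
move: a0; rewrite le_eqVlt => /orP[/eqP aE|a0].
  move: b0; rewrite le_eqVlt => /orP[/eqP bE|b0].
    move: w0; rewrite (det2_decomp w (lt0r_neq0 D0)) -aE -bE.
    by rewrite !scale0r addr0 eqxx.
  by rewrite -aE mul0r add0r nmulr_llt0.
apply: (@lt_le_trans _ _ (0 + det2 (dir p) w / det2 (dir p) (dir q) * height (dir q))).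
  by rewrite ltrD2r nmulr_llt0.
by rewrite add0r nmulr_lle0.
Qed.

(** Both corners are the strictly highest point of the same tile, so they coincide. Of two blocks
    there, one starting earlier would put points of the tile outside the cone of the other; the
    colours then fix the end of the block. *)
Lemma down_block_unique y p q y' p' q' : down_block y p q -> down_block y' p' q' ->
  germ y p = germ y' p' -> [/\ y = y', p = p' & q = q'].
Proof.
move=> db db' gE; have TE := germ_tile gE.
have yE : y = y'.
  apply/eqP/negPn/negP => ne.
  have Ty' : tile_at y p y' by rewrite TE; exact: center_tile.
  have Ty : tile_at y' p' y by rewrite -TE; exact: center_tile.
  have := down_block_top db' Ty ne.
  rewrite eq_sym in ne; have := down_block_top db Ty' ne.
  by move=> h /(lt_trans h); rewrite ltxx.
rewrite -{}yE in db' gE TE *.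
have le a b c d : down_block y a b -> down_block y c d ->
    tile_at y a = tile_at y c -> (a <= c)%N.
  move=> db1 db2 E; rewrite leqNgt; apply/negP => ca.
  have : tile_at y a (y + germ_pt zF y c).
    rewrite E; apply: subset_closure; apply: sector_tile.
      exact: germ_pt_sector.
    exact: germ_pt_norm.
  move=> /(down_block_cone db1)[+ _]; rewrite addrC addKr leNgt => /negP; apply.
  have [_ ? ? _ _] := db1; have [? _ _ _ _] := db2.
  apply: (@sector_neg _ _ (12 - (a - c))); first by lia.
  have -> : (a + (12 - (a - c)) = c + 12)%N by lia.
  by rewrite sectorD12; exact: germ_pt_sector.
have pE : p = p' by apply/eqP; rewrite eqn_leq (le _ _ _ _ db db') // (le _ _ _ _ db' db).
rewrite -{}pE in db' gE TE *; split => //.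
have leq a b : down_block y p a -> down_block y p b -> (a <= b)%N.
  move=> [_ pa _ run _] [_ pb _ _ [_ cb]]; rewrite leqNgt; apply/negP => ba.
  have := run b; rewrite (ltnW pb) ba cb => /(_ isT).
  by case: (colour y p).
by apply/eqP; rewrite eqn_leq !leq.
Qed.

End DownBlocks.

(** * Orbits of the permutations lifted to the plane *)

Section Superpotential.
Variables (R : realType) (F : plane R -> 'F_2) (zF : zebra F).
Hypothesis cF : zebra_convex F.
Variables (L : set (plane R)) (S : superpotential F L).
Local Notation plane := (plane R).
Local Notation dir := (dir R).
Local Notation colour := (colour zF).
Local Notation germ := (germ zF).
Local Notation tile_at := (tile_at zF).
Local Notation E := (eclass S).
Local Notation s0 := (sigma0 S).
Local Notation s1 := (sigma1 S).
Local Notation edge_dir := (edge_dir F).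
Implicit Types (x y : E) (e f : plane * plane) (i j k n : nat).

Definition rep x : plane * plane := s2val (cid2 (eproj_surj x)).

Lemma rep_edge x : edge F (rep x).
Proof. by rewrite /rep; case: cid2. Qed.

Lemma repK x : eproj S (rep x) = x.
Proof. by rewrite /rep; case: cid2. Qed.

Definition idx x : nat := projT1 (cid (edge_dirP zF (rep_edge x))).

Lemma rep_dir x : edge_dir (rep x) (idx x).
Proof. by rewrite /idx; case: cid. Qed.

Lemma eproj_vect e f : edge F e -> edge F f -> eproj S e = eproj S f ->
  e.2 - e.1 = f.2 - f.1.
Proof.
move=> ee ef /(eproj_eq S ee ef)[l _ ->] /=.
by rewrite opprD addrACA subrr addr0.
Qed.

Lemma edge_dir_vect e i : edge_dir e i -> exists2 t : R, 0 < t & e.2 - e.1 = t *: dir i.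
Proof. by move=> [_ _ [t t0 ->]]; exists t => //; rewrite addrC addKr. Qed.

(** Edges of one class differ by a translation, so their direction depends on the class alone. *)
Lemma idxE e i : edge_dir e i -> idx (eproj S e) = i.
Proof.
move=> ed; have rd := rep_dir (eproj S e).
have [ee i12 _] := ed; have [er j12 _] := rd.
have := eproj_vect er ee (repK _).
have [t t0 ->] := edge_dir_vect ed; have [u u0 ->] := edge_dir_vect rd.
exact: scaled_dir_inj.
Qed.

Definition up x : bool := (idx x < 6)%N.

Lemma s0_next e i : edge_dir e i -> exists f b,
  [/\ edge_dir f (b %% 12), f.1 = e.2, s0 (eproj S e) = eproj S f,
    germ f.1 (b %% 12) = germ e.1 i & [/\ (i <= b <= i + 5)%N,
      forall k, (b <= k <= i + 5)%N -> colour e.2 k = false &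
      colour e.2 (b + 11) = true]].
Proof.
move=> ed; have [f [b [fd fE bi run cb]]] := white_next zF cF ed.
have [fo gE] := follows_white cF ed fd fE bi (modn_mod _ _) run.
by exists f, b; split => //; exact: sigma0P fo.
Qed.

Lemma s1_next e i : edge_dir e i -> exists f b,
  [/\ edge_dir f (b %% 12), f.1 = e.2, s1 (eproj S e) = eproj S f,
    germ f.1 (b %% 12 + 11) = germ e.1 (i + 11) & (i + 7 <= b <= i + 12)%N /\
      forall k, (i + 6 <= k < b)%N -> colour e.2 k = true].
Proof.
move=> ed; have [f [b [fd fE bi run]]] := black_next zF cF ed.
have [fo gE] := follows_black cF ed fd fE bi (modn_mod _ _) run.
by exists f, b; split => //; exact: sigma1P fo.
Qed.

Lemma s1_prev f j : edge_dir f j -> exists e i b,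
  [/\ edge_dir e i, f.1 = e.2, s1 (eproj S e) = eproj S f, j = b %[mod 12] &
    (i + 7 <= b <= i + 12)%N /\
    forall k, (i + 6 <= k < b)%N -> colour e.2 k = true].
Proof.
move=> fd; have [e [i [b [ed fE bi jb run]]]] := black_prev zF cF fd.
have [fo _] := follows_black cF ed fd fE bi jb run.
by exists e, i, b; split => //; exact: sigma1P fo.
Qed.

(* Both colours are treated at once: [s] is sigma0 or sigma1, and [i + off] is
   the sector of the corresponding tile at the source of an edge of direction
   [i].  The function [g] recovers the direction of an edge from its block. *)
Section Faces.
Variables (s : {perm E}) (off : nat) (g : nat -> nat -> nat).
Hypothesis step : forall e i, edge_dir e i -> exists f j,
  [/\ edge_dir f j, f.1 = e.2, eproj S f = s (eproj S e) &
      germ f.1 (j + off) = germ e.1 (i + off)].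
Hypothesis top_block : forall e i, edge_dir e i ->
  up (eproj S e) -> ~~ up (s (eproj S e)) -> exists p q,
  [/\ down_block zF e.2 p q, germ e.2 p = germ e.1 (i + off) & i = g p q].

Definition top x := up x && ~~ up (s x).

Definition rise x : R := height ((rep x).2 - (rep x).1).

Lemma riseE e i : edge_dir e i -> rise (eproj S e) = height e.2 - height e.1.
Proof.
move=> [ee _ _]; rewrite /rise (eproj_vect (rep_edge _) ee (repK _)).
by rewrite heightD heightN.
Qed.

Lemma rise_up x : up x -> 0 < rise x.
Proof.
have [t t0 E] := edge_dir_vect (rep_dir x); rewrite /up /rise E heightZ => h.
by rewrite mulr_gt0 // height_dir_up.
Qed.

Lemma rise_down x : ~~ up x -> rise x < 0.
Proof.
have [t t0 E] := edge_dir_vect (rep_dir x); rewrite /up /rise E heightZ => h.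
rewrite pmulr_rlt0 // height_dir_down // leqNgt h.
by have [] := rep_dir x.
Qed.

(** The sign [c] selects rising or falling, and [d] bounds the progress of each step from below.
    With [c = d = 0] only the lifting remains. *)
Lemma orbit_lift e i (c d : R) n : edge_dir e i ->
  (forall k, d <= c * rise ((s ^+ k)%g (eproj S e))) -> exists f j,
  [/\ edge_dir f j, eproj S f = (s ^+ n)%g (eproj S e),
      germ f.1 (j + off) = germ e.1 (i + off) &
      n%:R * d <= c * (height f.1 - height e.1)].
Proof.
move=> ed cd; elim: n => [|n [f [j [fd fE gE hE]]]].
  by exists e, i; rewrite perm1 subrr mulr0 mul0r.
have [f' [j' [fd' f'1 f'E g'E]]] := step fd.
exists f', j'; split; [exact: fd'|by rewrite f'E fE expgSr permM|
  by rewrite g'E gE|].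
have := cd n; rewrite -fE (riseE fd) f'1 => h.
rewrite -addn1 natrD mulrDl mul1r; apply: le_trans (lerD hE h) _.
by rewrite -mulrDr addrC addrA subrK.
Qed.

(** The lifted orbit stays on one bounded tile, while a monotone one would change its height by at
    least a fixed amount in every step. *)
Lemma orbit_not_monotone x (b : bool) :
  ~ (forall y, y \in porbit s x -> up y = b).
Proof.
move=> H; pose c : R := (-1) ^+ (~~ b).
have pos k : 0 < c * rise ((s ^+ k)%g x).
  have := H _ (mem_porbit s k x); rewrite /c; case: b {H c} => /= H.
    by rewrite expr0 mul1r; exact: rise_up.
  by rewrite expr1 mulN1r oppr_gt0; apply: rise_down; rewrite H.
have [d d0 dP] : exists2 d : R, 0 < d & forall k, d <= c * rise ((s ^+ k)%g x).
  have [y yx ymin] := @arg_minP _ _ _ x (mem (porbit s x)) (fun y => c * rise y)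
    (porbit_id s x).
  exists (c * rise y); first by have /porbitP[k ->] := yx; exact: pos.
  by move=> k; apply: ymin; exact: mem_porbit.
have rd := rep_dir x.
have dP' k : d <= c * rise ((s ^+ k)%g (eproj S (rep x))) by rewrite repK.
have ctr (z : plane) j : tile_at z j z by exact: center_tile.
have [M HM] := tile_bounded zF cF (rep x).1 (idx x + off).
have M0 : 0 < M := le_lt_trans (normr_ge0 _) (HM _ (ctr _ _)).
(* Two points of norm below [M] have heights that differ by less than [8 * M], by [height_le]. *)
pose n := Num.bound (8 * M / d).
have [f [j [_ _ gE]]] := orbit_lift n rd dP'.
have hf := HM f.1; rewrite -(germ_tile gE) in hf.
have {}hf := hf (ctr _ _).
have hr := HM _ (ctr _ _).
have nd : 8 * M < n%:R * d.
  rewrite -ltr_pdivrMr //; apply: archi_boundP.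
  by rewrite divr_ge0 ?mulr_ge0 // ltW.
rewrite leNgt => /negP; apply; apply: le_lt_trans nd.
have c1 : `|c| = 1 by rewrite /c normrX normrN1 expr1n.
rewrite (le_trans (ler_norm _)) // normrM c1 mul1r.
rewrite (le_trans (ler_normB _ _)) //.
have := height_le f.1; have := height_le (rep x).1.
move: hf hr; move: `|f.1| `|(rep x).1| `|height _| `|height _|.
by move=> a b' c' d' *; lra.
Qed.

(** Without a top, one upward edge makes all its successors, hence the whole cycle, upward; both
    monotone cases are excluded. *)
Lemma top_exists x : exists2 y, y \in porbit s x & top y.
Proof.
apply: contrapT => H.
have nt y : y \in porbit s x -> up y -> up (s y).
  move=> yx uy; apply/negPn/negP => nu; apply: H; exists y => //.
  by rewrite /top uy.
have orb k y : y \in porbit s x -> (s ^+ k)%g y \in porbit s x.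
  move=> yx; have /eqP <- : porbit s y == porbit s x by rewrite eq_porbit_mem.
  exact: mem_porbit.
have [[y yx uy]|nu] := pselect (exists2 y, y \in porbit s x & up y).
  apply: (@orbit_not_monotone x true) => z zx.
  have : z \in porbit s y.
    by have /eqP -> : porbit s y == porbit s x by rewrite eq_porbit_mem.
  move=> /porbitP[k ->]; elim: k => [|k IH]; first by rewrite perm1.
  by rewrite expgSr permM; apply: nt => //; exact: orb.
apply: (@orbit_not_monotone x false) => y yx.
by apply/negbTE/negP => uy; apply: nu; exists y.
Qed.

Lemma orbit_lift0 e i y : edge_dir e i -> y \in porbit s (eproj S e) ->
  exists f j, [/\ edge_dir f j, eproj S f = y &
    germ f.1 (j + off) = germ e.1 (i + off)].
Proof.
move=> ed /porbitP[n ->].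
have [|f [j [fd fE gE _]]] := @orbit_lift e i 0 0 n ed.
  by move=> k; rewrite mul0r.
by exists f, j.
Qed.

(** Both edges end at the highest corner of the same tile, and the corner determines their direction
    through [g]; then [edge_dir_tgt_inj] applies. *)
Lemma top_unique e i f j : edge_dir e i -> edge_dir f j ->
  germ e.1 (i + off) = germ f.1 (j + off) ->
  top (eproj S e) -> top (eproj S f) -> e = f.
Proof.
move=> ed fd gE /andP[u1 u2] /andP[u3 u4].
have [p [q [db g1 iE]]] := top_block ed u1 u2.
have [p' [q' [db' g1' jE]]] := top_block fd u3 u4.
have [|yE pE qE] := down_block_unique cF db db'; first by rewrite g1 g1'.
have ij : i = j by rewrite iE pE qE -jE.
by rewrite -ij in fd; exact: (edge_dir_tgt_inj zF cF ed fd yE).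
Qed.

Lemma top_unique_orbit x y : y \in porbit s x -> top x -> top y -> x = y.
Proof.
move=> yx tx ty; have rd := rep_dir x.
have [|f [j [fd fE gE]]] := orbit_lift0 rd (y := y); first by rewrite repK.
rewrite -(repK x) -fE; congr (eproj S _); apply/esym.
by apply: (top_unique fd rd gE); rewrite ?repK ?fE.
Qed.

Lemma card_faces : #|porbits s| = #|[pred x | top x]|.
Proof. exact: card_porbits top_exists top_unique_orbit. Qed.

(** Both orbits pass through the unique top edge of the common tile. *)
Lemma same_tile_orbit e i f j : edge_dir e i -> edge_dir f j ->
  germ e.1 (i + off) = germ f.1 (j + off) ->
  porbit s (eproj S e) = porbit s (eproj S f).
Proof.
move=> ed fd gE.
have [x xe tx] := top_exists (eproj S e); have [y yf ty] := top_exists (eproj S f).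
have [e' [i' [ed' eE' ge]]] := orbit_lift0 ed xe.
have [f' [j' [fd' fE' gf]]] := orbit_lift0 fd yf.
have EF : e' = f'.
  by apply: (top_unique ed' fd'); rewrite ?ge ?gf ?eE' ?fE'.
have xy : x = y by rewrite -eE' -fE' EF.
transitivity (porbit s x); first by apply/eqP; rewrite eq_porbit_mem porbit_sym.
by rewrite xy; apply/eqP; rewrite eq_porbit_mem.
Qed.

End Faces.

End Superpotential.

(** * Euler's formula and connectedness of the torus *)

Section TorusCombinatorics.
Variables (R : realType) (F : plane R -> 'F_2) (zF : zebra F).
Hypothesis cF : zebra_convex F.
Variables (L : set (plane R)) (S : superpotential F L).
Local Notation plane := (plane R).
Local Notation dir := (dir R).
Local Notation colour := (colour zF).
Local Notation germ := (germ zF).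
Local Notation tile_at := (tile_at zF).
Local Notation E := (eclass S).
Local Notation s0 := (sigma0 S).
Local Notation s1 := (sigma1 S).
Local Notation pr := (eproj S).
Local Notation edge_dir := (edge_dir F).
Local Notation up := (up zF).
Local Notation v := (vperm s0 s1).
Implicit Types (x y : E) (e f : plane * plane) (i j k n b : nat).

Lemma white_step e i : edge_dir e i -> exists f j,
  [/\ edge_dir f j, f.1 = e.2, pr f = s0 (pr e) &
      germ f.1 (j + 0) = germ e.1 (i + 0)].
Proof.
move=> ed; have [f [b [fd fE sE gE _]]] := s0_next zF cF S ed.
by exists f, (b %% 12)%N; split; rewrite ?addn0.
Qed.

Lemma black_step e i : edge_dir e i -> exists f j,
  [/\ edge_dir f j, f.1 = e.2, pr f = s1 (pr e) &
      germ f.1 (j + 11) = germ e.1 (i + 11)].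
Proof.
move=> ed; have [f [b [fd fE sE gE _]]] := s1_next zF cF S ed.
by exists f, (b %% 12)%N; split.
Qed.

Lemma upE e i : edge_dir e i -> up (pr e) = (i < 6)%N.
Proof. by move=> /(idxE zF S); rewrite /up => ->. Qed.

Lemma white_top_block e i : edge_dir e i -> up (pr e) -> ~~ up (s0 (pr e)) ->
  exists p q, [/\ down_block zF e.2 p q, germ e.2 p = germ e.1 (i + 0) &
    i = (q - 6)%N].
Proof.
move=> ed; have [f [b [fd fE -> gE [bi run cb]]]] := s0_next zF cF S ed.
rewrite (upE ed) (upE fd) => i6 b6.
have [c0 c1] := edge_end_colours zF cF ed.
have bb : (b %% 12 = b)%N by move: bi i6; clear; lia.
rewrite bb fE in gE b6.
have cbE : colour e.2 b = false by apply: run; move: bi; clear; lia.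
(* The white corner extends from the direction [b] of the next edge to the reverse [i + 6] of the
   arriving one. *)
exists b, (i + 6)%N; split; [|by rewrite addn0|by rewrite addnK].
split; [by rewrite leqNgt|by move: bi; clear; lia|by move: i6; clear; lia| |].
  by move=> k kb; rewrite cbE; apply: run; move: kb; clear; lia.
by rewrite cbE.
Qed.

Lemma black_top_block e i : edge_dir e i -> up (pr e) -> ~~ up (s1 (pr e)) ->
  exists p q, [/\ down_block zF e.2 p q, germ e.2 p = germ e.1 (i + 11) &
    i = (p - 6)%N].
Proof.
move=> ed; have [f [b [fd fE -> gE [bi run]]]] := s1_next zF cF S ed.
rewrite (upE ed) (upE fd) => i6 b6.
have [c0 c1] := edge_end_colours zF cF ed.
have [cb _ _ _] := edge_dir_ends zF cF fd; rewrite fE in cb.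
have bb : (b %% 12 = b)%N by move: bi i6 b6; clear; lia.
rewrite bb in cb b6.
have [_ _ _ g6] := edge_dir_ends zF cF ed.
(* On the black side the arriving edge bounds the corner at its start, so [i] is recovered from [p]
   instead of [q]. *)
exists (i + 6)%N, b; split; [|exact: g6|by rewrite addnK].
split; [by move: bi; clear; lia|by move: bi; clear; lia|
  by move: bb; clear; lia| |].
  by move=> k kb; rewrite c1; apply: run.
have c17 : colour e.2 (i + 6 + 11) = colour e.2 (i + 5).
  by rewrite -addnA (_ : 6 + 11 = 5 + 12)%N // addnA; exact: colD12.
by rewrite c1 cb c17 c0.
Qed.

Lemma card_white : #|Pwhite s0| = #|[pred x | up x && ~~ up (s0 x)]|.
Proof. exact: (card_faces (g := fun _ q => (q - 6)%N) cF white_step white_top_block). Qed.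

Lemma card_black : #|Pblack s1| = #|[pred x | up x && ~~ up (s1 x)]|.
Proof. exact: (card_faces (g := fun p _ => (p - 6)%N) cF black_step black_top_block). Qed.

(* Going clockwise round a vertex, exactly one step crosses the sector 5
   upwards, through a white or through a black tile. *)
Definition white_crossing x := up x && up (s0 x).
Definition black_crossing x := ~~ up x && ~~ up (s1 x).
Definition crossing x := white_crossing x || black_crossing (v x).

Lemma s1_vperm x : s1 (v x) = s0 x.
Proof. by rewrite /vperm permM permKV. Qed.

(** The point is that the white corner after such an edge contains sector 5. *)
Lemma white_crossingP e i : edge_dir e i -> white_crossing (pr e) ->
  (i < 6)%N /\ forall k, (5 <= k <= i + 5)%N -> colour e.2 k = false.
Proof.
move=> ed; have [f [b [fd fE sE _ [bi run _]]]] := s0_next zF cF S ed.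
rewrite /white_crossing sE (upE ed) (upE fd) => /andP[i6 b6]; split => //.
by move=> k k5; apply: run; move: bi i6 b6 k5; clear; lia.
Qed.

(** The black corner contains sector 17, which is sector 5 again. *)
Lemma black_crossingP e i : edge_dir e i -> black_crossing (pr e) ->
  (6 <= i)%N /\ forall k, (i + 6 <= k <= 17)%N -> colour e.2 k = true.
Proof.
move=> ed; have [f [b [fd fE sE _ [bi run]]]] := s1_next zF cF S ed.
have [_ i12 _] := ed.
rewrite /black_crossing sE (upE ed) (upE fd) -!leqNgt => /andP[i6 b6]; split => //.
by move=> k k5; apply: run; move: bi i12 i6 b6 k5; clear; lia.
Qed.

(** A step passes clockwise over a white and then a black corner, so the direction of the incoming
    edge decreases modulo 12 and wraps round only at a crossing. *)
Lemma vertex_step e i : edge_dir e i -> exists f j,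
  [/\ edge_dir f j, f.2 = e.2, pr f = v (pr e) &
      ~~ crossing (pr e) -> (j < i)%N].
Proof.
move=> ed; have [f [b [fd fE sE _ [bi run _]]]] := s0_next zF cF S ed.
have [g [j [a [gd gE s1E ba [aj run']]]]] := s1_prev zF cF S fd.
have gv : pr g = v (pr e).
  by apply: (@perm_inj _ s1); rewrite s1_vperm sE s1E.
exists g, j; split; [exact: gd|by rewrite -gE|exact: gv|].
rewrite /crossing -gv /white_crossing /black_crossing s1E sE.
rewrite (upE ed) (upE fd) (upE gd).
have [_ i12 _] := ed; have [_ j12 _] := gd.
by move: bi ba aj i12 j12; clear; rewrite modn_mod; lia.
Qed.

Lemma vertex_lift e i y : edge_dir e i -> y \in porbit v (pr e) ->
  exists f j, [/\ edge_dir f j, f.2 = e.2 & pr f = y].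
Proof.
move=> ed /porbitP[n ->]; elim: n => [|n [f [j [fd fE pE]]]].
  by exists e, i; rewrite perm1.
have [g [a [gd gE pg _]]] := vertex_step fd.
by exists g, a; split; [exact: gd|rewrite gE|by rewrite pg pE expgSr [RHS]permM].
Qed.

(** Without a crossing the direction index would decrease for ever. *)
Lemma crossing_exists x : exists2 y, y \in porbit v x & crossing y.
Proof.
apply: contrapT => H.
have nc y : y \in porbit v x -> ~~ crossing y.
  by move=> yx; apply/negP => cy; apply: H; exists y.
have down n : exists e i, [/\ edge_dir e i, pr e = (v ^+ n)%g x &
    (i + n <= idx zF x)%N].
  elim: n => [|n [e [i [ed eE ile]]]].
    by exists (rep x), (idx zF x); rewrite repK perm1 addn0; split => //; exact: rep_dir.
  have [f [j [fd fE pE lt]]] := vertex_step ed.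
  exists f, j; split; [exact: fd|by rewrite pE eE expgSr [RHS]permM|].
  have := lt (nc _ _); rewrite eE mem_porbit => /(_ isT) ji.
  by move: ji ile; clear; lia.
have [e [i [_ _]]] := down (idx zF x).+1.
by clear; lia.
Qed.

(** All edges of the orbit lift to edges with one target, and a crossing singles out the corner
    there that contains sector 5. Its colour decides the kind of crossing, and two edges of
    different direction for the same corner would contradict the colours at their ends. *)
Lemma crossing_unique x y : y \in porbit v x -> crossing x -> crossing y -> x = y.
Proof.
move=> yx; have rd := rep_dir zF x.
have [|f [j [fd fE pf]]] := vertex_lift (y := y) rd; first by rewrite repK.
have [e' [i' [ed' e'E pe' _]]] := vertex_step rd.
have [f' [j' [fd' f'E pf' _]]] := vertex_step fd.
rewrite repK in pe'; rewrite pf in pf'.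
have [_ j12 _] := fd; have [_ i12 _] := rd.
have [_ j12' _] := fd'; have [_ i12' _] := ed'.
have [a0 a1] := edge_end_colours zF cF rd.
have [b0 b1] := edge_end_colours zF cF fd.
have [c0 c1] := edge_end_colours zF cF ed'.
have [d0 d1] := edge_end_colours zF cF fd'.
have c17 (z : plane) : colour z 17 = colour z 5 by rewrite -(colD12 zF z 5).
rewrite /crossing => /orP[w|b] /orP[w'|b'].
- have [|i6 run] := white_crossingP rd; first by rewrite repK.
  have [|j6 run'] := white_crossingP fd; first by rewrite pf.
  have ij : idx zF x = j.
    case: (ltngtP (idx zF x) j) => // ij.
      have := run' (idx zF x + 6)%N; rewrite fE a1 => H.
      by have := H _; move: ij; clear; lia.
    have := run (j + 6)%N; rewrite -fE b1 => H.
    by have := H _; move: ij; clear; lia.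
  by rewrite -ij in fd; rewrite -pf -(edge_dir_tgt_inj zF cF rd fd (esym fE)) repK.
- have [|i6 run] := white_crossingP rd; first by rewrite repK.
  have [|j6 run'] := black_crossingP fd'; first by rewrite pf'.
  have := run 5%N; rewrite -fE -f'E -c17 run' //.
    by have := i6; clear; lia.
  by have := j12'; clear; lia.
- have [|i6 run] := black_crossingP ed'; first by rewrite pe'.
  have [|j6 run'] := white_crossingP fd; first by rewrite pf.
  have := run' 5%N; rewrite fE -e'E -c17 run //.
    by have := j6; clear; lia.
  by have := i12'; clear; lia.
- have [|i6 run] := black_crossingP ed'; first by rewrite pe'.
  have [|j6 run'] := black_crossingP fd'; first by rewrite pf'.
  have ff : f'.2 = e'.2 by rewrite f'E fE e'E.
  have ij : i' = j'.
    case: (ltngtP i' j') => // ij.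
      have := run (j' + 5)%N; rewrite -ff d0 => H.
      by have := H _; move: ij i12' j12' i6; clear; lia.
    have := run' (i' + 5)%N; rewrite ff c0 => H.
    by have := H _; move: ij i12' j12' j6; clear; lia.
  rewrite -ij in fd'; apply: (@perm_inj _ v); rewrite -pe' -pf'.
  by rewrite (edge_dir_tgt_inj zF cF ed' fd' (esym ff)).
Qed.

Lemma card_star : #|Pstar s0 s1| = #|[pred x | crossing x]|.
Proof. exact: (card_porbits crossing_exists crossing_unique). Qed.

Lemma card_pred_perm (T : finType) (s : {perm T}) (P : pred T) :
  #|[pred x | P (s x)]| = #|P|.
Proof.
rewrite -(card_imset (mem [pred x | P (s x)]) (@perm_inj _ s)).
apply: eq_card => x; apply/imsetP/idP => [[y Py ->]//|Px].
by exists (s^-1%g x); rewrite ?inE permKV.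
Qed.

(* Every orbit is counted through its unique top or crossing, and the four kinds
   of consecutive edges add up to the upward edges plus the edges followed by a
   downward one on their black tile. *)
Lemma euler_torus : #|E| = (#|Pwhite s0| + #|Pblack s1| + #|Pstar s0 s1|)%N.
Proof.
rewrite card_white card_black card_star.
have -> : #|[pred x | crossing x]| =
    (#|[pred x | white_crossing x]| + #|[pred x | black_crossing x]|)%N.
  (* Black crossings may be counted at [v x], as [v] is a bijection; the two kinds exclude each
     other because [s1 (v x) = s0 x]. *)
  rewrite -(card_pred_perm v [pred x | black_crossing x]) -cardUI.
  rewrite [X in (_ + X)%N]eq_card0 ?addn0; first exact: eq_card.
  move=> x; rewrite !inE /white_crossing /black_crossing s1_vperm.
  by case: (up (s0 x)); rewrite ?andbF.
have -> : #|E| = (#|[pred x : E | up x]| + #|[pred x | ~~ up (s1 x)]|)%N.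
  by rewrite (card_pred_perm s1 [pred x : E | ~~ up x]) -(cardC [pred x : E | up x]).
have cs (P : pred E) : #|[pred x | P x]| = (\sum_x P x)%N.
  by rewrite -sum1_card [LHS]big_mkcond; apply: eq_bigr => x _; rewrite inE; case: (P x).
rewrite !cs -!big_split; apply: eq_bigr => x _ /=.
rewrite /white_crossing /black_crossing.
by case: (up x); case: (up (s0 x)); case: (up (s1 x)).
Qed.

Lemma torus_nonempty : (0 < #|E|)%N.
Proof.
have [z [i [i12 ch]]] := exists_change zF cF.
have [e [j [[ee _ _] _]]] := edge_of_change cF i12 ch.
by apply/card_gt0P; exists (pr e).
Qed.

Lemma same_white_tile e i f j : edge_dir e i -> edge_dir f j ->
  germ e.1 i = germ f.1 j -> porbit s0 (pr e) = porbit s0 (pr f).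
Proof.
move=> ed fd gE.
by apply: (same_tile_orbit (g := fun _ q => (q - 6)%N) cF white_step white_top_block ed fd); rewrite !addn0.
Qed.

Lemma same_black_tile e i f j : edge_dir e i -> edge_dir f j ->
  germ e.1 (i + 11) = germ f.1 (j + 11) -> porbit s1 (pr e) = porbit s1 (pr f).
Proof.
exact: (same_tile_orbit (g := fun p _ => (p - 6)%N) cF black_step black_top_block).
Qed.

Lemma porbit_invariant (T : finType) (s : {perm T}) (A : pred T) (x y : T) :
  (forall z, A (s z) = A z) -> porbit s x = porbit s y -> A x = A y.
Proof.
move=> As xy; have : y \in porbit s x by rewrite xy porbit_id.
move=> /porbitP[n ->]; elim: n => [|n IH]; first by rewrite perm1.
by rewrite expgSr permM As.
Qed.

Lemma torus_connected (A : pred E) :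
  (forall x, A (s0 x) = A x) -> (forall x, A (s1 x) = A x) ->
  forall x y, A x -> A y.
Proof.
move=> A0 A1.
(* [Q z k]: the tile in sector [k] at [z] carries an edge whose class lies in [A]. It will turn out
   not to depend on [z] and [k]. *)
pose Q z k := exists e i, [/\ edge_dir e i, A (pr e) &
  germ z k = germ e.1 i \/ germ z k = germ e.1 (i + 11)].
have Qg z k z' k' : germ z k = germ z' k' -> Q z k = Q z' k'.
  by move=> gE; rewrite /Q gE.
have Qedge f j : edge_dir f j -> Q f.1 j -> A (pr f).
  move=> fd [e [i [ed Ae [gE|gE]]]].
    by rewrite (porbit_invariant A0 (same_white_tile fd ed gE)).
  have [c _ _ _] := edge_dir_ends zF cF fd.
  have [_ c' _ _] := edge_dir_ends zF cF ed.
  by move: gE => [+ _]; rewrite c c'.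
have Qedge' f j : edge_dir f j -> Q f.1 (j + 11) -> A (pr f).
  move=> fd [e [i [ed Ae [gE|gE]]]].
    have [_ c _ _] := edge_dir_ends zF cF fd.
    have [c' _ _ _] := edge_dir_ends zF cF ed.
    by move: gE => [+ _]; rewrite c c'.
  by rewrite (porbit_invariant A1 (same_black_tile fd ed gE)).
have edgeQ f j : edge_dir f j -> A (pr f) -> Q f.1 j.
  by move=> fd Af; exists f, j; split; [exact: fd|exact: Af|left].
have edgeQ' f j : edge_dir f j -> A (pr f) -> Q f.1 (j + 11).
  by move=> fd Af; exists f, j; split; [exact: fd|exact: Af|right].
(* Passing a ray, one either stays in a tile or crosses an edge that belongs to both tiles. *)
have Qstep (z : plane) i : (i < 12)%N -> Q z i <-> Q z (i + 11).
  move=> i12; have [ch|/negPn/eqP nch] := boolP (change (colour z) i).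
    have [f [j [fd [[g1 g2]|[g1 g2]]]]] := edge_of_change cF i12 ch.
      rewrite (Qg _ _ _ _ g1) (Qg _ _ _ _ g2); split.
        by move=> /(Qedge _ _ fd); exact: edgeQ'.
      by move=> /(Qedge' _ _ fd); exact: edgeQ.
    rewrite (Qg _ _ _ _ g1) (Qg _ _ _ _ g2); split.
      by move=> /(Qedge' _ _ fd); exact: edgeQ.
    by move=> /(Qedge _ _ fd); exact: edgeQ'.
  have gE : germ z (i + 11) = germ z i.
    rewrite (@germ_adj _ _ zF z (i + 11)) -addnS ?germD12 //.
    by rewrite colD12 nch.
  by rewrite (Qg _ _ _ _ gE).
have Q0 (z : plane) k : Q z k = Q z 0.
  have Qmod n : Q z n = Q z (n %% 12)%N by apply: Qg; rewrite germ_modE.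
  elim: k => // k <-; apply/propext; rewrite (Qmod k.+1) (Qstep _ _ (ltn_pmod _ _)) //.
  rewrite (Qmod k) (Qmod (_ + 11)%N) modnDml addSnnS modnDr.
  by [].
have Qloc (z d : plane) : exists2 r : R, 0 < r &
    forall s, 0 < s -> s < r -> Q (z + s *: d) 0 = Q z 0.
  have [->|d0] := eqVneq d 0.
    by exists 1 => // s _ _; rewrite scaler0 addr0.
  have [r r0 Hr] := near0_small d (rad_gt0 zF z).
  exists r => // s sp /(Hr _ sp) n.
  have [i _ [sec|[t t0 dE]]] := sector_cases d0.
    rewrite (Qg _ _ _ _ (germ_in_sector 0 (sectorZ sp sec) n)); exact: Q0.
  rewrite dE scalerA in n *.
  have := germ_left (mulr_gt0 sp t0) n (isT : (0 < 6)%N); rewrite addn0 => gE.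
  by rewrite -(Q0 _ i) (Qg _ _ _ _ gE); exact: Q0.
have Qconst (z z' : plane) : Q z' 0 = Q z 0.
  have -> : z' = z + 1 *: (z' - z) by rewrite scale1r addrC subrK.
  (* Local constancy is used along the segment from [z] to [z'] only, with propositions as
     values. *)
  apply: (@ray_const _ _ (fun z => Q z 0) (fun z => Q z 0)) => // w.
  have [r r0 Hr] := Qloc w (- (z' - z)).
  by exists r => // s sp sr; rewrite -scalerN; exact: Hr.
move=> x y Ax; rewrite -(repK y); apply: (Qedge _ (idx zF y)); first exact: rep_dir.
rewrite Q0 (Qconst (rep x).1) -(Q0 _ (idx zF x)); apply: edgeQ.
  exact: rep_dir.
by rewrite repK.
Qed.

End TorusCombinatorics.

(** * Kernel of the incidence matrix *)

Section AdjointRank.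
Variable R : realType.
Implicit Types A B : finType.

Lemma dim_ffunR A : dim {ffun A -> R^o} = #|A|.
Proof. by rewrite /dim /= muln1. Qed.

Definition pairing A (x y : {ffun A -> R^o}) : R := \sum_a x a * y a.

Lemma pairing_eq0 A (x : {ffun A -> R^o}) : pairing x x = 0 -> x = 0.
Proof.
move=> /eqP; rewrite psumr_eq0 => [|a _]; last by rewrite -expr2 sqr_ge0.
move=> /allP H; apply/ffunP => a; rewrite ffunE.
have := H a (mem_index_enum _); rewrite /= mulf_eq0 orbb => /eqP.
exact.
Qed.

(** The kernel of [f] is orthogonal to the image of its adjoint, and the pairing is positive
    definite. *)
Lemma adjoint_ker_limg A B (f : 'Hom({ffun A -> R^o}, {ffun B -> R^o}))
    (g : 'Hom({ffun B -> R^o}, {ffun A -> R^o})) :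
  (forall x y, pairing (f x) y = pairing x (g y)) ->
  (\dim (lker f) + \dim (limg g) <= #|A|)%N.
Proof.
move=> fg; rewrite -dimv_disjoint_sum.
  by rewrite -[leqRHS]dim_ffunR -dimvf dimvS // subvf.
apply/eqP; rewrite -subv0; apply/subvP => x; rewrite memv_cap memv0.
rewrite memv_ker => /andP[/eqP fx /memv_imgP[y _ xE]].
by apply/eqP/pairing_eq0; rewrite {2}xE -fg fx /pairing big1 // => a _; rewrite ffunE mul0r.
Qed.

Lemma pairingC A (x y : {ffun A -> R^o}) : pairing x y = pairing y x.
Proof. by apply: eq_bigr => a _; rewrite mulrC. Qed.

(** Equality of row and column rank: the two inequalities from [adjoint_ker_limg] add up to the sum
    of the rank formulas of [f] and [g], so both are equalities. *)
Lemma adjoint_dim_ker A B (f : 'Hom({ffun A -> R^o}, {ffun B -> R^o}))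
    (g : 'Hom({ffun B -> R^o}, {ffun A -> R^o})) :
  (forall x y, pairing (f x) y = pairing x (g y)) ->
  (\dim (lker f) + #|B| = #|A| + \dim (lker g))%N.
Proof.
move=> fg; have h1 := adjoint_ker_limg fg.
have h2 : (\dim (lker g) + \dim (limg f) <= #|B|)%N.
  by apply: adjoint_ker_limg => x y; rewrite pairingC -fg pairingC.
have hf := limg_ker_dim f fullv; have hg := limg_ker_dim g fullv.
rewrite !capfv !dimvf !dim_ffunR in hf hg.
by move: h1 h2 hf hg; clear; lia.
Qed.

End AdjointRank.

Section Incidence.
Variables (R : realType) (E W B : finType) (w : E -> W) (b : E -> B).

(** The incidence matrix of the bipartite graph with edges [E]; [end_sums] is its transpose. *)
Definition fiber_sums (x : {ffun E -> R^o}) : {ffun W + B -> R^o} :=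
  [ffun k => match k with
             | inl u => \sum_(e | w e == u) x e
             | inr u => \sum_(e | b e == u) x e
             end].

Definition end_sums (y : {ffun W + B -> R^o}) : {ffun E -> R^o} :=
  [ffun e => y (inl (w e)) + y (inr (b e))].

Fact fiber_sums_linear : linear fiber_sums.
Proof.
move=> a x y; apply/ffunP => -[u|u]; rewrite !ffunE scaler_sumr -big_split;
by apply: eq_bigr => e _; rewrite !ffunE.
Qed.
HB.instance Definition _ := GRing.isLinear.Build R {ffun E -> R^o}
  {ffun W + B -> R^o} _ fiber_sums fiber_sums_linear.

Fact end_sums_linear : linear end_sums.
Proof.
move=> a x y; apply/ffunP => e; rewrite !ffunE.
by rewrite scalerDr addrACA.
Qed.
HB.instance Definition _ := GRing.isLinear.Build R {ffun W + B -> R^o}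
  {ffun E -> R^o} _ end_sums end_sums_linear.

Lemma fiber_end_adjoint x y :
  pairing (linfun fiber_sums x) y = pairing x (linfun end_sums y).
Proof.
rewrite !lfunE /pairing /=.
have aux (V : finType) (f : E -> V) (h : V -> W + B) :
    \sum_(u : V) (\sum_(e | f e == u) x e) * y (h u) = \sum_e x e * y (h (f e)).
  rewrite (eq_bigr (fun u => \sum_(e | f e == u) x e * y (h (f e)))).
    rewrite [RHS](partition_big f predT) //=.
  by move=> u _; rewrite mulr_suml; apply: eq_bigr => e /eqP ->.
rewrite big_sumType /=.
rewrite (eq_bigr (fun u => (\sum_(e | w e == u) x e) * y (inl u))); last first.
  by move=> u _; rewrite ffunE.
rewrite (aux _ w) (eq_bigr (fun u => (\sum_(e | b e == u) x e) * y (inr u))); last first.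
  by move=> u _; rewrite ffunE.
rewrite (aux _ b) -big_split; apply: eq_bigr => e _ /=.
by rewrite ffunE mulrDr.
Qed.

Definition cycle_space : {vspace {ffun E -> R^o}} := lker (linfun fiber_sums).

Lemma cycle_spaceP (x : {ffun E -> R^o}) : reflect
  ((forall u, \sum_(e | w e == u) x e = 0) /\
   (forall u, \sum_(e | b e == u) x e = 0)) (x \in cycle_space).
Proof.
rewrite memv_ker lfunE /=; apply: (iffP eqP) => [/ffunP H|[H1 H2]].
  by split=> u; [have := H (inl u)|have := H (inr u)]; rewrite !ffunE.
by apply/ffunP => -[u|u]; rewrite !ffunE.
Qed.

(** The relation between the rows of the incidence matrix which says that white and black sums have
    the same total. *)
Definition alternating_sign : {ffun W + B -> R^o} :=
  [ffun k => if k is inl _ then 1 else -1].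

Lemma alternating_ker : alternating_sign \in lker (linfun end_sums).
Proof.
by rewrite memv_ker lfunE /=; apply/eqP/ffunP => e; rewrite !ffunE subrr.
Qed.

Lemma dim_cycle_space :
  (\dim cycle_space + (#|W| + #|B|) = #|E| + \dim (lker (linfun end_sums)))%N.
Proof. by rewrite -card_sum; exact: adjoint_dim_ker fiber_end_adjoint. Qed.

Lemma alternating_neq0 (e : E) : alternating_sign != 0.
Proof.
apply/eqP => /ffunP/(_ (inl (w e))); rewrite !ffunE => /eqP.
by rewrite oner_eq0.
Qed.

(** A vector in the kernel of the transpose has opposite values at the two ends of each edge, so
    connectedness makes it a multiple of [alternating_sign]. *)
Lemma dim_cycle_space_connected (e0 : E) :
  (forall u, exists e, w e = u) -> (forall u, exists e, b e = u) ->
  (forall f : E -> R, (forall e e', w e = w e' -> f e = f e') ->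
     (forall e e', b e = b e' -> f e = f e') -> forall e e', f e = f e') ->
  (\dim cycle_space + (#|W| + #|B|) = #|E| + 1)%N.
Proof.
move=> wsurj bsurj conn; rewrite dim_cycle_space; congr addn.
suff -> : lker (linfun end_sums) = <[alternating_sign]>%VS.
  by rewrite dim_vline (alternating_neq0 e0).
apply/eqP; rewrite eqEsubv -memvE alternating_ker andbT.
apply/subvP => y; rewrite memv_ker lfunE /= => /eqP/ffunP H.
have Hy e : y (inl (w e)) = - y (inr (b e)).
  by apply/eqP; rewrite -addr_eq0; have := H e; rewrite !ffunE => ->.
have cst := conn (fun e => y (inl (w e))).
have {}cst e e' : y (inl (w e)) = y (inl (w e')).
  apply: cst => [a a' ->//|a a' ba]; by rewrite !Hy ba.
apply/vlineP; exists (y (inl (w e0))); apply/ffunP => -[u|u]; rewrite !ffunE.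
  have [e <-] := wsurj u; rewrite (cst e e0).
  by rewrite /GRing.scale /= mulr1.
have [e <-] := bsurj u; rewrite (cst e0 e) Hy /GRing.scale /=.
by rewrite mulrN1 opprK.
Qed.

(* If every vertex has degree at least 2 there are at least as many edges as
   vertices, while the incidence matrix is not of full rank. *)
Lemma cycle_exists (e0 : E) :
  (forall u, (2 <= #|[pred e | w e == u]|)%N) ->
  (forall u, (2 <= #|[pred e | b e == u]|)%N) ->
  exists2 x, x \in cycle_space & x != 0.
Proof.
move=> w2 b2.
have card2 (V : finType) (f : E -> V) :
    (forall u, (2 <= #|[pred e | f e == u]|)%N) -> (2 * #|V| <= #|E|)%N.
  move=> f2; rewrite -[#|E|]sum1_card (partition_big f predT) //=.
  rewrite mulnC -sum_nat_const; apply: leq_sum => u _.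
  by rewrite (leq_trans (f2 u)) // -sum1_card.
have := dim_cycle_space; have := card2 _ _ w2; have := card2 _ _ b2.
have : (0 < \dim (lker (linfun end_sums)))%N.
  rewrite lt0n dimv_eq0; apply/eqP => K0.
  have := alternating_ker; rewrite K0 memv0; apply/negP; exact: alternating_neq0.
move=> h1 h2 h3 h4.
have : cycle_space != 0%VS.
  by rewrite -dimv_eq0 -lt0n; move: h1 h2 h3 h4; clear; lia.
rewrite -vpick0 => nz.
by exists (vpick cycle_space) => //; exact: memv_pick.
Qed.

End Incidence.

(** * Fractional perfect matchings *)

(* After the imports, [conv] is the convex combination of MathComp-Analysis. *)
Local Notation conv := Defs.conv.

Section FractionalMatchings.
Variables (R : realType) (E W B : finType) (w : E -> W) (b : E -> B).
Implicit Types (x y : {ffun E -> R^o}) (m : {ffun E -> nat}).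

Definition feasible : set {ffun E -> R^o} := [set x | [/\ forall e, 0 <= x e,
  forall a, \sum_(e | w e == w a) x e = 1 &
  forall a, \sum_(e | b e == b a) x e = 1]].

Definition regular d m := (forall a, (\sum_(e | w e == w a) m e = d)%N) /\
  (forall a, (\sum_(e | b e == b a) m e = d)%N).

Lemma min_positive (f : E -> R) (P : pred E) :
  (forall e, P e -> 0 < f e) -> exists2 t : R, 0 < t & forall e, P e -> t <= f e.
Proof.
move=> fP; exists (\big[Num.min/1]_(e | P e) f e); first exact: lt_bigmin.
by move=> e; exact: bigmin_le_cond.
Qed.

Lemma feasible_le1 x e : feasible x -> x e <= 1.
Proof.
move=> [x0 xw _]; rewrite -(xw e) (bigD1 e) //= lerDl sumr_ge0 //.
Qed.

Lemma feasible_convex : convex_set (M := {ffun E -> R^o}) feasible.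
Proof.
apply/convex_setP => x y t [x0 xw xb] [y0 yw yb] /andP[t0 t1].
have sumE (P : pred E) : \sum_(e | P e) x e = 1 -> \sum_(e | P e) y e = 1 ->
    \sum_(e | P e) (t *: x + (1 - t) *: y) e = 1.
  move=> xP yP; rewrite (eq_bigr (fun e => t * x e + (1 - t) * y e)).
    by rewrite big_split /= -!mulr_sumr xP yP; ring.
  by move=> e _; rewrite !ffunE.
split=> [e|a|a]; [|exact: sumE|exact: sumE].
by rewrite !ffunE addr_ge0 // mulr_ge0 // subr_ge0.
Qed.

Lemma regular_feasible m : regular 1 m -> feasible (to_real R m).
Proof.
have sumE (P : pred E) : (\sum_(e | P e) m e = 1)%N ->
    \sum_(e | P e) to_real R m e = 1.
  by move=> mP; rewrite (eq_bigr (fun e => (m e)%:R)) -?natr_sum ?mP // => e _; rewrite ffunE.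
by move=> [mw mb]; split=> [e|a|a]; [rewrite ffunE ler0n|exact: sumE|exact: sumE].
Qed.

Definition fractional x e := 0 < x e < 1.

(** A single fractional term cannot be completed to the sum 1 by zeros and ones. *)
Lemma fractional_pair (V : finType) (f : E -> V) x e : (forall e, 0 <= x e) ->
  \sum_(e' | f e' == f e) x e' = 1 -> fractional x e ->
  exists e', [/\ f e' = f e, e' != e & fractional x e'].
Proof.
move=> x0 xf /andP[xe0 xe1].
have : \sum_(e' | (f e' == f e) && (e' != e)) x e' = 1 - x e.
  by rewrite -xf [in RHS](bigD1 e) //= addrAC subrr add0r.
move=> rest.
have : \sum_(e' | (f e' == f e) && (e' != e)) x e' != 0.
  by rewrite rest subr_eq0 eq_sym lt_eqF.
rewrite psumr_neq0 //.
move=> /hasP[e' _ /andP[/andP[/eqP fe ne] xe']].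
exists e'; split => //; rewrite /fractional xe' /= -subr_gt0.
apply: (lt_le_trans xe0); rewrite -xf (bigD1 e') ?fe //= addrAC subrr add0r.
rewrite (bigD1 e) ?eqxx //=; last by rewrite eq_sym.
by rewrite lerDl sumr_ge0.
Qed.

Lemma sum_sub (P : pred E) (h : E -> R) : (forall e, ~~ P e -> h e = 0) ->
  forall Q : pred E, \sum_(e : {e | P e} | Q (val e)) h (val e) = \sum_(e | Q e) h e.
Proof.
move=> hP Q; rewrite [RHS](bigID P) /= [X in _ + X]big1 ?addr0; last first.
  by move=> e /andP[_ /hP].
rewrite [LHS]big_mkcond [RHS]big_mkcondl /=.
by rewrite [RHS](reindex_omap (fun e : {e | P e} => val e) insub) /=;
  [apply: eq_big => [e|//]; rewrite valK eqxx (valP e)|move=> e Pe; rewrite insubT].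
Qed.

(** By [fractional_pair] the graph of fractional edges has all degrees at least 2; [cycle_exists]
    gives a kernel vector on it, which is extended by zero. *)
Lemma fractional_cycle x e0 : feasible x -> fractional x e0 ->
  exists c : {ffun E -> R^o}, [/\ c != 0, forall e, ~~ fractional x e -> c e = 0,
    forall u, \sum_(e | w e == u) c e = 0 & forall u, \sum_(e | b e == u) c e = 0].
Proof.
move=> [x0 xw xb] fx0.
pose P e := fractional x e.
(* Only vertices that meet a fractional edge are kept, since the others have degree 0 in this
   graph. *)
pose Pw u := [exists e, P e && (w e == u)]; pose Pb u := [exists e, P e && (b e == u)].
have Pww (e : {e | P e}) : Pw (w (val e)) by apply/existsP; exists (val e); rewrite (valP e) /=.
have Pbb (e : {e | P e}) : Pb (b (val e)) by apply/existsP; exists (val e); rewrite (valP e) /=.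
pose w' (e : {e | P e}) : {u | Pw u} := Sub (w (val e)) (Pww e).
pose b' (e : {e | P e}) : {u | Pb u} := Sub (b (val e)) (Pbb e).
have two (V V' : finType) (f : E -> V) (f' : {e | P e} -> V') (vl : V' -> V) :
    injective vl -> (forall e, vl (f' e) = f (val e)) ->
    (forall a, \sum_(e | f e == f a) x e = 1) ->
    (forall u, exists e, f' e = u) -> forall u, (2 <= #|[pred e | f' e == u]|)%N.
  move=> vl_inj fE xf surj u; have [e eu] := surj u.
  have [e' [fee ne Pe']] := fractional_pair x0 (xf (val e)) (valP e).
  pose a : {e | P e} := Sub e' Pe'.
  have au : f' a = u by apply: vl_inj; rewrite fE /= fee -fE eu.
  rewrite (cardD1 e) (cardD1 a) !inE eu au !eqxx /=.
  suff -> : a != e by [].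
  by apply: contra ne => /eqP <-.
have [||c' /cycle_spaceP[c'w c'b] c'0] := @cycle_exists R _ _ _ w' b' (Sub e0 fx0).
- apply: (two _ _ w w' val) => //.
  move=> [u Pu]; have /existsP[e /andP[Pe /eqP we]] := Pu.
  by exists (Sub e Pe); apply: val_inj.
- apply: (two _ _ b b' val) => //.
  move=> [u Pu]; have /existsP[e /andP[Pe /eqP we]] := Pu.
  by exists (Sub e Pe); apply: val_inj.
pose c : {ffun E -> R^o} := [ffun e => if insub e is Some a then c' a else 0].
have cP e : ~~ P e -> c e = 0 by move=> nP; rewrite ffunE insubN.
have cV (e : {e | P e}) : c (val e) = c' e by rewrite ffunE valK.
have sums (V V' : finType) (f : E -> V) (f' : {e | P e} -> V') (vl : V' -> V) :
    injective vl -> (forall e, vl (f' e) = f (val e)) ->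
    (forall u, \sum_(e | f' e == u) c' e = 0) -> forall u, \sum_(e | f e == u) c e = 0.
  move=> vl_inj fE c'f u; rewrite -(sum_sub cP (fun e => f e == u)).
  rewrite (eq_bigr (fun e => c' e)); last by move=> e _; exact: cV.
  have [[u' uE]|nu] := pselect (exists u', vl u' = u).
    transitivity (\sum_(e | f' e == u') c' e); last exact: c'f.
    by apply: eq_bigl => e; rewrite -uE -fE; apply/eqP/eqP => [/vl_inj|->].
  by apply: big_pred0 => e; apply/eqP => fe; apply: nu; exists (f' e); rewrite fE.
exists c; split => //.
- apply: contra c'0 => /eqP c0; apply/eqP/ffunP => e.
  by rewrite -cV c0 !ffunE.
- by apply: (sums _ _ w w' val).
- by apply: (sums _ _ b b' val).
Qed.

Lemma integral_regular x : feasible x -> (forall e, ~~ fractional x e) ->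
  exists2 m, regular 1 m & to_real R m = x.
Proof.
move=> fx nf; have [x0 xw xb] := fx.
pose m : {ffun E -> nat} := [ffun e => (x e == 1 : nat)].
have mE : to_real R m = x.
  apply/ffunP => e; rewrite !ffunE; have := nf e; have := feasible_le1 e fx.
  rewrite /fractional le_eqVlt => /orP[/eqP -> _|x1]; first by rewrite eqxx.
  rewrite x1 andbT -leNgt lt_eqF // => xe.
  by apply/eqP; rewrite eq_le x0.
exists m => //; split=> a; apply/eqP; rewrite -(@eqr_nat R) natr_sum; apply/eqP.
  by rewrite -[RHS](xw a) -mE; apply: eq_bigr => e _; rewrite [RHS]ffunE.
by rewrite -[RHS](xb a) -mE; apply: eq_bigr => e _; rewrite [RHS]ffunE.
Qed.

Lemma feasible_move x (c : {ffun E -> R^o}) (t : R) : feasible x ->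
  (forall u, \sum_(e | w e == u) c e = 0) -> (forall u, \sum_(e | b e == u) c e = 0) ->
  (forall e, 0 <= x e + t * c e) -> feasible (x + t *: c).
Proof.
move=> [x0 xw xb] cw cb tc.
have sumE (P : pred E) : \sum_(e | P e) x e = 1 -> \sum_(e | P e) c e = 0 ->
    \sum_(e | P e) (x + t *: c) e = 1.
  move=> xP cP; rewrite (eq_bigr (fun e => x e + t * c e)).
    by rewrite big_split /= -mulr_sumr xP cP mulr0 addr0.
  by move=> e _; rewrite !ffunE.
split=> [e|a|a]; [by rewrite !ffunE; exact: tc|exact: sumE|exact: sumE].
Qed.

Lemma cycle_has_neg (c : {ffun E -> R^o}) : c != 0 ->
  (forall u, \sum_(e | w e == u) c e = 0) -> exists e, c e < 0.
Proof.
move=> c0 cw; apply: contrapT => H.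
have pos e : 0 <= c e by rewrite leNgt; apply/negP => ce; apply: H; exists e.
move/eqP: c0; apply; apply/ffunP => e; rewrite ffunE.
have /eqP := cw (w e); rewrite psumr_eq0 // => /allP/(_ e (mem_index_enum _)).
by rewrite eqxx /= => /eqP.
Qed.

Definition supp x : {set E} := [set e | 0 < x e]%SET.

(* Moving along a cycle of fractional edges until a coordinate vanishes shrinks
   the support. *)
Lemma support_matching x : feasible x ->
  exists2 m, regular 1 m & forall e, (0 < m e)%N -> 0 < x e.
Proof.
move: {2}#|supp x| (leqnn #|supp x|) => n; elim: n x => [|n IH] x sx fx.
  have [x0 xw xb] := fx.
  have nf e : ~~ fractional x e.
    apply/negP => /andP[xe _].
    have : e \in supp x by rewrite inE.
    have sx0 : #|supp x| = 0%N by apply/eqP; rewrite -leqn0.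
    by rewrite (cards0_eq sx0) inE.
  have [m rm mE] := integral_regular fx nf.
  by exists m => // e me; rewrite -mE ffunE ltr0n.
have [[e0 fe0]|nf] := pselect (exists e, fractional x e); last first.
  have [|m rm mE] := integral_regular fx.
    by move=> e; apply/negP => fe; apply: nf; exists e.
  by exists m => // e me; rewrite -mE ffunE ltr0n.
have [x0 xw xb] := fx.
have [c [c0 cf cw cb]] := fractional_cycle fx fe0.
have [e1 ce1] := cycle_has_neg c0 cw.
(* The minimal ratio is the longest step along [c] that keeps all coordinates nonnegative, and the
   coordinate [e2] then vanishes. *)
have [e2 ce2 e2min] := @arg_minP _ _ _ e1 [pred e | c e < 0] (fun e => x e / - c e) ce1.
have xpos e : c e != 0 -> 0 < x e.
  move=> ce; have [fe|/cf] := boolP (fractional x e); first by case/andP: fe.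
  by move=> cz; rewrite cz eqxx in ce.
pose t := x e2 / - c e2.
have nc2 : 0 < - c e2 by rewrite oppr_gt0.
have t0 : 0 < t by rewrite divr_gt0 // xpos // lt_eqF.
have tc e : 0 <= x e + t * c e.
  case: (ltP (c e) 0) => ce; last by rewrite addr_ge0 // mulr_ge0 // ltW.
  have : t <= x e / - c e by apply: e2min.
  by rewrite ler_pdivlMr ?oppr_gt0 // mulrN; lra.
have fy := feasible_move fx cw cb tc.
have sub : supp (x + t *: c) \proper supp x.
  apply/properP; split.
    apply/fintype.subsetP => e; rewrite !inE !ffunE => h.
    have [ce|ce] := eqVneq (c e) 0; last exact: xpos.
    by move: h; rewrite ce scaler0 addr0.
  exists e2; rewrite !inE ?xpos ?lt_eqF // !ffunE -leNgt.
  have -> : t *: c e2 = - x e2.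
    have cn : c e2 != 0 by rewrite lt_eqF.
    by rewrite /GRing.scale /= /t; field.
  by rewrite subrr.
have [|m rm mP] := IH _ _ fy.
  by rewrite -ltnS; apply: leq_trans (proper_card sub) sx.
exists m => // e /mP me; have : e \in supp (x + t *: c) by rewrite inE.
by move/(fintype.subsetP (proper_sub sub)); rewrite inE.
Qed.

Lemma regular1_le1 m e : regular 1 m -> (m e <= 1)%N.
Proof. by move=> [mw _]; rewrite -(mw e) (bigD1 e) //= leq_addr. Qed.

(** Subtract from [x] the largest possible multiple of a matching in its support and rescale; the
    remainder is feasible with smaller support. *)
Lemma birkhoff x : feasible x ->
  conv (to_real R @` [set m | regular 1 m]) x.
Proof.
move: {2}#|supp x| (leqnn #|supp x|) => n; elim: n x => [|n IH] x sx fx.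
  (* When the support is empty, the matching inside it is zero as well and equals [x]. *)
  have [m rm mP] := support_matching fx; have [x0 xw xb] := fx.
  have z e : x e = 0.
    apply/eqP; rewrite eq_le x0 andbT leNgt; apply/negP => xe.
    have : e \in supp x by rewrite inE.
    have sx0 : #|supp x| = 0%N by apply/eqP; rewrite -leqn0.
    by rewrite (cards0_eq sx0) inE.
  have -> : x = to_real R m.
    apply/ffunP => e; rewrite z ffunE.
    have := mP e; rewrite z ltxx; case: (m e) => // k H.
    by have := H isT.
  by move=> A [_ MA]; apply: MA; exists m.
have [m rm mP] := support_matching fx; have [x0 xw xb] := fx.
have Mm : conv (to_real R @` [set m | regular 1 m]) (to_real R m).
  by move=> A [_ MA]; apply: MA; exists m.
have [xE|nE] := eqVneq x (to_real R m); first by rewrite xE.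
have [e0 me0] : exists e, (0 < m e)%N.
  apply: contrapT => H; move/eqP: nE; apply; apply/ffunP => e.
  have [mw _] := rm; have := mw e; rewrite big1 // => e' _.
  by apply/eqP; rewrite -leqn0 leqNgt; apply/negP => me; apply: H; exists e'.
have [e2 me2 e2min] := @arg_minP _ _ _ e0 [pred e | (0 < m e)%N] (fun e => x e) me0.
pose t := x e2.
have t0 : 0 < t by exact: mP.
have m1 e : (0 < m e)%N -> m e = 1%N.
  by move=> me; apply/eqP; rewrite eqn_leq me regular1_le1.
(* If [t] were 1, the edges of [m] would all have weight 1 and leave nothing to the others, so [x]
   would be [m]. *)
have t1 : t < 1.
  rewrite lt_neqAle (feasible_le1 _ fx) andbT; apply/negP => /eqP tE.
  move/eqP: nE; apply; apply/ffunP => e; rewrite ffunE.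
  have one e' : (0 < m e')%N -> x e' = 1.
    move=> me'; apply/eqP; rewrite eq_le feasible_le1 //= -tE; exact: e2min.
  have [me|] := ltnP 0 (m e); first by rewrite one // m1.
  rewrite leqn0 => /eqP me; rewrite me.
  have [e' /andP[/eqP we me']] : exists e', (w e' == w e) && (0 < m e')%N.
    apply: contrapT => H; have [mw _] := rm; have := mw e; rewrite big1 // => e' we.
    apply/eqP; rewrite -leqn0 leqNgt; apply/negP => me'; apply: H.
    by exists e'; rewrite we.
  have ne : e != e' by apply/eqP => E1; rewrite E1 in me; rewrite me in me'.
  have := xw e; rewrite (bigD1 e) //= (bigD1 e') /=; last by rewrite we eqxx eq_sym.
  rewrite (one _ me') => s1; have := x0 e.
  have : 0 <= \sum_(i | (w i == w e) && (i != e) && (i != e')) x i by rewrite sumr_ge0.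
  by move: s1; move: (\sum_(i | _) _) => z; lra.
pose y : {ffun E -> R^o} := (1 - t)^-1 *: (x - t *: to_real R m).
have t1' : 0 < 1 - t by rewrite subr_gt0.
have ye e : y e = (x e - t * (m e)%:R) / (1 - t).
  by rewrite !ffunE /GRing.scale /= mulrC.
have fy : feasible y.
  have [_ rw rb] := regular_feasible rm.
  have sumE (P : pred E) : \sum_(e | P e) x e = 1 ->
      \sum_(e | P e) to_real R m e = 1 -> \sum_(e | P e) y e = 1.
    move=> xP mPP; rewrite (eq_bigr (fun e => (x e - t * to_real R m e) / (1 - t))).
      rewrite -mulr_suml sumrB -mulr_sumr xP mPP mulr1 divff // gt_eqF //.
    by move=> e _; rewrite ye ffunE.
  split=> [e|a|a]; [|exact: sumE|exact: sumE].
  rewrite ye divr_ge0 ?(ltW t1') // subr_ge0.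
  have [me|] := ltnP 0 (m e); first by rewrite m1 // mulr1; exact: e2min.
  by rewrite leqn0 => /eqP ->; rewrite mulr0.
have sub : supp y \proper supp x.
  apply/properP; split.
    apply/fintype.subsetP => e; rewrite !inE ye => h.
    have : 0 < x e - t * (m e)%:R by move: h; rewrite pmulr_lgt0 // invr_gt0.
    rewrite subr_gt0; apply: le_lt_trans.
    by rewrite mulr_ge0 // ltW.
  exists e2; rewrite !inE ?ye; first exact: mP.
  by rewrite m1 // mulr1 subrr mul0r ltxx.
have cy : conv (to_real R @` [set m | regular 1 m]) y.
  apply: IH => //.
  by rewrite -ltnS; apply: leq_trans (proper_card sub) sx.
have -> : x = t *: to_real R m + (1 - t) *: y.
  apply/ffunP => e; rewrite !ffunE /GRing.scale /= mulrA divff ?gt_eqF //.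
  by rewrite mul1r addrC subrK.
move=> A [cA MA]; apply: ((convex_setP A).1 cA).
- exact: Mm.
- exact: cy.
- by rewrite !ltW.
Qed.

(** Divided by its degree, [m] is feasible, so a matching lies in its support; having values at most
    1, it can be subtracted from [m]. *)
Lemma koenig d m : regular d m ->
  exists2 l : seq {ffun E -> nat}, (forall m', m' \in l -> regular 1 m') &
    \sum_(m' <- l) m' = m.
Proof.
elim: d m => [|d IH] m rm.
  exists [::] => //; rewrite big_nil; apply/ffunP => e; rewrite ffunE.
  have [mw _] := rm; have /eqP := mw e; rewrite sum_nat_eq0 => /forallP/(_ e).
  by rewrite eqxx => /eqP.
pose x : {ffun E -> R^o} := [ffun e => (m e)%:R / d.+1%:R].
have d0 : 0 < d.+1%:R :> R by rewrite ltr0n.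
have fx : feasible x.
  have [mw mb] := rm.
  have sumE (P : pred E) : (\sum_(e | P e) m e = d.+1)%N -> \sum_(e | P e) x e = 1.
    move=> mP; rewrite (eq_bigr (fun e => (m e)%:R / d.+1%:R)).
      by rewrite -mulr_suml -natr_sum mP divff // gt_eqF.
    by move=> e _; rewrite ffunE.
  split=> [e|a|a]; [|exact: sumE|exact: sumE].
  by rewrite ffunE divr_ge0 // ltW.
have [m1 rm1 m1P] := support_matching fx.
have le e : (m1 e <= m e)%N.
  have [h|] := ltnP 0 (m1 e); last by rewrite leqn0 => /eqP ->.
  apply: (leq_trans (regular1_le1 e rm1)).
  have := m1P e h; rewrite ffunE pmulr_lgt0 ?invr_gt0 // ltr0n.
  exact.
pose m' : {ffun E -> nat} := [ffun e => (m e - m1 e)%N].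
have mE : m = m1 + m'.
  apply/ffunP => e; rewrite !ffunE.
  by have := subnKC (le e) => {1}<-.
have [|l lP lE] := IH m'.
  have [mw mb] := rm; have [m1w m1b] := rm1.
  have sumE (P : pred E) : (\sum_(e | P e) m e = d.+1)%N ->
      (\sum_(e | P e) m1 e = 1)%N -> (\sum_(e | P e) m' e = d)%N.
    move=> h1 h2; move: h1; rewrite (eq_bigr (fun e => m1 e + m' e)%N).
      by rewrite big_split /= h2 add1n => -[].
    by move=> e _; rewrite ffunE subnKC.
  by split=> a; exact: sumE.
exists (m1 :: l); last by rewrite big_cons lE mE.
by move=> y; rewrite inE => /orP[/eqP ->|/lP].
Qed.

Lemma feasible_extreme : extreme_points feasible = to_real R @` [set m | regular 1 m].
Proof.
apply/seteqP; split=> [x [fx ext]|_ [m rm <-]].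
  have [|m rm mE] := integral_regular fx; last by exists m.
  move=> e0; apply/negP => fe0.
  have [c [c0 cf cw cb]] := fractional_cycle fx fe0.
  have [x0 xw xb] := fx.
  (* This [t] permits a move along [c] in both directions, which makes [x] a midpoint. *)
  have [|t t0 tP] := @min_positive (fun e => x e / `|c e|) [pred e | c e != 0].
    move=> e /= ce; rewrite divr_gt0 ?normr_gt0 //.
    have [/andP[//]|/cf cz] := boolP (fractional x e).
    by rewrite cz eqxx in ce.
  have tc e : `|t * c e| <= x e.
    have [ce|ce] := eqVneq (c e) 0; first by rewrite ce mulr0 normr0.
    by have := tP e ce; rewrite ler_pdivlMr ?normr_gt0 // normrM gtr0_norm.
  have f1 : feasible (x + t *: c).
    by apply: feasible_move => // e; have := tc e; rewrite ler_norml => /andP[]; lra.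
  have f2 : feasible (x + (- t) *: c).
    by apply: feasible_move => // e; have := tc e; rewrite ler_norml => /andP[]; lra.
  have [|E1 _] := ext _ _ f1 f2.
    exists 2^-1; first by rewrite /= invr_gt0 ltr0n invf_lt1 ?ltr0n // ltr1n.
    apply/ffunP => e; rewrite !ffunE /GRing.scale /=; lra.
  move/eqP: c0; apply; apply/ffunP => e.
  move/ffunP/(_ e): E1; rewrite !ffunE /GRing.scale /= => /eqP.
  rewrite -subr_eq0 addrAC subrr add0r mulf_eq0 gt_eqF //= => /eqP ->.
  by [].
split; first exact: regular_feasible.
move=> x y fx fy [t /= /andP[t0 t1] E1].
have [x0 _ _] := fx; have [y0 _ _] := fy.
have pt e : (1 - t) * x e + t * y e = (m e)%:R.
  by move/ffunP/(_ e): E1; rewrite !ffunE.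
suff H e : x e = (m e)%:R /\ y e = (m e)%:R.
  by split; apply/ffunP => e; have [h1 h2] := H e; rewrite [RHS]ffunE.
have := pt e; have := x0 e; have := y0 e.
have := feasible_le1 e fx; have := feasible_le1 e fy.
have := regular1_le1 e rm; case: (m e) => [|[|//]] _ hx1 hy1 hx hy h.
  by split; nra.
by split; nra.
Qed.

Lemma conv_regular : conv (to_real R @` [set m | regular 1 m]) = feasible.
Proof.
apply/seteqP; split=> [x cx|x]; last exact: birkhoff.
apply: cx; split; first exact: feasible_convex.
by move=> _ [m rm <-]; exact: regular_feasible.
Qed.

End FractionalMatchings.

(** * Affine hulls of polytopes and of their linear images *)

Section Dimensions.
Variables (R : realType) (E W B : finType) (w : E -> W) (b : E -> B).
Local Notation V := {ffun E -> R^o}.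
Local Notation feasible := (feasible (R := R) w b).

Lemma fiber_sum0 (T : finType) (f : E -> T) (x : V) :
  (forall a, \sum_(e | f e == f a) x e = 0) -> forall u, \sum_(e | f e == u) x e = 0.
Proof.
move=> H u; have [[a <-]|nu] := pselect (exists a, f a = u); first exact: H.
by rewrite big_pred0 // => e; apply/eqP => fe; apply: nu; exists e.
Qed.

Lemma feasible_sub (x y : V) : feasible x -> feasible y ->
  x - y \in cycle_space R w b.
Proof.
move=> [_ xw xb] [_ yw yb].
have sumE (P : pred E) : \sum_(e | P e) x e = 1 -> \sum_(e | P e) y e = 1 ->
    \sum_(e | P e) (x - y) e = 0.
  move=> xP yP; rewrite (eq_bigr (fun e => x e - y e)).
    by rewrite sumrB xP yP subrr.
  by move=> e _; rewrite !ffunE.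
by apply/cycle_spaceP; split; apply: fiber_sum0 => a; exact: sumE.
Qed.

(** From a point with positive coordinates a short step along any vector of the cycle space stays
    feasible. *)
Lemma feasible_span (x0 : V) (U : {vspace V}) :
  feasible x0 -> (forall e, 0 < x0 e) ->
  (forall x y, feasible x -> feasible y -> x - y \in U) ->
  (cycle_space R w b <= U)%VS.
Proof.
move=> fx0 pos H; apply/subvP => c cc.
have [cw cb] : (forall u, \sum_(e | w e == u) c e = 0) /\
  (forall u, \sum_(e | b e == u) c e = 0) by apply/cycle_spaceP.
have [|t t0 tP] := @min_positive R E (fun e => x0 e / (1 + `|c e|)) predT.
  by move=> e _; rewrite divr_gt0 // ltr_pwDl.
have fx : feasible (x0 + t *: c).
  apply: feasible_move => // e; have := tP e isT.
  have n0 : 0 < 1 + `|c e| by rewrite ltr_pwDl.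
  rewrite ler_pdivlMr //; have : - `|c e| <= c e by rewrite lerNl ler_normr lexx orbT.
  by move: t0 => /=; nra.
have := H _ _ fx fx0; rewrite addrC addKr => tc.
by rewrite -(scalerK (lt0r_neq0 t0) c); exact: memvZ.
Qed.

Lemma sub_conv (U : lmodType R) (S : set U) : S `<=` conv S.
Proof. by move=> x Sx A [_]; apply. Qed.

Lemma conv_convex (U : lmodType R) (S : set U) : convex_set (M := U) (conv S).
Proof.
apply/convex_setP => x y t cx cy t01 A [cA SA].
by apply: ((convex_setP A).1 cA) => //; [apply: cx|apply: cy].
Qed.

Lemma conv_min (U : lmodType R) (S A : set U) : convex_set (M := U) A ->
  S `<=` A -> conv S `<=` A.
Proof. by move=> cA SA x; apply. Qed.

Lemma conv_image_sub (Q : vectType R) (q : 'Hom(V, Q)) (S : set V) :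
  conv (q @` S) `<=` q @` conv S.
Proof.
apply: conv_min; last by move=> _ [x Sx <-]; exists x => //; exact: sub_conv.
apply/convex_setP => _ _ t [x cx <-] [y cy <-] t01.
exists (t *: x + (1 - t) *: y); last by rewrite linearD !linearZ.
by apply: ((convex_setP _).1 (@conv_convex _ S)).
Qed.

Lemma image_conv_sub (Q : vectType R) (q : 'Hom(V, Q)) (S : set V) :
  q @` conv S `<=` conv (q @` S).
Proof.
move=> _ [x cx <-]; apply: (cx [set x | conv (q @` S) (q x)]); split.
  apply/convex_setP => y z t cy cz t01 /=; rewrite linearD !linearZ.
  by apply: ((convex_setP _).1 (@conv_convex _ _)).
by move=> y Sy; apply: sub_conv; exists y.
Qed.

(** For minimality, the preimage under [q] of a subspace containing the differences of the image
    contains the original differences, hence [U]. *)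
Lemma has_dim_image_conv (Q : vectType R) (q : 'Hom(V, Q)) (S : set V)
    (U : {vspace V}) : conv S !=set0 ->
  (forall x y, conv S x -> conv S y -> x - y \in U) ->
  (forall U' : {vspace V}, (forall x y, conv S x -> conv S y -> x - y \in U') ->
     (U <= U')%VS) ->
  has_dim (conv (q @` S)) (\dim (q @: U)).
Proof.
move=> [x cx] US Umin; split.
  by exists (q x); apply: image_conv_sub; exists x.
exists (q @: U)%VS; split => // [_ _ /conv_image_sub[y cy <-] /conv_image_sub[z cz <-]|U' HU'].
  by rewrite -linearB memv_img // US.
have UU' : (U <= q @^-1: U')%VS.
  apply: Umin => y z cy cz; rewrite -memv_preim linearB.
  by apply: HU'; apply: image_conv_sub; [exists y|exists z].
apply/subvP => _ /memv_imgP[u uU ->].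
by move/subvP: UU' => /(_ _ uU); rewrite -memv_preim.
Qed.

End Dimensions.

(** * Weights of two permutations and the dimensions on the torus *)

Section PermutedWeights.
Variables (R : realType) (E : finType) (s0 s1 : {perm E}).
Local Notation V := {ffun E -> R^o}.
Local Notation WT := {u : {set E} | u \in Pwhite s0}.
Local Notation BT := {u : {set E} | u \in Pblack s1}.
Local Notation v := (vperm s0 s1).
Local Notation VT := {u : {set E} | u \in Pstar s0 s1}.

Lemma mem_porbits (s : {perm E}) e : porbit s e \in porbits s.
Proof. exact: imset_f. Qed.

Lemma mem_porbit1 (s : {perm E}) e : s e \in porbit s e.
Proof. by have := mem_porbit s 1 e; rewrite expg1. Qed.

(** Orbits are turned into elements of finite types, so that they can serve as the vertices of the
    bipartite graph above. *)
Definition white_of (e : E) : WT := Sub (wpoly s0 e) (mem_porbits s0 e).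
Definition black_of (e : E) : BT := Sub (bpoly s1 e) (mem_porbits s1 e).
Definition target_of (e : E) : VT := Sub (target s0 s1 e) (mem_porbits v e).
Definition source_of (e : E) : VT := Sub (source s0 s1 e) (mem_porbits v (s0^-1%g e)).

Lemma white_ofE e a : (white_of e == white_of a) = (e \in porbit s0 a).
Proof. by rewrite -val_eqE /= eq_porbit_mem. Qed.

Lemma black_ofE e a : (black_of e == black_of a) = (e \in porbit s1 a).
Proof. by rewrite -val_eqE /= eq_porbit_mem. Qed.

Lemma porbits_surj (s : {perm E}) (u : {u : {set E} | u \in porbits s}) :
  exists e, val u = porbit s e.
Proof. by have /imsetP[e _ ->] := valP u; exists e. Qed.

Lemma white_surj u : exists e, white_of e = u.
Proof. by have [e eu] := porbits_surj u; exists e; apply: val_inj. Qed.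

Lemma black_surj u : exists e, black_of e = u.
Proof. by have [e eu] := porbits_surj u; exists e; apply: val_inj. Qed.

Lemma target_surj u : exists e, target_of e = u.
Proof. by have [e eu] := porbits_surj u; exists e; apply: val_inj. Qed.

Local Notation feasible := (feasible (R := R) white_of black_of).
Local Notation regular := (regular white_of black_of).
Local Notation cycle_space := (cycle_space R white_of black_of).

Lemma is_weightE d m : is_weight s0 s1 d m <-> regular d m.
Proof.
split=> [[Hw Hb]|[Hw Hb]]; split.
- move=> a; rewrite -(Hw (porbit s0 a) (mem_porbits _ _)).
  by apply: eq_bigl => e; rewrite white_ofE.
- move=> a; rewrite -(Hb (porbit s1 a) (mem_porbits _ _)).
  by apply: eq_bigl => e; rewrite black_ofE.
- move=> _ /imsetP[a _ ->]; rewrite -(Hw a).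
  by apply: eq_bigl => e; rewrite white_ofE.
- move=> _ /imsetP[a _ ->]; rewrite -(Hb a).
  by apply: eq_bigl => e; rewrite black_ofE.
Qed.

Lemma matchingsE : matchings s0 s1 = [set m | regular 1 m].
Proof. by apply/seteqP; split=> m /is_weightE. Qed.

Lemma matching_polytopeE : matching_polytope s0 s1 R = feasible.
Proof. by rewrite /matching_polytope matchingsE conv_regular. Qed.

Lemma feasibleE : feasible = [set theta : V |
  [/\ forall e, 0 <= theta e,
      forall u, u \in Pwhite s0 -> \sum_(e | wpoly s0 e == u) theta e = 1
    & forall u, u \in Pblack s1 -> \sum_(e | bpoly s1 e == u) theta e = 1]].
Proof.
apply/seteqP; split=> x [x0 xw xb]; split => //.
- by move=> _ /imsetP[a _ ->]; rewrite -[RHS](xw a).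
- by move=> _ /imsetP[a _ ->]; rewrite -[RHS](xb a).
- by move=> a; rewrite -[RHS](xw (wpoly s0 a) (mem_porbits _ _)).
- by move=> a; rewrite -[RHS](xb (bpoly s1 a) (mem_porbits _ _)).
Qed.

Lemma weights_generated : weights s0 s1 = Nspan (matchings s0 s1).
Proof.
rewrite matchingsE; apply/seteqP; split=> [m [d /is_weightE/(koenig R)[l lP lE]]|m [l lP <-]].
  by exists l.
exists (size l); apply/is_weightE.
elim: l lP => [|a l IH] lP.
  by rewrite big_nil; split=> e; rewrite big1 // => *; rewrite ffunE.
have [|lw lb] := IH; first by move=> x xl; apply: lP; rewrite inE xl orbT.
have [aw ab] : regular 1 a by apply: lP; rewrite inE eqxx.
rewrite big_cons; split=> e.
  rewrite (eq_bigr (fun e => a e + (\sum_(x <- l) x)%R e)%N).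
    by rewrite big_split /= aw lw.
  by move=> *; rewrite ffunE.
rewrite (eq_bigr (fun e => a e + (\sum_(x <- l) x)%R e)%N).
  by rewrite big_split /= ab lb.
by move=> *; rewrite ffunE.
Qed.

Lemma wclass_sum (l : seq {ffun E -> nat}) :
  wclass s0 s1 (\sum_(m <- l) m) = \sum_(m <- l) wclass s0 s1 m.
Proof.
have intD m m' : to_int (m + m') = to_int m + to_int m'.
  by apply/ffunP => e; rewrite !ffunE PoszD.
have int0 : to_int 0 = 0 :> {ffun E -> int} by apply/ffunP => e; rewrite !ffunE.
elim: l => [|m l IH]; first by rewrite !big_nil /wclass int0 raddf0.
by rewrite !big_cons -IH /wclass intD raddfD.
Qed.

Lemma weight_classes_generated :
  weight_classes s0 s1 = Nspan (matching_classes s0 s1).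
Proof.
apply/seteqP; split=> [_ [m + <-]|_ [l lP <-]].
  rewrite weights_generated => -[l lP <-].
  exists [seq wclass s0 s1 m | m <- l]; last by rewrite big_map wclass_sum.
  by move=> _ /mapP[x xl ->]; exists x => //; exact: lP.
have [l' l'P <-] : exists2 l', (forall m, m \in l' -> matchings s0 s1 m) &
    [seq wclass s0 s1 m | m <- l'] = l.
  elim: l lP => [|c l IH] lP; first by exists [::].
  have [|l' l'P <-] := IH; first by move=> x xl; apply: lP; rewrite inE xl orbT.
  have [m mP mc] : matching_classes s0 s1 c by apply: lP; rewrite inE eqxx.
  exists (m :: l'); last by rewrite /= mc.
  by move=> x; rewrite inE => /orP[/eqP ->|/l'P].
exists (\sum_(m <- l') m); last by rewrite wclass_sum big_map.
by rewrite weights_generated; exists l'.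
Qed.

Lemma dimer_matching e : dimer_complete s0 s1 ->
  exists2 m, regular 1 m & (0 < m e)%N.
Proof.
move=> /(_ e); apply: contraPP => H; apply/negP; rewrite -leqNgt leqn0.
have z m : matchings s0 s1 m -> m e = 0%N.
  rewrite matchingsE => mm; apply/eqP; rewrite -leqn0 leqNgt.
  by apply/negP => me; apply: H; exists m.
(* By convention a sum over a set with infinite support is the empty sum. *)
case: finite_supportP => [|X XM _ _]; first by rewrite big_nil ffunE.
rewrite big_seq; elim/big_ind: _ => [|x y /eqP x0 /eqP y0|m mX].
- by rewrite ffunE.
- by rewrite ffunE x0 y0.
- by rewrite z //; exact: XM.
Qed.

(** The point is the average, over all edges [a], of a matching through [a]. *)
Lemma positive_point : dimer_complete s0 s1 -> (0 < #|E|)%N ->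
  exists2 x : V, feasible x & forall e, 0 < x e.
Proof.
move=> dc E0; pose m e := s2val (cid2 (dimer_matching e dc)).
have mr e : regular 1 (m e) by rewrite /m; case: cid2.
have me e : (0 < m e e)%N by rewrite /m; case: cid2.
have n0 : 0 < #|E|%:R :> R by rewrite ltr0n.
pose x : V := [ffun e => (\sum_a to_real R (m a) e) / #|E|%:R].
exists x => [|e]; last first.
  rewrite ffunE divr_gt0 // (bigD1 e) //= ltr_pwDl //.
    by rewrite ffunE ltr0n.
  by rewrite sumr_ge0 // => *; rewrite ffunE.
have sumE (P : pred E) : (forall a, \sum_(e | P e) to_real R (m a) e = 1) ->
    \sum_(e | P e) x e = 1.
  move=> mP; rewrite (eq_bigr (fun e => (\sum_a to_real R (m a) e) / #|E|%:R)).
    rewrite -mulr_suml exchange_big /= (eq_bigr (fun=> 1)) => [|a _]; last exact: mP.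
    by rewrite sumr_const divff // gt_eqF.
  by move=> e _; rewrite ffunE.
split=> [e|a|a].
- by rewrite ffunE divr_ge0 ?(ltW n0) // sumr_ge0 // => *; rewrite ffunE.
- by apply: sumE => c; have [] := regular_feasible R (mr c).
- by apply: sumE => c; have [] := regular_feasible R (mr c).
Qed.

Hypothesis connected : forall A : pred E, (forall e, A (s0 e) = A e) ->
  (forall e, A (s1 e) = A e) -> forall e e', A e -> A e'.

Lemma invariant_const (f : E -> R) : (forall e, f (s0 e) = f e) ->
  (forall e, f (s1 e) = f e) -> forall e e', f e = f e'.
Proof.
move=> f0 f1 e e'; apply/esym/eqP.
apply: (@connected [pred a | f a == f e] _ _ e e') => /= [a|a|].
- by rewrite f0.
- by rewrite f1.
- exact: eqxx.
Qed.

Lemma dim_cycles (e0 : E) :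
  (\dim cycle_space + (#|Pwhite s0| + #|Pblack s1|) = #|E| + 1)%N.
Proof.
have cw : #|{: WT}| = #|Pwhite s0| by rewrite card_sig; apply: eq_card.
have cb : #|{: BT}| = #|Pblack s1| by rewrite card_sig; apply: eq_card.
rewrite -cw -cb; apply: dim_cycle_space_connected e0 white_surj black_surj _.
move=> f fw fb; apply: invariant_const => e.
  by apply: fw; apply/eqP; rewrite white_ofE mem_porbit1.
by apply: fb; apply/eqP; rewrite black_ofE mem_porbit1.
Qed.

(** [source] is defined through the white tile; the preceding edge on the black tile is one step of
    [vperm] away, so both permutations can be treated alike. *)
Lemma target_s1V e : source s0 s1 e = target s0 s1 (s1^-1%g e).
Proof.
rewrite /source /target; apply/eqP; rewrite eq_porbit_mem porbit_sym.
have -> : s1^-1%g e = v (s0^-1%g e) by rewrite /vperm permM permKV.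
exact: mem_porbit1.
Qed.

(** Since an edge begins where its predecessor on either tile ends, the sum over a cycle
    telescopes. *)
Lemma alpha_cycle u : alpha_real s0 s1 R u \in cycle_space.
Proof.
pose F e : R := (target s0 s1 e == u)%:R.
have aE (s : {perm E}) e : source s0 s1 e = target s0 s1 (s^-1%g e) ->
    alpha_real s0 s1 R u e = F e - F (s^-1%g e).
  by move=> sE; rewrite !ffunE sE rmorphB.
have sum0 (s : {perm E}) a : (forall e, source s0 s1 e = target s0 s1 (s^-1%g e)) ->
    \sum_(e in porbit s a) alpha_real s0 s1 R u e = 0.
  move=> sE; rewrite (eq_bigr (fun e => F e - F (s^-1%g e))) => [|e _]; last exact: aE.
  rewrite sumrB; apply/eqP; rewrite subr_eq0; apply/eqP.
  rewrite [RHS](reindex_inj (@perm_inj _ s)) /=.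
  apply: eq_big => e; last by rewrite permK.
  by have := porbit_perm s 1 e; rewrite -!eq_porbit_mem expg1 => ->.
apply/cycle_spaceP; split; apply: fiber_sum0 => a.
  by rewrite -[RHS](@sum0 s0 a) //; apply: eq_bigl => e; rewrite white_ofE.
rewrite -[RHS](@sum0 s1 a); last exact: target_s1V.
by apply: eq_bigl => e; rewrite black_ofE.
Qed.

(** The coboundary map from functions on the vertices to functions on the edges. *)
Definition alpha_comb (c : {ffun VT -> R^o}) : V :=
  \sum_u c u *: alpha_real s0 s1 R (val u).

Fact alpha_comb_linear : linear alpha_comb.
Proof.
move=> a x y; rewrite /alpha_comb scaler_sumr -big_split; apply: eq_bigr => u _ /=.
by rewrite !ffunE scalerDl scalerA.
Qed.
HB.instance Definition _ := GRing.isLinear.Build R {ffun VT -> R^o} V _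
  alpha_comb alpha_comb_linear.

Lemma alpha_combE c e : alpha_comb c e = c (target_of e) - c (source_of e).
Proof.
rewrite /alpha_comb sum_ffunE.
have pick (g : E -> VT) : \sum_u c u * (val (g e) == val u)%:R = c (g e).
  rewrite (bigD1 (g e)) //= eqxx mulr1 big1 ?addr0 // => u ne.
  by rewrite val_eqE eq_sym (negbTE ne) mulr0.
rewrite -(pick target_of) -(pick source_of) -sumrB; apply: eq_bigr => u _.
by rewrite !ffunE -mulrBr rmorphB.
Qed.

Lemma alpha_space_limg : alpha_space s0 s1 R = limg (linfun alpha_comb).
Proof.
apply/eqP; rewrite eqEsubv; apply/andP; split.
  apply/span_subvP => _ /mapP[u + ->]; rewrite mem_enum => uP.
  pose d : {ffun VT -> R^o} := [ffun a => (val a == u)%:R].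
  have -> : alpha_real s0 s1 R u = linfun alpha_comb d.
    rewrite lfunE /= /alpha_comb (bigD1 (Sub u uP : VT)) //= ffunE eqxx scale1r.
    rewrite big1 ?addr0 // => a; rewrite -val_eqE /= => /negbTE ne.
    by rewrite ffunE ne scale0r.
  by rewrite memv_img ?memvf.
apply/subvP => _ /memv_imgP[c _ ->]; rewrite lfunE /=.
apply: memv_suml => u _; apply: memvZ; apply: memv_span.
by apply: map_f; rewrite mem_enum (valP u).
Qed.

(** A function with zero coboundary agrees at the ends of every edge. As each edge ends where its
    successors under [s0] and [s1] begin, connectedness makes the function constant, so the kernel
    is a line. *)
Lemma dim_alpha_space (e0 : E) : (\dim (alpha_space s0 s1 R) + 1 = #|Pstar s0 s1|)%N.
Proof.
have ck : #|{: VT}| = #|Pstar s0 s1| by rewrite card_sig; apply: eq_card.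
have := limg_ker_dim (linfun alpha_comb) fullv.
rewrite capfv -alpha_space_limg dimvf dim_ffunR ck => <-; rewrite addnC.
congr addn; pose cst : {ffun VT -> R^o} := [ffun=> 1].
suff -> : lker (linfun alpha_comb) = <[cst]>%VS.
  rewrite dim_vline; suff -> : cst != 0 by [].
  apply/eqP => /ffunP/(_ (target_of e0)); rewrite !ffunE => /eqP.
  by rewrite oner_eq0.
apply/eqP; rewrite eqEsubv -memvE; apply/andP; split; last first.
  rewrite memv_ker lfunE /=; apply/eqP/ffunP => e.
  by rewrite alpha_combE !ffunE subrr.
apply/subvP => c; rewrite memv_ker lfunE /= => /eqP/ffunP H.
have st e : c (target_of e) = c (source_of e).
  by apply/eqP; rewrite -subr_eq0 -alpha_combE H ffunE.
have const : forall e e', c (target_of e) = c (target_of e').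
  apply: invariant_const => e.
    rewrite st; congr (c _); apply: val_inj; by rewrite /= /source permK.
  rewrite st; congr (c _); apply: val_inj; by rewrite /= target_s1V permK.
apply/vlineP; exists (c (target_of e0)); apply/ffunP => u.
have [e <-] := target_surj u.
by rewrite (const e e0) !ffunE /GRing.scale /= mulr1.
Qed.

(** The coboundaries lie in the cycle space, so [q] lowers its dimension by exactly theirs. *)
Lemma dim_newton (e0 : E) (Q : vectType R) (q : 'Hom(V, Q)) :
  lker q = alpha_space s0 s1 R ->
  (\dim (q @: cycle_space) + #|Pstar s0 s1| = \dim cycle_space + 1)%N.
Proof.
move=> kq; rewrite -(limg_ker_dim q cycle_space) kq.
have /capv_idPr -> : (alpha_space s0 s1 R <= cycle_space)%VS.
  by apply/span_subvP => _ /mapP[u _ ->]; exact: alpha_cycle.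
by rewrite -(dim_alpha_space e0); move: (\dim _) (\dim _); clear; lia.
Qed.

Hypothesis nonempty : (0 < #|E|)%N.
Hypothesis euler : #|E| = (#|Pwhite s0| + #|Pblack s1| + #|Pstar s0 s1|)%N.
Hypothesis complete : dimer_complete s0 s1.

Lemma dim_cycle_space_torus : \dim cycle_space = (#|Pstar s0 s1| + 1)%N.
Proof.
have [e0 _] : exists e0 : E, e0 \in E by apply/card_gt0P.
by have := dim_cycles e0; rewrite euler; clear; lia.
Qed.

Lemma polytope_sub x y : matching_polytope s0 s1 R x ->
  matching_polytope s0 s1 R y -> x - y \in cycle_space.
Proof. by rewrite matching_polytopeE; exact: feasible_sub. Qed.

Lemma polytope_span (U : {vspace V}) : (forall x y,
    matching_polytope s0 s1 R x -> matching_polytope s0 s1 R y -> x - y \in U) ->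
  (cycle_space <= U)%VS.
Proof.
have [x0 fx0 pos] := positive_point complete nonempty.
by rewrite matching_polytopeE; exact: feasible_span fx0 pos.
Qed.

Lemma polytope_nonempty : matching_polytope s0 s1 R !=set0.
Proof.
have [x0 fx0 pos] := positive_point complete nonempty.
by exists x0; rewrite matching_polytopeE.
Qed.

Lemma has_dim_polytope : has_dim (matching_polytope s0 s1 R) (#|Pstar s0 s1| + 1).
Proof.
split; first exact: polytope_nonempty.
exists cycle_space; split; [exact: dim_cycle_space_torus|exact: polytope_sub|].
exact: polytope_span.
Qed.

Lemma has_dim_newton (Q : vectType R) (q : 'Hom(V, Q)) :
  lker q = alpha_space s0 s1 R -> has_dim (newton_polygon s0 s1 q) 2.
Proof.
move=> kq; have [e0 _] : exists e0 : E, e0 \in E by apply/card_gt0P.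
have -> : 2%N = \dim (q @: cycle_space).
  by have := dim_newton e0 kq; rewrite dim_cycle_space_torus; clear; lia.
have -> : newton_polygon s0 s1 q = conv (q @` (to_real R @` matchings s0 s1)).
  rewrite /newton_polygon; congr conv; apply/seteqP; split.
    by move=> _ [m mm <-]; exists (to_real R m) => //; exists m.
  by move=> _ [_ [m mm <-] <-]; exists m.
apply: has_dim_image_conv; [exact: polytope_nonempty|exact: polytope_sub|].
exact: polytope_span.
Qed.

End PermutedWeights.

Theorem proposition2p2 (R : realType) (F : plane R -> 'F_2)
    (L : set (plane R)) (S : superpotential F L)
    (E := eclass S) (s0 : {perm E} := sigma0 S) (s1 : {perm E} := sigma1 S) :
  zebra F -> zebra_convex F ->
  lattice L -> L `<=` zAut F ->
  dimer_complete s0 s1 ->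
  (exists nu1 nu2 nu3, weight_realization (S := S) nu1 nu2 nu3) ->
  [/\ (* (i) *)
      matching_polytope s0 s1 R =
        [set theta : {ffun E -> R^o} |
           [/\ forall e, 0 <= theta e,
               forall w, w \in Pwhite s0 ->
                 \sum_(e | wpoly s0 e == w) theta e = 1
             & forall b, b \in Pblack s1 ->
                 \sum_(e | bpoly s1 e == b) theta e = 1]]
      /\ extreme_points (matching_polytope s0 s1 R)
           = [set to_real R m | m in matchings s0 s1],
      (* (ii) *)
      weights s0 s1 = Nspan (matchings s0 s1)
      /\ weight_classes s0 s1 = Nspan (matching_classes s0 s1)
    & (* (iii) *)
      has_dim (matching_polytope s0 s1 R) (#|Pstar s0 s1| + 1)
      /\ forall (Q : vectType R) (q : 'Hom({ffun E -> R^o}, Q)),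
           lker q = alpha_space s0 s1 R -> limg q = fullv ->
           has_dim (newton_polygon s0 s1 q) 2].
Proof.
move=> zF cF _ _ dc _.
have E0 := torus_nonempty zF cF S.
have conn := torus_connected zF cF (S := S).
have euler := euler_torus zF cF S.
split; [split|split|split].
- by rewrite matching_polytopeE feasibleE.
- by rewrite matching_polytopeE feasible_extreme matchingsE.
- exact: (weights_generated R).
- exact: (weight_classes_generated R).
- exact: has_dim_polytope.
by move=> Q q kq _; exact: has_dim_newton.
Qed.
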